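(* Let $n,m$ be positive integers and let $M$ be an $(n-1)$-dimensional compact oriented minimal submanifold of the unit sphere $S^{n+m-1}\subset\mathbb{R}^{n+m}$. Suppose that there is a fixed oriented $m$-plane $Q_0$ (an oriented $m$-dimensional linear subspace of $\mathbb{R}^{n+m}$) such that $\langle N,Q_0\rangle\ge \frac13$ holds for all normal $m$-planes $N$ of $M$. Then $M$ is totally geodesic in $S^{n+m-1}$.
   Context: Submanifolds are smooth, possibly immersed, and compact means compact without boundary. For $p\in M$, the normal $m$-plane of $M$ at $p$ is the normal space $N_pM\subset T_pS^{n+m-1}$ of $M$ in the sphere, which is $m$-dimensional and is regarded, by parallel translation in $\mathbb{R}^{n+m}$, as an oriented $m$-dimensional linear subspace of $\mathbb{R}^{n+m}$ (the orientation being the one induced from the orientation of $M$, continuous in $p$). For oriented $m$-dimensional subspaces $N,Q_0$ of $\mathbb{R}^{n+m}$ with oriented orthonormal bases $\{u_1,\dots,u_m\}$ of $N$ and $\{\varepsilon_1,\dots,\varepsilon_m\}$ of $Q_0$, one sets $\langle N,Q_0\rangle:=\langle u_1\wedge\cdots\wedge u_m,\varepsilon_1\wedge\cdots\wedge\varepsilon_m\rangle=\det(\langle u_\alpha,\varepsilon_\beta\rangle)_{1\le\alpha,\beta\le m}$; this does not depend on the choice of oriented orthonormal bases. Minimal means that the mean curvature vector (the trace of the second fundamental form of $M$ in $S^{n+m-1}$) vanishes identically; totally geodesic means that the second fundamental form vanishes identically. *)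

(* Defs.v *)
From HB Require Import structures.
From mathcomp Require Import all_boot all_order all_algebra.
From mathcomp Require Import all_classical all_reals all_analysis.

Set Implicit Arguments.
Unset Strict Implicit.
Unset Printing Implicit Defensive.
Import Order.TTheory GRing.Theory Num.Theory.
Import numFieldNormedType.Exports.
Local Open Scope classical_set_scope.
Local Open Scope ring_scope.

Section smooth_maps.
Context {R : realType} {k d : nat}.

Fixpoint differentiable_upto (r : nat) (U : set 'rV[R]_k)
    (f : 'rV[R]_k -> 'rV[R]_d) : Prop :=
  if r is s.+1 then
    (forall x, U x -> differentiable f x) /\
    (forall v, differentiable_upto s U ('D_v f))
  else True.

(* Meaningful for open U; being differentiable to all orders is the same as
   being of class C^oo. *)
Definition smooth_on (U : set 'rV[R]_k) (f : 'rV[R]_k -> 'rV[R]_d) : Prop :=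
  forall r, differentiable_upto r U f.

End smooth_maps.

(* A smooth oriented k-manifold structure on M. A chart is given by its inverse
   [param i], defined on the open set [dom i] of R^k, together with
   [coord i], which is only relevant on the patch [param i @` dom i].
   The orientation is a sign for each chart: a chart with [flip i = false]
   is positively oriented and one with [flip i = true] is negatively oriented.
   Signs are needed, rather than only positively oriented charts, for k = 0,
   where an orientation is an arbitrary choice of sign at each point. *)
Record oriented_atlas (R : realType) (k : nat) (M : topologicalType) :=
  OrientedAtlas {
  chart : Type;
  dom : chart -> set 'rV[R]_k;
  param : chart -> 'rV[R]_k -> M;
  coord : chart -> M -> 'rV[R]_k;
  flip : chart -> bool;
  dom_open : forall i, open (dom i);
  patch_open : forall i, open (param i @` dom i);
  param_continuous : forall i x, dom i x -> {for x, continuous (param i)};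
  coord_continuous : forall i x, dom i x ->
    {for param i x, continuous (coord i)};
  paramK : forall i x, dom i x -> coord i (param i x) = x;
  patch_cover : forall p, exists i, (param i @` dom i) p;
  transition_smooth : forall i j,
    smooth_on (dom i `&` param i @^-1` (param j @` dom j))
      (coord j \o param i);
  transition_oriented : forall i j x,
    dom i x -> (param j @` dom j) (param i x) ->
    0 < (-1) ^+ (flip i (+) flip j) * \det ('J (coord j \o param i) x)
}.

Section oriented_planes.
Context {R : realType} {m d : nat}.
Implicit Types (u : 'M[R]_(m, d)) (N Q : set 'M[R]_(m, d)).

Definition dotp (v w : 'rV[R]_d) : R := (v *m w^T) 0 0.

Definition orthonormal u : Prop := u *m u^T = 1%:M.

Definition special_orthogonal : set 'M[R]_m :=
  [set A | A *m A^T = 1%:M /\ \det A = 1].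

(* An oriented m-dimensional subspace of R^d is identified with the set of its
   oriented orthonormal bases (listed as the rows of a matrix), that is, with
   an orbit of SO(m) on orthonormal m-frames. *)
Definition oriented_plane Q : Prop :=
  exists2 u, orthonormal u & Q = [set A *m u | A in special_orthogonal].

(* <N, Q> is computed on chosen bases; see plane_ipE for independence. *)
Definition plane_ip N Q : R := \det (xget 0 N *m (xget 0 Q)^T).

Lemma plane_ipE N Q u e : oriented_plane N -> oriented_plane Q ->
  N u -> Q e -> plane_ip N Q = \det (u *m e^T).
Proof.
move=> [u0 _ ->] [e0 _ ->] Nu Qe; rewrite /plane_ip.
have := @xgetI _ 0 _ _ Nu; have := @xgetI _ 0 _ _ Qe.
case: Nu Qe => [A [_ dA] <-] [B [_ dB] <-].
case=> B' [_ dB'] <- [A' [_ dA'] <-].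
by rewrite !trmx_mul !mulmxA -!(mulmxA _ u0) !det_mulmx !det_tr dA dB dA' dB'.
Qed.

End oriented_planes.

(* Orthogonal projection v |-> v *m orth_proj A onto the row space of A,
   for A with linearly independent rows. *)
Definition orth_proj {R : realType} {k d : nat} (A : 'M[R]_(k, d)) : 'M[R]_d :=
  A^T *m invmx (A *m A^T) *m A.

Section spherical_submanifolds.
Context {R : realType} {k d : nat} {M : topologicalType}.
Variables (A : oriented_atlas R k M) (F : M -> 'rV[R]_d).

Definition local_map (i : chart A) : 'rV[R]_k -> 'rV[R]_d := F \o param i.

(* The rows of ['J f x] are the partial derivatives of f at x. *)
Definition spherical_immersion : Prop :=
  [/\ forall p, dotp (F p) (F p) = 1,
      forall i : chart A, smooth_on (dom i) (local_map i) &
      forall (i : chart A) x, dom i x -> row_free ('J (local_map i) x)].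

(* The second fundamental form B(v, w) in the sphere, at the point of
   coordinates x, of the tangent vectors with coordinates v and w. The vector
   fields V, W with constant coordinates v, w have D_V W = 'D_v ('D_w f) in the
   ambient space; its part tangent to the sphere is the Levi-Civita derivative
   in the sphere, and B(V, W) is the part of the latter normal to M. *)
Definition second_fundamental_form (i : chart A) (x v w : 'rV[R]_k) :
    'rV[R]_d :=
  let f := local_map i in
  let ambient := 'D_v ('D_w f) x in
  let spherical := ambient - dotp ambient (f x) *: f x in
  spherical - spherical *m orth_proj ('J f x).

Definition metric (i : chart A) (x : 'rV[R]_k) : 'M[R]_k :=
  'J (local_map i) x *m ('J (local_map i) x)^T.

Definition mean_curvature (i : chart A) (x : 'rV[R]_k) : 'rV[R]_d :=
  \sum_a \sum_b invmx (metric i x) a b *: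
    second_fundamental_form i x (delta_mx 0 a) (delta_mx 0 b).

Definition minimal : Prop :=
  forall (i : chart A) x, dom i x -> mean_curvature i x = 0.

Definition totally_geodesic : Prop :=
  forall (i : chart A) x, dom i x ->
  forall v w, second_fundamental_form i x v w = 0.

End spherical_submanifolds.

(* The oriented normal plane at p, as the set of its oriented orthonormal bases:
   u is orthogonal to F p (hence tangent to the sphere) and to the tangent
   space of M, and (F p, e, u) is a positive basis of R^(k + 1 + m) for e a
   positive basis of the tangent space. Reversing this convention reverses all
   normal planes simultaneously. *)
Definition normal_plane {R : realType} {k m : nat} {M : topologicalType}
    (A : oriented_atlas R k M) (F : M -> 'rV[R]_(k.+1 + m)) (p : M) :
    set 'M[R]_(m, k.+1 + m) :=
  [set u | [/\ orthonormal u, u *m (F p)^T = 0 &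
    forall (i : chart A) x, dom i x -> param i x = p ->
      let J := 'J (local_map F i) x in
      u *m J^T = 0 /\
      0 < (-1) ^+ flip i *
          \det (col_mx (F p) (col_mx J u) : 'M[R]_(k.+1 + m))]].

(* Main.v *)
(* Let J be the Jacobian of a local parametrization f of M, and write the cone
   over M, spanned by f and the rows of J, as a graph over the orthogonal
   complement of Q0, with slope matrix Z. Then D = det (1 + Z Z^T) is
   <N, Q0>^-2, hence at most 9. Minimality makes Z harmonic up to terms
   quadratic in its first derivatives, and therefore the Laplacian of D is 2 D
   times a quadratic form in the second fundamental form h. In frames adapted to
   the singular values l_i of Z this is
     sum h_{a,ij}^2 + sum l_a l_i h_{a,ij} h_{i,aj} + 2 sum_j (sum_a l_a h_{a,aj})^2,
   and the bound prod (1 + l_i^2) <= 9 makes it nonnegative. It can vanish with h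
   nonzero only where l_1^2 = l_2^2 = 2 and the other l_i are 0; since the radial
   direction of the cone is a null direction of h, this forces f to be orthogonal
   to Q0.
   So D is subharmonic, and by Hopf's strong maximum principle it is locally
   constant, M being compact. Hence near each point h vanishes or f takes its
   values in the orthogonal complement of Q0; in the latter case Z = 0, and h
   vanishes as well. *)

Require Import Defs.
From HB Require Import structures.
From mathcomp Require Import all_boot all_order all_algebra.
From mathcomp Require Import perm ring lra.
From mathcomp Require Import all_classical all_reals all_analysis.
Set Implicit Arguments.
Unset Strict Implicit.
Unset Printing Implicit Defensive.
Import Order.TTheory GRing.Theory Num.Theory.
Import numFieldNormedType.Exports.
Local Open Scope classical_set_scope.
Local Open Scope ring_scope.

(** * Quadratic forms under a bound on the slopes *)

(** The number 9 is where this form first degenerates: on triples of distinct indices, the least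
    product at which definiteness is lost is [(1 + 2) * (1 + 2)]. The function studied is [D] and
    not its logarithm because the Laplacian of [log D] only produces the first two sums of the form.
    For coefficients that are symmetric but otherwise arbitrary, these two sums can be negative
    within the bound, for instance when two slopes have squares 3 and 5/4 and an index of [h] is
    repeated; the third sum, which comes from the gradient of [D], repairs this. Singular values and
    their frames need not depend smoothly on the point, so no adapted frame is ever differentiated.
    The equation for [Z] and the Laplacian of [D] are matrix and trace identities among partial
    derivatives of [f] up to order three in an arbitrary chart; singular values enter afterwards, at
    a fixed point, only to determine a sign. *)

Section algebraic_inequality.
Variable R : realFieldType.
Implicit Types (x y z a b c p q s u v l : R).

(* (4 + abc - ab - bc - ca) / 4 is the determinant of [triple_form] below, for
   a, b, c the squares of l1, l2, l3. *)
Lemma e2_le_of_sqrt a b c s : 0 <= c -> c <= a -> c <= b -> 0 <= s -> s ^+ 2 = a * b ->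
  (1 + a) * (1 + b) * (1 + c) <= 9 ->
  a * b + b * c + a * c <= 4 + a * b * c /\
  (a * b + b * c + a * c = 4 + a * b * c -> c = 0 /\ s = 2).
Proof.
move=> c0 ca cb s0 sab h.
have a0 : 0 <= a by lra.
have b0 : 0 <= b by lra.
have u9 : (1 + s) ^+ 2 * (1 + c) <= 9.
  apply: le_trans h; rewrite ler_wpM2r //; first by lra.
  have : (s *+ 2) ^+ 2 <= (a + b) ^+ 2.
    by have := sqr_ge0 (a - b); nra.
  by rewrite ler_sqr ?nnegrE ?mulrn_wge0 ?addr_ge0 // => sab2; nra.
pose X := a * b + b * c + a * c - (4 + a * b * c).
(* Adding [c] times the slack of the product bound eliminates [a + b], so that only [s] and [c]
   remain. The sign of [1 - 2 * c] then decides whether [s] has to be bounded from above or from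
   below. *)
have hX : (1 + c) * X <= s ^+ 2 * (1 + c) * (1 - 2 * c) + 4 * c - c ^+ 2 - 4.
  have -> : s ^+ 2 * (1 + c) * (1 - 2 * c) + 4 * c - c ^+ 2 - 4
     = (1 + c) * X + c * (9 - (1 + a) * (1 + b) * (1 + c)).
    by rewrite /X sab; ring.
  by rewrite lerDl mulr_ge0 // subr_ge0.
suff : X <= 0 /\ (X = 0 -> c = 0 /\ s = 2).
  rewrite /X subr_le0 => -[-> H]; split=> // e; apply: H.
  by rewrite e subrr.
have [c2|c2] := leP c (1/2).
  (* The bound [u9] says [s <= 3 / sqrt (1 + c) - 1]; the right side here is the Taylor polynomial
     of order two of that function at [c = 0]. *)
  have us : s <= 2 - 3/2 * c + 9/8 * c ^+ 2.
    rewrite leNgt; apply/negP => us.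
    set v := 3 - 3/2 * c + 9/8 * c ^+ 2.
    have v0 : 0 <= v by rewrite /v; nra.
    have v1 : v ^+ 2 < (1 + s) ^+ 2 by rewrite ltr_sqr ?nnegrE /v//; lra.
    have : 9 <= v ^+ 2 * (1 + c).
      have -> : v ^+ 2 * (1 + c) = 9 + c ^+ 3 * (9 * (5/8) - 9 * (15/64) * c + 81/64 * c ^+ 2).
        by rewrite /v; field.
      by rewrite lerDl mulr_ge0 ?exprn_ge0 //; nra.
    suff : v ^+ 2 * (1 + c) < (1 + s) ^+ 2 * (1 + c) by lra.
    by rewrite ltr_pM2r //; lra.
  have ps : s ^+ 2 * (1 + c) <= 4 - 2 * c + 3 * c ^+ 2.
    have : s ^+ 2 <= (2 - 3/2 * c + 9/8 * c ^+ 2) ^+ 2.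
      by rewrite ler_sqr ?nnegrE //; nra.
    rewrite -(@ler_pM2r _ (1 + c)); last by lra.
    move/le_trans; apply; rewrite -subr_ge0.
    set p := (X in 0 <= X).
    have -> : p = c ^+ 2 * (9/4 - 27/8 * c + 27/8 * c ^+ 2 - 81/64 * c ^+ 2 - 81/64 * c ^+ 3).
      by rewrite /p; field.
    by apply: mulr_ge0; [exact: sqr_ge0|nra].
  have hX2 : (1 + c) * X <= - (6 * c * (1 - c + c ^+ 2)).
    apply: le_trans hX _.
    have : s ^+ 2 * (1 + c) * (1 - 2 * c) <= (4 - 2 * c + 3 * c ^+ 2) * (1 - 2 * c).
      by rewrite ler_wpM2r //; lra.
    by lra.
  have c1 : 0 < 1 - c + c ^+ 2 by nra.
  split.
    rewrite -(@pmulr_rle0 _ (1 + c)); last by lra.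
    by apply: le_trans hX2 _; rewrite oppr_le0 !mulr_ge0 ?(ltW c1).
  move=> X0; move: hX2; rewrite X0 mulr0 oppr_ge0 pmulr_lle0 // => c00.
  have {c00}c00 : c = 0 by lra.
  split=> //; move: X0; rewrite /X c00 => X0.
  have : (s - 2) * (s + 2) = 0 by nra.
  by move/eqP; rewrite mulf_eq0 => /orP[]/eqP; lra.
suff X0 : X < 0 by split; [lra|move=> X1; lra].
rewrite -(@pmulr_rlt0 _ (1 + c)); last by lra.
apply: le_lt_trans hX _.
(* Now [1 - 2 * c < 0], so a lower bound on [s] is what counts. Together with [u9] it also gives
   [(1 + c) ^+ 3 <= 9], which confines [c] below 11/10. *)
have pc : c ^+ 2 <= s ^+ 2 by rewrite sab; nra.
have c3 : (1 + c) ^+ 3 <= 9 by apply: le_trans u9; rewrite exprS mulrC ler_wpM2r//; nra.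
have c4 : c < 11/10 by rewrite ltNge; apply/negP => c4; nra.
have : s ^+ 2 * (1 + c) * (1 - 2 * c) <= c ^+ 2 * (1 + c) * (1 - 2 * c).
  by rewrite ler_wnM2r //; nra.
move=> h1; apply: (@le_lt_trans _ _ (4 * c - 4 - c ^+ 3 - 2 * c ^+ 4)).
  by lra.
have c5 : 1/2 * c < c ^+ 2 by nra.
have c6 : 1/2 * c ^+ 2 < c ^+ 3 by nra.
have c7 : 0 < c ^+ 4 by rewrite exprn_gt0//; lra.
by nra.
Qed.

(** The share of [gauss_form] carried by three distinct indices: [x], [y], [z] stand for [h a i j],
    [h i j a], [h j a i], each paired with the slope of its normal index. *)
Definition triple_form l1 l2 l3 x y z :=
  x ^+ 2 + y ^+ 2 + z ^+ 2 + l1 * l2 * x * y + l2 * l3 * y * z + l1 * l3 * x * z.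

(** If [(l1 * l2) ^+ 2 < 4], completing squares leaves the determinant, up to a factor, as last
    coefficient, and the equality case of [e2_le_of_sqrt] keeps it positive. If
    [(l1 * l2) ^+ 2 = 4], the product bound is attained: the squares are 2, 2, 0 and the form is
    [(x + y) ^+ 2 + z ^+ 2] or [(x - y) ^+ 2 + z ^+ 2]. *)
Lemma triple_form_sorted l1 l2 l3 x y z :
  l3 ^+ 2 <= l1 ^+ 2 -> l3 ^+ 2 <= l2 ^+ 2 ->
  (1 + l1 ^+ 2) * (1 + l2 ^+ 2) * (1 + l3 ^+ 2) <= 9 ->
  0 <= triple_form l1 l2 l3 x y z /\
  (triple_form l1 l2 l3 x y z = 0 ->
   (x = 0 /\ y = 0 /\ z = 0) \/
   (l1 ^+ 2 = 2 /\ l2 ^+ 2 = 2 /\ l3 = 0 /\ z = 0 /\ x ^+ 2 = y ^+ 2)).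
Proof.
move=> h31 h32 h9.
have c0 := sqr_ge0 l3.
have [e2 e2eq] : _ /\ _ := e2_le_of_sqrt c0 h31 h32 (normr_ge0 (l1 * l2))
  (etrans (real_normK (num_real _)) (exprMn _ _ _)) h9.
have ab4 : (l1 * l2) ^+ 2 <= 4.
  have : 0 <= (l1 ^+ 2) + (l2 ^+ 2) - 2 * `|l1 * l2|.
    have -> : l1 ^+ 2 + l2 ^+ 2 - 2 * `|l1 * l2| = (`|l1| - `|l2|) ^+ 2.
      by rewrite normrM sqrrB !real_normK ?num_real//; ring.
    exact: sqr_ge0.
  move=> h; rewrite -(real_normK (num_real (l1 * l2))).
  move: (normr_ge0 (l1 * l2)) h.
  have : (1 + l1 ^+ 2) * (1 + l2 ^+ 2) <= 9.
    apply: le_trans h9; rewrite ler_peMr ?lerDl//.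
    by rewrite mulr_ge0 ?addr_ge0 ?sqr_ge0.
  have : (l1 ^+ 2) * (l2 ^+ 2) = `|l1 * l2| ^+ 2 by rewrite real_normK ?num_real// exprMn.
  set s := `|_|; move=> e1 e3 s0 h; have s2 : s <= 2 by nra.
  by nra.
move: ab4; rewrite le_eqVlt => /orP[/eqP ab4|ab4].
  have [a2 [b2 c20]] : l1 ^+ 2 = 2 /\ l2 ^+ 2 = 2 /\ l3 ^+ 2 = 0.
    move: h9 ab4 c0; rewrite exprMn; have := sqr_ge0 (l1 ^+ 2 - l2 ^+ 2).
    have := sqr_ge0 l1; have := sqr_ge0 l2.
    set a := l1 ^+ 2; set b := l2 ^+ 2; set c := l3 ^+ 2 => b0 a0 h1 h2 h3 c0.
    have ab : 4 <= a + b by nra.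
    have cab : 0 <= c * (a + b - 4) by rewrite mulr_ge0// subr_ge0.
    have c00 : c = 0 by nra.
    have ab2 : a + b = 4 by move: h2; rewrite c00; nra.
    have ab' : a = b by apply/eqP; rewrite -subr_eq0 -sqrf_eq0; apply/eqP; nra.
    by split; lra.
  have l30 : l3 = 0 by apply/eqP; rewrite -sqrf_eq0 c20.
  have : l1 * l2 = 2 \/ l1 * l2 = - 2.
    have : (l1 * l2 - 2) * (l1 * l2 + 2) = 0 by nra.
    by move/eqP; rewrite mulf_eq0 => /orP[]/eqP; [left|right]; lra.
  rewrite /triple_form l30 => -[] -> ; split.
  - by have := sqr_ge0 (x + y); have := sqr_ge0 z; lra.
  - move=> h; right; have h1 : (x + y) ^+ 2 + z ^+ 2 = 0 by lra.
    move/eqP: h1; rewrite paddr_eq0 ?sqr_ge0// !sqrf_eq0 => /andP[/eqP h1 /eqP h2].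
    by rewrite h2 (_ : y = - x) ?sqrrN; last lra.
  - by have := sqr_ge0 (x - y); have := sqr_ge0 z; lra.
  move=> h; right; have h1 : (x - y) ^+ 2 + z ^+ 2 = 0 by lra.
  move/eqP: h1; rewrite paddr_eq0 ?sqr_ge0// !sqrf_eq0 => /andP[/eqP h1 /eqP h2].
  by rewrite h2 (_ : y = x); last lra.
have e2lt : 0 < 4 + l1 ^+ 2 * l2 ^+ 2 * l3 ^+ 2 - (l1 ^+ 2 * l2 ^+ 2 + l2 ^+ 2 * l3 ^+ 2 + l1 ^+ 2
  * l3 ^+ 2).
  rewrite lt_def subr_ge0 e2 andbT subr_eq0; apply/eqP => /esym/e2eq[_ h].
  by move: ab4; rewrite -(real_normK (num_real _)) h; lra.
set A := x + l1 * l2 * y / 2 + l1 * l3 * z / 2.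
set B := (4 - (l1 * l2) ^+ 2) * y + l2 * l3 * (2 - l1 ^+ 2) * z.
set D := (X in 0 < X) in e2lt.
have E : (4 - (l1 * l2) ^+ 2) * 4 * triple_form l1 l2 l3 x y z =
  (4 - (l1 * l2) ^+ 2) * 4 * A ^+ 2 + B ^+ 2 + 4 * D * z ^+ 2.
  by rewrite /triple_form /A /B /D; field.
have k0 : 0 < (4 - (l1 * l2) ^+ 2) * 4 by lra.
have t1 : 0 <= (4 - (l1 * l2) ^+ 2) * 4 * A ^+ 2 by rewrite mulr_ge0 ?sqr_ge0 ?ltW.
have t2 := sqr_ge0 B.
have t3 : 0 <= 4 * D * z ^+ 2 by rewrite mulr_ge0 ?sqr_ge0//; lra.
split; first by rewrite -(pmulr_rge0 _ k0) E !addr_ge0.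
move=> h; left; move: E; rewrite h mulr0 => /esym/eqP.
rewrite !paddr_eq0 ?addr_ge0// => /andP[/andP[]].
rewrite mulf_eq0 (gt_eqF k0)/= sqrf_eq0 => /eqP A0.
rewrite sqrf_eq0 => /eqP B0.
rewrite mulf_eq0 sqrf_eq0 => /orP[/eqP|/eqP z0]; first by lra.
move: B0; rewrite /B z0 mulr0 addr0 => /eqP; rewrite mulf_eq0 => /orP[/eqP|/eqP y0]; first by lra.
by move: A0; rewrite /A y0 z0; lra.
Qed.

(** The form is invariant under simultaneous permutations of the pairs [(l1, x)], [(l2, y)],
    [(l3, z)], which brings the slope of least square into third position. *)
Lemma triple_form_ge0 l1 l2 l3 x y z :
  (1 + l1 ^+ 2) * (1 + l2 ^+ 2) * (1 + l3 ^+ 2) <= 9 ->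
  0 <= triple_form l1 l2 l3 x y z /\
  (triple_form l1 l2 l3 x y z = 0 -> x != 0 ->
   l1 ^+ 2 = 2 /\
   ((l2 ^+ 2 = 2 /\ l3 = 0 /\ y != 0) \/ (l3 ^+ 2 = 2 /\ l2 = 0 /\ z != 0))).
Proof.
have sq0 u v : u ^+ 2 = v ^+ 2 -> u != 0 -> v != 0.
  by move=> h; rewrite -(sqrf_eq0 u) -(sqrf_eq0 v) h.
move=> h9; have [h12|h12] := leP (l1 ^+ 2) (l2 ^+ 2).
  have [h13|h13] := leP (l1 ^+ 2) (l3 ^+ 2).
    have E : triple_form l1 l2 l3 x y z = triple_form l2 l3 l1 y z x by rewrite /triple_form; ring.
    rewrite E; have [||//|-> H] := @triple_form_sorted l2 l3 l1 y z x; [lra..|].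
    by split=> // /H[[_ [_ ->]]|[_ [_ [_ [-> _]]]]]; rewrite eqxx.
  have [||//|-> H] := @triple_form_sorted l1 l2 l3 x y z; [lra..|].
  split=> // /H[[->]|[-> [-> [-> [_ h]]]]]; first by rewrite eqxx.
  by move=> x0; split=> //; left; do !split=> //; exact: sq0 h _.
have [h23|h23] := leP (l2 ^+ 2) (l3 ^+ 2).
  have E : triple_form l1 l2 l3 x y z = triple_form l1 l3 l2 x z y by rewrite /triple_form; ring.
  rewrite E; have [||//|-> H] := @triple_form_sorted l1 l3 l2 x z y; [lra..|].
  split=> // /H[[->]|[-> [-> [-> [_ h]]]]]; first by rewrite eqxx.
  by move=> x0; split=> //; right; do !split=> //; exact: sq0 h _.
have [||//|-> H] := @triple_form_sorted l1 l2 l3 x y z; [lra..|].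
split=> // /H[[->]|[-> [-> [-> [_ h]]]]]; first by rewrite eqxx.
by move=> x0; split=> //; left; do !split=> //; exact: sq0 h _.
Qed.

Lemma one_plus_sum_le_prod (I : finType) (P : pred I) (a : I -> R) :
  (forall i, 0 <= a i) ->
  1 + \sum_(i | P i) a i <= \prod_(i | P i) (1 + a i).
Proof.
move=> a0.
suff : 0 <= \sum_(i | P i) a i /\ 1 + \sum_(i | P i) a i <= \prod_(i | P i) (1 + a i) by case.
elim/big_ind2: _ => [|p q s t [p0 pq] [s0 st]|i _]; first by rewrite addr0.
  split; first exact: addr_ge0.
  apply: le_trans (_ : (1 + p) * (1 + s) <= _); first by have := mulr_ge0 p0 s0; lra.
  by apply: ler_pM => //; lra.
by split.
Qed.

Lemma cauchy_schwarz_sum (I : finType) (P : pred I) (u v : I -> R) :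
  (\sum_(i | P i) u i * v i) ^+ 2 <=
  (\sum_(i | P i) u i ^+ 2) * (\sum_(i | P i) v i ^+ 2).
Proof.
set A := \sum_(i | P i) u i ^+ 2; set B := \sum_(i | P i) _ * _; set C := \sum_(i | P i) _.
have A0 : 0 <= A by apply: sumr_ge0 => i _; exact: sqr_ge0.
have q t : 0 <= A * t ^+ 2 + 2 * B * t + C.
  have -> : A * t ^+ 2 + 2 * B * t + C = \sum_(i | P i) (u i * t + v i) ^+ 2.
    rewrite /A /B /C mulr_suml mulr_sumr mulr_suml -!big_split/=.
    by apply: eq_bigr => i _; ring.
  by apply: sumr_ge0 => i _; exact: sqr_ge0.
have [A00|A00] := eqVneq A 0.
  have u0 i : P i -> u i = 0.
    move: A00 => /eqP; rewrite psumr_eq0; last by move=> ? _; exact: sqr_ge0.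
    by move=> /allP/(_ i (mem_index_enum _)) /implyP h /h; rewrite sqrf_eq0 => /eqP.
  by rewrite A00 mul0r /B big1 ?expr0n// => i /u0->; rewrite mul0r.
have Ap : 0 < A by rewrite lt_def A00.
have := q (- B / A); have -> : A * (- B / A) ^+ 2 + 2 * B * (- B / A) + C = (A * C - B ^+ 2) / A by
  field.
by rewrite pmulr_lge0 ?invr_gt0// subr_ge0.
Qed.

(* The coefficient 2 + l_i^2 (1 - l_j^2) of x_i^2 is negative for at most one i,
   and then 2 <= l_j^2 <= 5; x0 is that x_i, while r and t gather the others. *)
Lemma axis_form_scalar l0 l x0 r z t :
  2 <= l ^+ 2 <= 5 -> (1 + l ^+ 2) * (1 + l0 ^+ 2) <= 9 -> 8 * r ^+ 2 <= t ->
  let T := (1 + l ^+ 2) * z ^+ 2 + 2 * (l * z + (l0 * x0 + r)) ^+ 2 +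
    ((2 + l0 ^+ 2 * (1 - l ^+ 2)) * x0 ^+ 2 + 3/2 * t) in
  0 <= T /\ (T = 0 -> [/\ z = 0, x0 = 0 & t = 0]).
Proof.
move=> /andP[b2 b5] h9 rt /=.
set b := l ^+ 2 in b2 b5 h9 *; set S := l0 * x0 + r; set a := l0 ^+ 2 in h9 *.
set T := (X in 0 <= X).
have a0 : 0 <= a := sqr_ge0 _.
(* The constants come from minimizing one variable at a time. Over [z], the first two terms are at
   least [(2 + 2 * b) / (1 + 3 * b) * S ^+ 2], hence at least [3/4 * S ^+ 2] since [b <= 5]. With
   [1/8 * t] kept in reserve, what is left of [t] is [11/8 * t >= 11 * r ^+ 2]. Over [r], the sum
   [11 * r ^+ 2 + 3/4 * S ^+ 2] is at least [33/47 * a * x0 ^+ 2], where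
   [33/47 = 11 * (3/4) / (11 + 3/4)]. *)
have ca : 0 < 2 + a * (1 - b) + 33/47 * a.
  rewrite -(@pmulr_rgt0 _ (1 + a)); last lra.
  have -> : (1 + a) * (2 + a * (1 - b) + 33/47 * a) =
     (127 * a ^+ 2 - 202 * a + 94) / 47 + a * (9 - (1 + b) * (1 + a)) by field.
  apply: ltr_wpDr; first by rewrite mulr_ge0// subr_ge0.
  by apply: divr_gt0 => //; have := sqr_ge0 (127 * a - 101); lra.
have zS : 0 <= (1 + b) * z ^+ 2 + 2 * (l * z + S) ^+ 2 - 3/4 * S ^+ 2.
  rewrite -(@pmulr_rge0 _ (1 + 3 * b)); last lra.
  have -> : (1 + 3 * b) * ((1 + b) * z ^+ 2 + 2 * (l * z + S) ^+ 2 - 3/4 * S ^+ 2) =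
    ((1 + 3 * b) * z + 2 * l * S) ^+ 2 + (5/4 - b/4) * S ^+ 2 by rewrite /b; field.
  by apply: addr_ge0; [exact: sqr_ge0|apply: mulr_ge0; [lra|exact: sqr_ge0]].
have rS : 0 <= 11 * r ^+ 2 + 3/4 * S ^+ 2 - 33/47 * (a * x0 ^+ 2).
  have -> : 11 * r ^+ 2 + 3/4 * S ^+ 2 - 33/47 * (a * x0 ^+ 2) =
    47/4 * (r + 3/47 * l0 * x0) ^+ 2 by rewrite /S /a; field.
  by apply: mulr_ge0; [lra|exact: sqr_ge0].
have Tge : 1/8 * t + (2 + a * (1 - b) + 33/47 * a) * x0 ^+ 2 <= T by rewrite /T; lra.
have t0 : 0 <= t by have := sqr_ge0 r; lra.
have x00 : 0 <= (2 + a * (1 - b) + 33/47 * a) * x0 ^+ 2 by rewrite mulr_ge0 ?sqr_ge0// ltW.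
split; first by apply: le_trans Tge; rewrite addr_ge0//; lra.
move=> T0; have t00 : t = 0 by lra.
have : (2 + a * (1 - b) + 33/47 * a) * x0 ^+ 2 = 0 by lra.
move/eqP; rewrite mulf_eq0 (gt_eqF ca)/= sqrf_eq0 => /eqP x0_0.
have r0 : r = 0 by apply/eqP; rewrite -sqrf_eq0; apply/eqP; have := sqr_ge0 r; lra.
split=> //; apply/eqP; rewrite -sqrf_eq0; apply/eqP; move: T0.
rewrite /T /S x0_0 r0 t00 => T0; have := sqr_ge0 z; move: T0;
  rewrite mulr0 !addr0 expr0n/= !mulr0 !addr0 exprMn -/b.
by nra.
Qed.

(** The share of [gauss_form] in which [j] occurs once next to a repeated index, or three times: [z]
    is [h j j j], [x i] is [h i i j] and [y i] is [h j i i]. *)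
Definition axis_form (I : finType) (l x y : I -> R) (j : I) (z : R) : R :=
  (1 + l j ^+ 2) * z ^+ 2
  + \sum_(i | i != j) ((2 + l i ^+ 2) * x i ^+ 2 + y i ^+ 2 + 2 * l j * l i * x i * y i)
  + 2 * (l j * z + \sum_(i | i != j) l i * x i) ^+ 2.

(** Completing the square in each [y i] leaves [c i * x i ^+ 2] with
    [c i = 2 + l i ^+ 2 * (1 - l j ^+ 2)]. If some [c i0 <= 0], then
    [(1 + l j ^+ 2) * (1 + l i0 ^+ 2)] is already at least 8, so the squares of the other slopes sum
    to at most 1/8 and their coefficients are at least 3/2; [axis_form_scalar] shows that the
    remaining terms make up for [c i0]. *)
Lemma axis_form_ge0 (I : finType) (l x y : I -> R) (j : I) (z : R) :
  \prod_i (1 + l i ^+ 2) <= 9 ->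
  0 <= axis_form l x y j z /\
  (axis_form l x y j z = 0 -> z = 0 /\ forall i, i != j -> x i = 0 /\ y i = 0).
Proof.
move=> h9; set c := fun i => 2 + l i ^+ 2 * (1 - l j ^+ 2).
set S := \sum_(i | i != j) l i * x i.
set T := (1 + l j ^+ 2) * z ^+ 2 + 2 * (l j * z + S) ^+ 2 + \sum_(i | i != j) c i * x i ^+ 2.
set V := \sum_(i | i != j) (y i + l j * l i * x i) ^+ 2.
have -> : axis_form l x y j z = T + V.
  rewrite /axis_form -/S /T /V -!addrA; congr (_ + _).
  rewrite [LHS]addrC; congr (_ + _); rewrite -big_split/=.
  by apply: eq_bigr => i _; rewrite /c; ring.
have V0 : 0 <= V by apply: sumr_ge0 => i _; exact: sqr_ge0.
suff [T0 Teq] : 0 <= T /\ (T = 0 -> z = 0 /\ forall i, i != j -> x i = 0).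
  split; first exact: addr_ge0.
  move/eqP; rewrite paddr_eq0// => /andP[/eqP/Teq[-> x0]].
  rewrite psumr_eq0; last by move=> ? _; exact: sqr_ge0.
  move/allP => y0; split=> // i ij; split; first exact: x0.
  move: (y0 i (mem_index_enum _)); rewrite ij/= sqrf_eq0 x0// mulr0 addr0.
  by move/eqP.
have [/forall_inP cpos|] := boolP [forall (i | i != j), 0 < c i].
  have W0 : 0 <= \sum_(i | i != j) c i * x i ^+ 2.
    by apply: sumr_ge0 => i /cpos ci; rewrite mulr_ge0 ?sqr_ge0// ltW.
  have b1 : 0 < 1 + l j ^+ 2 by have := sqr_ge0 (l j); lra.
  have Z0 : 0 <= (1 + l j ^+ 2) * z ^+ 2 by rewrite mulr_ge0 ?sqr_ge0// ltW.
  have U0 : 0 <= 2 * (l j * z + S) ^+ 2 by rewrite mulr_ge0 ?sqr_ge0.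
  split; first by rewrite /T !addr_ge0.
  move/eqP; rewrite /T !paddr_eq0 ?addr_ge0// => /andP[/andP[]].
  rewrite mulf_eq0 (gt_eqF b1)/= sqrf_eq0 => /eqP-> _.
  rewrite psumr_eq0; last by move=> i /cpos ci; rewrite mulr_ge0 ?sqr_ge0// ltW.
  move/allP => x0; split=> // i ij; move: (x0 i (mem_index_enum _)).
  by rewrite ij/= mulf_eq0 (gt_eqF (cpos _ ij)) sqrf_eq0 => /eqP.
rewrite negb_forall_in => /exists_inP[i0 i0j]; rewrite -leNgt => ci0.
set b := l j ^+ 2; set a := l i0 ^+ 2.
set s := \sum_(i | (i != j) && (i != i0)) l i ^+ 2.
have a0 : 0 <= a := sqr_ge0 _.
have b0 : 0 <= b := sqr_ge0 _.
have s0 : 0 <= s by apply: sumr_ge0 => i _; exact: sqr_ge0.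
have h9' : (1 + b) * (1 + a) * (1 + s) <= 9.
  apply: le_trans h9; rewrite (bigD1 j)//= -mulrA ler_wpM2l//; first by lra.
  rewrite (bigD1 i0)//= ler_wpM2l//; first by lra.
  by apply: one_plus_sum_le_prod => i; exact: sqr_ge0.
have ab9 : (1 + b) * (1 + a) <= 9 by have := mulr_ge0 (mulr_ge0 (addr_ge0 ler01 b0)
  (addr_ge0 ler01 a0)) s0; lra.
have ab2 : 2 <= a * (b - 1) by move: ci0; rewrite /c -/a -/b; lra.
have b1 : 1 < b by rewrite ltNge; apply/negP => b1; have := mulr_ge0 a0 (_ : 0 <= 1 - b); lra.
(* By [ab2], [(b - 1) * (1 + a) >= b + 1]. So the product is at least [(b + 1) ^+ 2 / (b - 1)],
   whose minimum 8 is reached at [b = 3] and which is at most 9 only for [2 <= b <= 5]. *)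
have ab8 : 8 <= (1 + b) * (1 + a).
  rewrite -(@ler_pM2l _ (b - 1)); last lra.
  have -> : (b - 1) * ((1 + b) * (1 + a)) = (1 + b) * (b + 1) + (1 + b) * (a * (b - 1) - 2) by ring.
  have := mulr_ge0 (addr_ge0 ler01 b0) (_ : 0 <= a * (b - 1) - 2); have := sqr_ge0 (b - 3); lra.
have b25 : 2 <= b <= 5.
  have : (b - 2) * (b - 5) <= 0.
    have : (b - 1) * ((1 + b) * (1 + a)) <= (b - 1) * 9 by rewrite ler_wpM2l//; lra.
    have := mulr_ge0 (addr_ge0 ler01 b0) (_ : 0 <= a * (b - 1) - 2); lra.
  by move=> h; apply/andP; split; nra.
have s8 : s <= 1/8 by nra.
set t := \sum_(i | (i != j) && (i != i0)) x i ^+ 2.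
set r := \sum_(i | (i != j) && (i != i0)) l i * x i.
have t0 : 0 <= t by apply: sumr_ge0 => i _; exact: sqr_ge0.
have rt : 8 * r ^+ 2 <= t.
  have := cauchy_schwarz_sum (fun i => (i != j) && (i != i0)) l x; rewrite -/r -/s -/t.
  have : s * t <= 1/8 * t by rewrite ler_wpM2r.
  by lra.
have SE : S = l i0 * x i0 + r by rewrite /S (bigD1 i0).
have [T0 Teq] := @axis_form_scalar (l i0) (l j) (x i0) r z t b25 ab9 rt.
have tle : 3/2 * t <= \sum_(i | (i != j) && (i != i0)) c i * x i ^+ 2.
  rewrite mulr_sumr; apply: ler_sum => i ii; rewrite ler_wpM2r ?sqr_ge0//.
  have : l i ^+ 2 <= s by rewrite /s (bigD1 i)//= lerDl; apply: sumr_ge0 => ? _; exact: sqr_ge0.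
  rewrite /c -/b; have := sqr_ge0 (l i); set ai := l i ^+ 2 => ai0 ais.
  by move: b25 => /andP[b2 b5]; nra.
have Tle : (1 + l j ^+ 2) * z ^+ 2 + 2 * (l j * z + (l i0 * x i0 + r)) ^+ 2 +
    ((2 + l i0 ^+ 2 * (1 - l j ^+ 2)) * x i0 ^+ 2 + 3/2 * t) <= T.
  by rewrite /T SE (bigD1 i0)//= lerD2l lerD2l.
split; first exact: le_trans Tle.
move=> T00; have [|-> x00 t00] := Teq; first by apply/eqP; rewrite eq_le T0 -T00 Tle.
split=> // i ij; have [->//|ii0] := eqVneq i i0.
move/eqP: t00; rewrite psumr_eq0; last by move=> ? _; exact: sqr_ge0.
by move/allP/(_ i (mem_index_enum _)); rewrite ij ii0/= sqrf_eq0 => /eqP.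
Qed.

End algebraic_inequality.

(** * The quadratic form in the second fundamental form *)

Section gauss_inequality.
Variable R : realFieldType.
Definition distinct3 (I : eqType) (a i j : I) := [&& a != i, a != j & i != j].

(** Triples are sorted by their pattern of coincidences. Those that are not distinct are grouped by
    the index occurring an odd number of times, to match [axis_form]. *)
Lemma sum_triples_split (I : finType) (F : I -> I -> I -> R) :
  \sum_a \sum_i \sum_j F a i j =
  \sum_a \sum_i \sum_(j | distinct3 a i j) F a i j +
  \sum_j (F j j j + \sum_(i | i != j) (F i i j + F i j i + F j i i)).
Proof.
have ex (G : I -> I -> R) : \sum_a \sum_(i | i != a) G a i = \sum_i \sum_(a | a != i) G a i.
  rewrite [LHS](exchange_big_dep xpredT)//=; apply: eq_bigr => i _.
  by apply: eq_bigl => a; rewrite eq_sym.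
have -> : \sum_a \sum_i \sum_(j | distinct3 a i j) F a i j =
    \sum_a \sum_(i | i != a) \sum_(j | (j != a) && (j != i)) F a i j.
  apply: eq_bigr => a _; rewrite [LHS](bigD1 a)//= [X in X + _]big1 ?add0r => [|j].
    apply: eq_bigr => i ia; apply: eq_bigl => j.
    by rewrite /distinct3 eq_sym ia/= ![_ == j]eq_sym.
  by rewrite /distinct3 eqxx.
have -> : \sum_a \sum_i \sum_j F a i j =
   \sum_a (F a a a + \sum_(j | j != a) F a a j) +
   \sum_a \sum_(i | i != a) (F a i a + F a i i + \sum_(j | (j != a) && (j != i)) F a i j).
  rewrite -big_split/=; apply: eq_bigr => a _; rewrite [LHS](bigD1 a)//= (bigD1 a)//=.
  congr (_ + _); apply: eq_bigr => i ia; rewrite (bigD1 a)//= (bigD1 i)//= addrA.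
  by [].
rewrite !big_split/=.
under [X in _ + X = _]eq_bigr do rewrite !big_split/=.
under [X in _ = _ + (_ + X)]eq_bigr do rewrite !big_split/=.
rewrite !big_split/= (ex (fun a j => F a a j)) (ex (fun a i => F a i a)).
ring.
Qed.

Lemma sum_distinct_rot (I : finType) (F : I -> I -> I -> R) :
  \sum_a \sum_i \sum_(j | distinct3 a i j) F i j a =
  \sum_a \sum_i \sum_(j | distinct3 a i j) F a i j.
Proof.
have E G : \sum_a \sum_i \sum_(j | distinct3 a i j) G a i j =
    \sum_a \sum_i \sum_j (if distinct3 a i j then G a i j else 0) :> R.
  by apply: eq_bigr => a _; apply: eq_bigr => i _; rewrite big_mkcond.
rewrite !E exchange_big/=; apply: eq_bigr => i _.
rewrite exchange_big/=; apply: eq_bigr => j _; apply: eq_bigr => a _.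
by rewrite /distinct3 [a == i]eq_sym [a == j]eq_sym andbA andbC.
Qed.

(* [h a i j] is the second fundamental form, with normal index a and tangent
   indices i and j, both running over the same set I after padding by zeros. *)
Definition gauss_form (I : finType) (l : I -> R) (h : I -> I -> I -> R) : R :=
  \sum_a \sum_i \sum_j (h a i j ^+ 2 + l a * l i * h a i j * h i a j)
  + 2 * \sum_j (\sum_a l a * h a a j) ^+ 2.

(** Three times the form is a sum of [triple_form]s, each rotation of a triple being counted, plus
    three times a sum of [axis_form]s. [X] stands for a null direction of [h], later the radial
    direction of the cone. *)
Lemma gauss_form_ge0 (I : finType) (l : I -> R) (h : I -> I -> I -> R) :
  (forall a i j, h a i j = h a j i) ->
  \prod_i (1 + l i ^+ 2) <= 9 ->
  0 <= gauss_form l h /\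
  (gauss_form l h = 0 -> forall X : I -> R,
    (forall a j, \sum_i X i * h a i j = 0) ->
    (forall a i j, h a i j = 0) \/ (forall i, l i * X i = 0)).
Proof.
move=> hsym h9.
pose tf a i j := triple_form (l a) (l i) (l j) (h a i j) (h i j a) (h j a i).
pose af j := axis_form l (fun i => h i i j) (fun i => h j i i) j (h j j j).
have E : 3 * gauss_form l h =
    \sum_a \sum_i \sum_(j | distinct3 a i j) tf a i j + 3 * \sum_j af j.
  rewrite /gauss_form sum_triples_split.
  set F := fun a i j => h a i j ^+ 2 + l a * l i * h a i j * h i a j.
  set D := \sum_a \sum_i \sum_(j | _) _.
  have -> : \sum_a \sum_i \sum_(j | distinct3 a i j) tf a i j = 3 * D.
    have -> : 3 * D = D + \sum_a \sum_i \sum_(j | distinct3 a i j) F i j a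
                     + \sum_a \sum_i \sum_(j | distinct3 a i j) F j a i.
      by rewrite (sum_distinct_rot (fun a i j => F i j a)) (sum_distinct_rot F) -/D; ring.
    rewrite -!big_split/=.
    apply: eq_bigr => a _; rewrite -!big_split/=; apply: eq_bigr => i _.
    rewrite -!big_split/=; apply: eq_bigr => j _.
    rewrite /F /tf /triple_form (hsym i a j) (hsym j i a) (hsym a j i); ring.
  rewrite -mulrDr -addrA; congr (_ * (_ + _)).
  rewrite mulr_sumr -big_split/=; apply: eq_bigr => j _; rewrite /af /axis_form.
  rewrite [\sum_a l a * h a a j](bigD1 j)//=; congr (_ + _ + _); first by ring.
  by apply: eq_bigr => i _; rewrite (hsym i j i); ring.
have p3 a i j : distinct3 a i j ->
    (1 + l a ^+ 2) * (1 + l i ^+ 2) * (1 + l j ^+ 2) <= 9.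
  move=> /and3P[ai aj ij]; apply: le_trans h9.
  rewrite (bigD1 a)//= (bigD1 i) 1?eq_sym//= (bigD1 j)/=; last by rewrite eq_sym aj eq_sym ij.
  have q k : 0 <= 1 + l k ^+ 2 by rewrite addr_ge0 ?sqr_ge0.
  rewrite !mulrA ler_peMr ?mulr_ge0//.
  apply: le_trans (one_plus_sum_le_prod _ (fun i => sqr_ge0 (l i))).
  by rewrite lerDl; apply: sumr_ge0 => k _; exact: sqr_ge0.
have tf0 a i j : distinct3 a i j -> 0 <= tf a i j.
  by move=> d; exact: (triple_form_ge0 (h a i j) (h i j a) (h j a i) (p3 _ _ _ d)).1.
have af0 j : 0 <= af j by case: (axis_form_ge0 (fun i => h i i j) (fun i =>
  h j i i) j (h j j j) h9).
have Stf : 0 <= \sum_a \sum_i \sum_(j | distinct3 a i j) tf a i j.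
  by apply: sumr_ge0 => a _; apply: sumr_ge0 => i _; apply: sumr_ge0 => j; exact: tf0.
have Saf : 0 <= \sum_j af j by apply: sumr_ge0.
split; first by rewrite -(@pmulr_rge0 _ 3)// E addr_ge0// mulr_ge0.
move=> Q0 X nullX; move: E; rewrite Q0 mulr0 => /esym/eqP.
rewrite paddr_eq0// ?mulr_ge0// mulf_eq0 pnatr_eq0/= => /andP[/eqP Stf0 /eqP Saf0].
have {Stf0}tf00 a i j : distinct3 a i j -> tf a i j = 0.
  move=> d; move/eqP: Stf0; rewrite psumr_eq0; last first.
    by move=> k _; apply: sumr_ge0 => k' _; apply: sumr_ge0 => k''; exact: tf0.
  move/allP/(_ a (mem_index_enum _)) => /=; rewrite psumr_eq0; last first.
    by move=> k' _; apply: sumr_ge0 => k''; exact: tf0.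
  move/allP/(_ i (mem_index_enum _)) => /=; rewrite psumr_eq0; last by move=> k; exact: tf0.
  by move/allP/(_ j (mem_index_enum _)); rewrite d => /eqP.
have {Saf0}af00 j : af j = 0.
  move/eqP: Saf0; rewrite psumr_eq0//.
  by move/allP/(_ j (mem_index_enum _)) => /eqP.
have nd a i j : ~~ distinct3 a i j -> h a i j = 0.
  have ax k := (axis_form_ge0 (fun i => h i i k) (fun i => h k i i) k (h k k k) h9).2 (af00 k).
  rewrite /distinct3 !negb_and !negbK.
  have [->|ai] := eqVneq a i => /=.
    by have [->|ij] := eqVneq i j; [case: (ax j)|move=> _; case: (ax j) => _ /(_ i ij)[]].
  have [<-|aj] := eqVneq a j => /=; first by move=> _; rewrite hsym; case: (ax i) => _ /(_ a ai)[].
  by move/eqP=> <-; case: (ax a) => _ /(_ i); rewrite eq_sym => /(_ ai)[].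
have tri a i j : distinct3 a i j -> h a i j != 0 -> l a ^+ 2 = 2 /\
   ((l i ^+ 2 = 2 /\ l j = 0 /\ h i j a != 0) \/ (l j ^+ 2 = 2 /\ l i = 0 /\ h j a i != 0)).
  by move=> d; have [_ /(_ (tf00 _ _ _ d))] := triple_form_ge0 (h a i j) (h i j a) (h j a i)
    (p3 _ _ _ d).
(* The slopes at [a] and [i] exhaust the product bound, so all others vanish. By [tri], [h _ k j] is
   then zero for [k] other than [a] and [i], and the null relation collapses to [X i * h a i j = 0]
   and [X a * h i a j = 0]. *)
have main a i j : distinct3 a i j -> h a i j != 0 -> h i a j != 0 ->
    l a ^+ 2 = 2 -> l i ^+ 2 = 2 -> l j = 0 -> forall k, l k * X k = 0.
  move=> /and3P[ai aj ij] haij hiaj la li lj.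
  have l0 k : k != a -> k != i -> l k = 0.
    move=> ka ki; move: h9; rewrite (bigD1 a)//= (bigD1 i) 1?eq_sym//= la li.
    have := one_plus_sum_le_prod (fun k => (k != a) && (k != i)) (fun i => sqr_ge0 (l i)).
    rewrite (bigD1 k) ?ka//= => h1 h2; apply/eqP; rewrite -sqrf_eq0; apply/eqP.
    have h3 : 0 <= \sum_(i0 | (i0 != a) && (i0 != i) && (i0 != k)) l i0 ^+ 2.
      by apply: sumr_ge0 => ? _; exact: sqr_ge0.
    by have h4 := sqr_ge0 (l k); lra.
  have vanish b k : k != a -> k != i -> h b k j = 0.
    move=> ka ki; apply/eqP; apply: contraT => hn.
    have [d|/nd/eqP] := boolP (distinct3 b k j); last by rewrite (negbTE hn).
    have [_ [[lk _]|[lj2 _]]] := tri _ _ _ d hn.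
      by move: lk; rewrite l0// expr0n/= => /eqP; rewrite eq_sym pnatr_eq0.
    by move: lj2; rewrite lj expr0n/= => /eqP; rewrite eq_sym pnatr_eq0.
  have Xi : X i = 0.
    move: (nullX a j); rewrite (bigD1 i)//= big1 => [|k ki].
      by rewrite addr0 => /eqP; rewrite mulf_eq0 (negbTE haij) orbF => /eqP.
    have [->|ka] := eqVneq k a; last by rewrite vanish ?mulr0.
    by rewrite nd ?mulr0// /distinct3 eqxx.
  have Xa : X a = 0.
    move: (nullX i j); rewrite (bigD1 a)//= big1 => [|k ki].
      by rewrite addr0 => /eqP; rewrite mulf_eq0 (negbTE hiaj) orbF => /eqP.
    have [->|ka] := eqVneq k i; last by rewrite vanish ?mulr0.
    by rewrite nd ?mulr0// /distinct3 eqxx.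
  move=> k; have [->|ka] := eqVneq k a; first by rewrite Xa mulr0.
  by have [->|ki] := eqVneq k i; [rewrite Xi mulr0|rewrite l0 ?mul0r].
have [/forallP h0|] := boolP [forall a, forall i, forall j, h a i j == 0].
  by left=> a i j; move: (h0 a) => /forallP/(_ i)/forallP/(_ j)/eqP.
move=> /forallPn[a /forallPn[i /forallPn[j haij]]]; right.
have d : distinct3 a i j by apply: contraNT haij => /nd->.
have [la [[li [lj hi]]|[lj [li hj]]]] := tri _ _ _ d haij.
  by apply: (main a i j) => //; rewrite hsym.
apply: (main a j i) => //; last by rewrite hsym.
by move: d => /and3P[ai aj ij]; apply/and3P; split=> //; rewrite eq_sym.
Qed.

End gauss_inequality.

(** * Smooth functions on open sets *)

Section smooth_functions.
Variables (R : realType) (k : nat).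
Implicit Types (U : set 'rV[R]_k) (f g : 'rV[R]_k -> R).

Lemma near_eq_differentiable (V W : normedModType R) (f g : V -> W) (x : V) :
  (\near x, f x = g x) -> differentiable f x -> differentiable g x.
Proof.
move=> fg df.
have E : g \o shift x = cst (g x) + 'd f x +o_ 0 id.
  apply/eqaddoP => e e0; have /eqaddoP := diff_locally df => /(_ e e0).
  have : \forall h \near 0, f (h + x) = g (h + x).
    by move: fg; rewrite (near_shift 0)/= => fg; near=> h; near: h; move: fg; apply: filterS => h;
      rewrite subr0.
  move=> fgh; apply: filterS2 fgh => h /= fgh.
  suff -> : (f \o shift x - (cst (f x) + 'd f x)) h = (g \o shift x - (cst (g x) + 'd f x)) h by [].
  have fgx : f x = g x := nbhs_singleton fg.
  by rewrite -[LHS]/(f (h + x) - (f x + 'd f x h)) fgh fgx.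
by apply/diff_locallyP; rewrite (diff_unique (diff_continuous df) E); split=> //;
  exact: (diff_continuous df).
Unshelve. all: by end_near. Qed.

(** The scalar counterpart of [differentiable_upto]; matrix-valued maps are handled through it,
    entry by entry. *)
Fixpoint diffn (r : nat) U f : Prop :=
  if r is s.+1 then
    (forall x, U x -> differentiable f x) /\ (forall v, diffn s U ('D_v f))
  else True.

Definition smooth U f := forall r, diffn r U f.

Lemma open_near U (P : 'rV[R]_k -> Prop) x : open U -> U x ->
  (forall y, U y -> P y) -> \forall y \near x, P y.
Proof. by move=> oU Ux H; apply: filterS H _; exact: open_nbhs_nbhs. Qed.

Lemma diffn_ext r U f g : open U -> (forall x, U x -> f x = g x) ->
  diffn r U f -> diffn r U g.
Proof.
move=> oU; elim: r f g => //= r IH f g fg [df ddf]; split=> [x Ux|v].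
  by apply: near_eq_differentiable (df x Ux); exact: open_near oU Ux fg.
apply: IH (ddf v) => x Ux; apply: near_eq_derive.
exact: open_near oU Ux fg.
Qed.

Lemma diffnW r U f : diffn r.+1 U f -> diffn r U f.
Proof. by elim: r f => //= r IH f [df ddf]; split=> // v; apply: IH; exact: ddf. Qed.

Lemma diffn_cst r U (c : R) : open U -> diffn r U (cst c).
Proof.
move=> oU; elim: r c => //= r IH c; split=> [x _|v]; first exact: differentiable_cst.
by apply: diffn_ext (IH 0) => // x _; rewrite derive_cst.
Qed.

Lemma diffnD r U f g : open U -> diffn r U f -> diffn r U g ->
  diffn r U (fun x => f x + g x).
Proof.
move=> oU; elim: r f g => //= r IH f g [df ddf] [dg ddg]; split=> [x Ux|v].
  by apply: differentiableD; [exact: df|exact: dg].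
apply: diffn_ext (IH _ _ (ddf v) (ddg v)) => // x Ux.
by rewrite deriveD//; apply: diff_derivable; [exact: df|exact: dg].
Qed.

Lemma diffnM r U f g : open U -> diffn r U f -> diffn r U g ->
  diffn r U (fun x => f x * g x).
Proof.
move=> oU; elim: r f g => //= r IH f g df dg; split=> [x Ux|v].
  by apply: differentiableM; [exact: df.1|exact: dg.1].
have h1 := IH _ _ (diffnW df) (dg.2 v).
have h2 := IH _ _ (diffnW dg) (df.2 v).
apply: diffn_ext (diffnD oU h1 h2) => // x Ux.
by rewrite deriveM//; apply: diff_derivable; [exact: df.1|exact: dg.1].
Qed.

(** The derivative of the inverse is a product of the inverse itself, twice, and ['D_v f], so the
    induction on the order closes with [f] fixed. *)
Lemma diffnV r U f : open U -> (forall x, U x -> f x != 0) -> diffn r U f ->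
  diffn r U (fun x => (f x)^-1).
Proof.
move=> oU f0; elim: r => //= r IH df; split=> [x Ux|v].
  by apply: differentiableV; [exact: df.1|exact: f0].
have h1 := IH (diffnW df).
have h2 := diffnM oU (diffn_cst r (-1) oU) (diffnM oU (diffnM oU h1 h1) (df.2 v)).
apply: diffn_ext h2 => // x Ux; rewrite deriveV//; last 1 first.
- by apply: diff_derivable; exact: df.1.
- by rewrite /cst scaleNr mulN1r -invfM -expr2.
- exact: f0.
Qed.

Lemma smooth_ext U f g : open U -> (forall x, U x -> f x = g x) ->
  smooth U f -> smooth U g.
Proof. by move=> oU fg sf r; exact: diffn_ext (sf r). Qed.

Lemma smooth_cst U (c : R) : open U -> smooth U (cst c).
Proof. by move=> oU r; exact: diffn_cst. Qed.

Lemma smoothD U f g : open U -> smooth U f -> smooth U g ->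
  smooth U (fun x => f x + g x).
Proof. by move=> oU sf sg r; exact: diffnD. Qed.

Lemma smoothM U f g : open U -> smooth U f -> smooth U g ->
  smooth U (fun x => f x * g x).
Proof. by move=> oU sf sg r; exact: diffnM. Qed.

Lemma smoothN U f : open U -> smooth U f -> smooth U (fun x => - f x).
Proof.
move=> oU sf; apply: smooth_ext (smoothM oU (smooth_cst (-1) oU) sf) => // x _.
by rewrite mulN1r.
Qed.

Lemma smoothV U f : open U -> (forall x, U x -> f x != 0) -> smooth U f ->
  smooth U (fun x => (f x)^-1).
Proof. by move=> oU f0 sf r; exact: diffnV. Qed.

Lemma smooth_sum (I : Type) (s : seq I) (P : pred I) (F : I -> 'rV[R]_k -> R) U :
  open U -> (forall i, P i -> smooth U (F i)) ->
  smooth U (fun x => \sum_(i <- s | P i) F i x).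
Proof.
move=> oU sF; elim: s => [|i s IH].
  by apply: smooth_ext (smooth_cst 0 oU) => // x _; rewrite big_nil.
have [Pi|Pi] := boolP (P i).
  by apply: smooth_ext (smoothD oU (sF i Pi) IH) => // x _; rewrite big_cons Pi.
by apply: smooth_ext IH => // x _; rewrite big_cons (negbTE Pi).
Qed.

Lemma smooth_prod (I : Type) (s : seq I) (P : pred I) (F : I -> 'rV[R]_k -> R) U :
  open U -> (forall i, P i -> smooth U (F i)) ->
  smooth U (fun x => \prod_(i <- s | P i) F i x).
Proof.
move=> oU sF; elim: s => [|i s IH].
  by apply: smooth_ext (smooth_cst 1 oU) => // x _; rewrite big_nil.
have [Pi|Pi] := boolP (P i).
  by apply: smooth_ext (smoothM oU (sF i Pi) IH) => // x _; rewrite big_cons Pi.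
by apply: smooth_ext IH => // x _; rewrite big_cons (negbTE Pi).
Qed.

Lemma smooth_derive U f v : smooth U f -> smooth U ('D_v f).
Proof. by move=> sf r; exact: (sf r.+1).2. Qed.

Lemma smooth_differentiable U f x : smooth U f -> U x -> differentiable f x.
Proof. by move=> sf Ux; exact: (sf 1%N).1. Qed.

Lemma smooth_derivable U f x v : smooth U f -> U x -> derivable f x v.
Proof. by move=> sf Ux; apply: diff_derivable; exact: smooth_differentiable Ux. Qed.

Lemma smooth_continuous U f x : smooth U f -> U x -> {for x, continuous f}.
Proof. by move=> sf Ux; apply: differentiable_continuous; exact: smooth_differentiable Ux. Qed.

Lemma smooth_subset U U' f : U' `<=` U -> smooth U f -> smooth U' f.
Proof.
move=> UU' sf r; elim: r f {sf}(sf r) => //= r IH f [df ddf]; split=> [x /UU'/df//|v].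
exact: IH.
Qed.

End smooth_functions.

(** * Symmetry of second derivatives, and derivatives at a local maximum *)

Section second_derivatives.
Variables (R : realType) (k : nat).
Implicit Types (U : set 'rV[R]_k) (f g : 'rV[R]_k -> R) (v w x : 'rV[R]_k).

Lemma is_derive_line f x w (t : R) : derivable f (x + t *: w) w ->
  is_derive t 1 (fun s => f (x + s *: w)) ('D_w f (x + t *: w)).
Proof.
have E : (fun h : R => h^-1 *: ((fun s => f (x + s *: w)) (h *: 1 + t) - f (x + t *: w))) =
    (fun h => h^-1 *: (f (h *: w + (x + t *: w)) - f (x + t *: w))).
  by apply/funext => h; rewrite [h *: 1]mulr1 scalerDl addrCA.
by move=> df; split; rewrite /derivable /derive E.
Qed.

Lemma nbhs_parallelogram (P : 'rV[R]_k -> Prop) x v w : (\near x, P x) ->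
  exists2 h : R, 0 < h & forall s t, 0 <= s <= h -> 0 <= t <= h -> P (x + s *: v + t *: w).
Proof.
move=> /nbhs_ballP[e /= e0 Pe].
have N0 : 0 < `|v| + `|w| + 1 by have := normr_ge0 v; have := normr_ge0 w; lra.
exists (e / 2 / (`|v| + `|w| + 1)); first by rewrite !divr_gt0.
set h := _ / _ => s t /andP[s0 sh] /andP[t0 th]; apply: Pe.
rewrite -ball_normE/= -addrA opprD addNKr normrN.
apply: le_lt_trans (ler_normD _ _) _; rewrite !normrZ !ger0_norm//.
have h0 : 0 <= h by rewrite !divr_ge0 ?ltW.
have E : h * (`|v| + `|w| + 1) = e / 2 by rewrite /h divfK// gt_eqF.
have h1 := ler_wpM2r (normr_ge0 v) sh.
have h2 := ler_wpM2r (normr_ge0 w) th.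
by lra.
Qed.

Lemma gt0_of_dist_lt (a b : R) : `|a - b| < a -> 0 < b.
Proof. by rewrite ltr_norml => /andP[]; lra. Qed.

Lemma dist_lt_half_absurd (a b c : R) :
  `|a - c| < `|a - b| / 2 -> `|b - c| < `|a - b| / 2 -> False.
Proof. by move=> ac bc; have := ler_distD c a b; rewrite (distrC c); lra. Qed.

(** The mean value theorem is used twice: along [v] for the difference of [f] between two opposite
    sides of the parallelogram, then along [w] for ['D_v f]. *)
Lemma mixed_difference U f x v w (h : R) : open U -> smooth U f -> 0 < h ->
  (forall s t, 0 <= s <= h -> 0 <= t <= h -> U (x + s *: v + t *: w)) ->
  exists s t, [/\ 0 <= s <= h, 0 <= t <= h &
    f (x + h *: v + h *: w) - f (x + h *: v) - (f (x + h *: w) - f x)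
    = 'D_w ('D_v f) (x + s *: v + t *: w) * h * h].
Proof.
move=> oU sf h0 HU.
have inn s : s \in `]0, h[%R -> 0 <= s <= h.
  by rewrite in_itv/= => /andP[s0 sh]; rewrite !ltW.
have hh : 0 <= h <= h by apply/andP; split=> //; exact: ltW.
have h00 : 0 <= (0 : R) <= h by apply/andP; split=> //; exact: ltW.
have dvt t s : 0 <= t <= h -> 0 <= s <= h ->
    is_derive s 1 (fun s => f (x + t *: w + s *: v)) ('D_v f (x + t *: w + s *: v)).
  move=> th sh; apply: is_derive_line; apply: smooth_derivable sf _.
  by rewrite addrAC; exact: HU.
have [s s0 Es] : exists2 s, s \in `]0, h[%R &
    (f (x + h *: w + h *: v) - f (x + 0 *: w + h *: v)) - (f (x + h *: w + 0 *: v)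
      - f (x + 0 *: w + 0 *: v))
    = ('D_v f (x + h *: w + s *: v) - 'D_v f (x + 0 *: w + s *: v)) * (h - 0).
  apply: (@MVT R (fun s => f (x + h *: w + s *: v) - f (x + 0 *: w + s *: v))
     (fun s => 'D_v f (x + h *: w + s *: v) - 'D_v f (x + 0 *: w + s *: v)) 0 h h0).
    by move=> s /inn sh; apply: is_deriveB; exact: dvt.
  apply: derivable_within_continuous => s /= sh.
  have {}sh : 0 <= s <= h by move: sh; rewrite in_itv.
  by apply: derivableB; [case: (dvt h s hh sh)|case: (dvt 0 s h00 sh)].
have dwt t : 0 <= t <= h -> is_derive t 1 (fun t => 'D_v f (x + s *: v + t *: w))
    ('D_w ('D_v f) (x + s *: v + t *: w)).
  move=> th; apply: is_derive_line; apply: smooth_derivable (smooth_derive v sf) _.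
  by apply: HU => //; exact: inn.
have [t t0 Et] : exists2 t, t \in `]0, h[%R &
    'D_v f (x + s *: v + h *: w) - 'D_v f (x + s *: v + 0 *: w)
    = 'D_w ('D_v f) (x + s *: v + t *: w) * (h - 0).
  apply: (@MVT R (fun t => 'D_v f (x + s *: v + t *: w))
     (fun t => 'D_w ('D_v f) (x + s *: v + t *: w)) 0 h h0).
    by move=> t /inn; exact: dwt.
  apply: derivable_within_continuous => t /= th.
  have {}th : 0 <= t <= h by move: th; rewrite in_itv.
  by case: (dwt t th).
exists s, t; split; [exact: inn|exact: inn|].
rewrite subr0 in Et Es; rewrite -Et; move: Es; rewrite !scale0r !addr0 => Es.
have key (X Y Z T : R) : X - Y - (Z - T) = X - Z - (Y - T) by ring.
by rewrite [x + s *: v + h *: w]addrAC -Es [x + h *: v + h *: w]addrAC key.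
Qed.

(** The second difference of [mixed_difference] is symmetric in [v] and [w], so the two mixed
    derivatives take a common value, at possibly different points of an arbitrarily small
    parallelogram. By continuity they cannot differ at [x]. *)
Lemma schwarz U f x v w : open U -> smooth U f -> U x ->
  'D_v ('D_w f) x = 'D_w ('D_v f) x.
Proof.
move=> oU sf Ux; apply/eqP; rewrite -subr_eq0 -normr_eq0; apply/eqP/le_anti.
rewrite normr_ge0 andbT leNgt; apply/negP => H.
set e := `|_| in H.
have cA := smooth_continuous (smooth_derive v (smooth_derive w sf)) Ux.
have cB := smooth_continuous (smooth_derive w (smooth_derive v sf)) Ux.
have e2 : 0 < e / 2 by rewrite divr_gt0.
move/cvgrPdist_lt : cA => /(_ _ e2) nA; move/cvgrPdist_lt : cB => /(_ _ e2) nB.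
have nU := open_near oU Ux (fun _ h => h).
have [h h0 Hh] := nbhs_parallelogram v w (filterI nU (filterI nA nB)).
have [|s [t [sh th Est]]] := @mixed_difference U f x v w h oU sf h0; first by move=> s t sh th;
  case: (Hh s t sh th).
have [|s' [t' [sh' th' Est']]] := @mixed_difference U f x w v h oU sf h0.
  by move=> s' t' sh' th'; rewrite addrAC; case: (Hh t' s' th' sh').
have [_ [_ hB]] := Hh _ _ sh th; have [_ [hA _]] := Hh _ _ th' sh'.
have AB : 'D_w ('D_v f) (x + s *: v + t *: w) = 'D_v ('D_w f) (x + t' *: v + s' *: w).
  have key (X Y Z T A B : R) : X - Y - (Z - T) = A * h * h -> X - Z - (Y - T) = B * h * h -> A = B.
    move=> eA eB; apply: (mulIf (lt0r_neq0 h0)); apply: (mulIf (lt0r_neq0 h0)).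
    by rewrite -eA -eB; ring.
  have xhh : x + h *: w + h *: v = x + h *: v + h *: w by rewrite addrAC.
  have xst : x + t' *: v + s' *: w = x + s' *: w + t' *: v by rewrite addrAC.
  by rewrite xst; rewrite xhh in Est'; exact: key Est Est'.
by rewrite AB in hB; exact: dist_lt_half_absurd hA hB.
Qed.

Lemma derive_sumv (I : finType) f x (a : I -> R) (v : I -> 'rV[R]_k) : differentiable f x ->
  'D_(\sum_i a i *: v i) f x = \sum_i a i * 'D_(v i) f x.
Proof.
move=> df; rewrite deriveE// linear_sum; apply: eq_bigr => i _.
by rewrite linearZ deriveE.
Qed.

Lemma derive_local_max_eq0 U f x w : open U -> smooth U f -> U x ->
  (\forall y \near x, f y <= f x) -> 'D_w f x = 0.
Proof.
move=> oU sf Ux fx.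
have nU := open_near oU Ux (fun _ h => h).
(* The sides [w] and [- w] let one parallelogram cover both directions of the line through [x]. *)
have [h h0 Hh] := nbhs_parallelogram w (- w) (filterI nU fx).
have zh : 0 <= (0 : R) <= h by apply/andP; split=> //; exact: ltW.
have H t : t \in `]- h, h[%R -> U (x + t *: w) /\ f (x + t *: w) <= f x.
  rewrite in_itv/= => /andP[ht th]; have [t0|t0] := leP 0 t.
    have := Hh t 0 _ zh; rewrite scale0r addr0; apply.
    by rewrite t0 ltW.
  have := Hh 0 (- t) zh; rewrite scale0r addr0 scalerN scaleNr opprK; apply.
  by apply/andP; split; lra.
have d t : t \in `]- h, h[%R -> is_derive t 1 (fun s => f (x + s *: w)) ('D_w f (x + t *: w)).
  by move=> /H[Ut _]; apply: is_derive_line; exact: smooth_derivable sf Ut.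
have z0 : 0 \in `]- h, h[%R by rewrite in_itv/= oppr_lt0 h0.
have : is_derive (0 : R) 1 (fun s => f (x + s *: w)) 0.
  apply: (@derive1_at_max R _ (- h) h) => //.
  - by rewrite ge0_cp// ltW.
  - by move=> t /d[].
  - by move=> t /H[_]; rewrite scale0r addr0.
move=> [_]; have [_] := d 0 z0; rewrite scale0r addr0 => -> //.
Qed.

(** A positive second derivative would remain positive nearby. As the first derivative vanishes at
    [x], two applications of the mean value theorem would then give [f (x + h *: w) > f x]. *)
Lemma derive2_local_max_le0 U f x w : open U -> smooth U f -> U x ->
  (\forall y \near x, f y <= f x) -> 'D_w ('D_w f) x <= 0.
Proof.
move=> oU sf Ux fx; rewrite leNgt; apply/negP => pos.
have nU := open_near oU Ux (fun _ h => h).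
have c2 := smooth_continuous (smooth_derive w (smooth_derive w sf)) Ux.
have np : \forall y \near x, 0 < 'D_w ('D_w f) y.
  by move/cvgrPdist_lt: c2 => /(_ _ pos); apply: filterS => y; exact: gt0_of_dist_lt.
have [h h0 Hh] := nbhs_parallelogram w 0 (filterI nU (filterI fx np)).
have H t : 0 <= t <= h -> [/\ U (x + t *: w),
  f (x + t *: w) <= f x & 0 < 'D_w ('D_w f) (x + t *: w)].
  move=> th; have [] := Hh t 0 th; rewrite ?scaler0 ?addr0; last by move=> ? [].
  by rewrite lexx ltW.
have d1 t : 0 <= t <= h -> is_derive t 1 (fun s => f (x + s *: w)) ('D_w f (x + t *: w)).
  by move=> /H[Ut _ _]; apply: is_derive_line; exact: smooth_derivable sf Ut.
have d2 t : 0 <= t <= h -> is_derive t 1 (fun s =>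
  'D_w f (x + s *: w)) ('D_w ('D_w f) (x + t *: w)).
  by move=> /H[Ut _ _]; apply: is_derive_line; exact: smooth_derivable (smooth_derive w sf) Ut.
have oc t s : t \in `]0, s[%R -> s <= h -> 0 < t <= h.
  by rewrite in_itv/= => /andP[t0 ts] sh; rewrite t0/=; apply: le_trans sh; exact: ltW.
have [s s0 Es] : exists2 s, s \in `]0, h[%R & f (x + h *: w) - f (x + 0 *: w) = 'D_w f (x + s *: w)
  * (h - 0).
  apply: (@MVT R (fun t => f (x + t *: w)) (fun t => 'D_w f (x + t *: w)) 0 h h0).
    by move=> t /oc/(_ (lexx _))/andP[t0 th]; apply: d1; rewrite (ltW t0).
  apply: derivable_within_continuous => t; rewrite in_itv/= => th.
  by case: (d1 t th).
have /andP[s0' sh] := oc _ _ s0 (lexx _).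
have [t t0 Et] : exists2 t, t \in `]0, s[%R & 'D_w f (x + s *: w) - 'D_w f (x + 0 *: w)
  = 'D_w ('D_w f) (x + t *: w) * (s - 0).
  apply: (@MVT R (fun t => 'D_w f (x + t *: w)) (fun t => 'D_w ('D_w f) (x + t *: w)) 0 s s0').
    by move=> t /oc/(_ sh)/andP[t0 th]; apply: d2; rewrite (ltW t0).
  apply: derivable_within_continuous => t; rewrite in_itv/= => /andP[t0 ts].
  by case: (d2 t) => //; rewrite t0 (le_trans ts).
have /andP[t0' th] := oc _ _ t0 sh.
have [_ fh _] := H h (introT andP (conj (ltW h0) (lexx h))).
have [_ _ dt] := H t (introT andP (conj (ltW t0') th)).
move: Es Et; rewrite !scale0r !addr0 !subr0 (derive_local_max_eq0 w oU sf Ux fx) subr0 => Es Et.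
have : 0 < f (x + h *: w) - f x by rewrite Es Et !mulr_gt0.
by rewrite subr_gt0 ltNge fh.
Qed.

End second_derivatives.

(** * Strong maximum principle *)

Section euclidean_balls.
Variables (R : realType) (k : nat).
Implicit Types (U : set 'rV[R]_k) (f g : 'rV[R]_k -> R) (v w x y z : 'rV[R]_k).

Lemma dotpE (e : nat) (v w : 'rV[R]_e) : dotp v w = \sum_i v 0 i * w 0 i.
Proof. by rewrite /dotp mxE; apply: eq_bigr => i _; rewrite mxE. Qed.

Lemma dotpC (e : nat) (v w : 'rV[R]_e) : dotp v w = dotp w v.
Proof. by rewrite !dotpE; apply: eq_bigr => i _; rewrite mulrC. Qed.

Lemma dotpDl (e : nat) (u v w : 'rV[R]_e) : dotp (u + v) w = dotp u w + dotp v w.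
Proof. by rewrite /dotp mulmxDl mxE. Qed.

Lemma dotpNl (e : nat) (v w : 'rV[R]_e) : dotp (- v) w = - dotp v w.
Proof. by rewrite /dotp mulNmx mxE. Qed.

Lemma dotpZl (e : nat) a (v w : 'rV[R]_e) : dotp (a *: v) w = a * dotp v w.
Proof. by rewrite /dotp -scalemxAl mxE. Qed.

Lemma dotp_ge0 (e : nat) (v : 'rV[R]_e) : 0 <= dotp v v.
Proof. by rewrite dotpE; apply: sumr_ge0 => i _; rewrite -expr2 sqr_ge0. Qed.

Lemma dotp_eq0 (e : nat) (v : 'rV[R]_e) : (dotp v v == 0) = (v == 0).
Proof.
apply/idP/eqP => [|->]; last by rewrite /dotp mul0mx mxE.
rewrite dotpE psumr_eq0; last by move=> i _; rewrite -expr2 sqr_ge0.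
move=> /allP h; apply/rowP => i; rewrite mxE.
by move: (h i (mem_index_enum _)); rewrite -expr2 sqrf_eq0 => /eqP.
Qed.

Lemma dotp_gt0 (e : nat) (v : 'rV[R]_e) : (0 < dotp v v) = (v != 0).
Proof. by rewrite lt_def dotp_ge0 dotp_eq0 andbT. Qed.

Lemma norm_sqr_le_dotp v : `|v| ^+ 2 <= dotp v v.
Proof.
have [->|v0] := eqVneq v 0; first by rewrite normr0 expr0n dotp_ge0.
have : `|v| != 0 by rewrite normr_eq0.
rewrite {1 2}/Num.Def.normr/= => /mx_norm_neq0[[i j] ->]/=.
rewrite real_normK ?num_real// (ord1 i) dotpE (bigD1 j)//= -expr2 lerDl.
by apply: sumr_ge0 => l _; rewrite -expr2 sqr_ge0.
Qed.

Definition smoothmx (p q : nat) U (A : 'rV[R]_k -> 'M[R]_(p, q)) :=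
  forall i j, smooth U (fun x => A x i j).

Lemma smooth_coord U i : open U -> smooth U (fun x => x 0 i).
Proof.
move=> oU [|r]//=; split=> [x _|v]; first exact: differentiable_coord.
apply: diffn_ext (diffn_cst r (v 0 i) oU) => // x _.
rewrite /cst /derive; apply/esym/cvg_lim => //.
have E : \forall h \near 0^', v 0 i = h^-1 *: ((h *: v + x) 0 i - x 0 i).
  near=> h; rewrite !mxE addrK [_ *: _]mulrA mulVf ?mul1r//.
  by near: h; exact: nbhs_dnbhs_neq.
by apply: cvg_trans (near_eq_cvg E) _; exact: cvg_cst.
Unshelve. all: by end_near. Qed.

Lemma derive_coord x v i : 'D_v (fun x => x 0 i) x = v 0 i.
Proof.
rewrite /derive; apply/cvg_lim => //.
have E : \forall h \near 0^', v 0 i = h^-1 *: ((h *: v + x) 0 i - x 0 i).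
  near=> h; rewrite !mxE addrK [_ *: _]mulrA mulVf ?mul1r//.
  by near: h; exact: nbhs_dnbhs_neq.
by apply: cvg_trans (near_eq_cvg E) _; exact: cvg_cst.
Unshelve. all: by end_near. Qed.

(** The norm on row vectors is the sup norm; the barrier needs Euclidean distance, whose square is
    smooth. *)
Definition sqdist y x := dotp (x - y) (x - y).

Lemma smooth_sqdist U y : open U -> smooth U (sqdist y).
Proof.
move=> oU; apply: (@smooth_ext _ _ _ (fun x => \sum_i (x 0 i + - y 0 i) * (x 0 i + - y 0 i))) => //.
  by move=> x _; rewrite /sqdist dotpE; apply: eq_bigr => i _; rewrite !mxE.
apply: smooth_sum => // i _; apply: smoothM => //; apply: smoothD => //;
  by [exact: smooth_coord|exact: smooth_cst].
Qed.

Lemma sqdist_continuous y : continuous (sqdist y).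
Proof. by move=> x; exact: smooth_continuous (smooth_sqdist y openT) I. Qed.

Lemma derive_sqdist y v x : 'D_v (sqdist y) x = 2 * dotp v (x - y).
Proof.
have -> : sqdist y = (fun x => \sum_i (x 0 i + - y 0 i) ^+ 2).
  by apply/funext => t; rewrite /sqdist dotpE; apply: eq_bigr => i _; rewrite !mxE expr2.
have ds i : derivable (fun x : 'rV[R]_k => x 0 i + - y 0 i) x v.
  apply: derivableD; last exact: derivable_cst.
  exact: smooth_derivable (smooth_coord i openT) I.
have -> : (fun x => \sum_i (x 0 i + - y 0 i) ^+ 2) =
    \sum_i ((fun x : 'rV[R]_k => x 0 i + - y 0 i) ^+ 2).
  by apply/funext => t; rewrite fct_sumE.
rewrite derive_sum; last by move=> i; exact: derivableX.
rewrite dotpE mulr_sumr; apply: eq_bigr => i _; rewrite deriveX// deriveD//; last first.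
  exact: smooth_derivable (smooth_coord i openT) I.
by rewrite derive_coord derive_cst addr0 /= expr1 [_ *: _]mulrC !mxE; ring.
Qed.

Lemma derive2_sqdist y v x : 'D_v ('D_v (sqdist y)) x = 2 * dotp v v.
Proof.
have -> : 'D_v (sqdist y) = (fun x => \sum_i (2 * v 0 i) * (x 0 i + - y 0 i)).
  apply/funext => t; rewrite derive_sqdist dotpE mulr_sumr.
  by apply: eq_bigr => i _; rewrite !mxE mulrA.
have ds i : derivable (fun x : 'rV[R]_k => x 0 i + - y 0 i) x v.
  apply: derivableD; last exact: derivable_cst.
  exact: smooth_derivable (smooth_coord i openT) I.
have -> : (fun x => \sum_i (2 * v 0 i) * (x 0 i + - y 0 i)) =
    \sum_i ((2 * v 0 i) *: (fun x : 'rV[R]_k => x 0 i + - y 0 i)).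
  by apply/funext => t; rewrite fct_sumE.
rewrite derive_sum; last by move=> i; exact: derivableZ.
rewrite dotpE mulr_sumr; apply: eq_bigr => i _; rewrite deriveZ// deriveD//; last first.
  exact: smooth_derivable (smooth_coord i openT) I.
by rewrite derive_coord derive_cst addr0 [_ *: _]mulrC; ring.
Qed.

(** [r] is the square of the radius. *)
Definition closed_eball y (r : R) := [set x | sqdist y x <= r].

Lemma closed_eball_compact y r : compact (closed_eball y r).
Proof.
apply: bounded_closed_compact; last first.
  by apply: (@closed_comp _ _ (sqdist y) [set t | t <= r]) => [x _|];
    [exact: sqdist_continuous|exact: closed_le].
exists (`|y| + `|r| + 1); split; first exact: num_real.
move=> M HM x /= xr; apply: ltW; apply: le_lt_trans HM.
rewrite -(subrK y x); apply: le_trans (ler_normD _ _) _.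
rewrite addrC -!addrA lerD2l.
have : `|x - y| ^+ 2 <= (`|r| + 1) ^+ 2.
  apply: le_trans (norm_sqr_le_dotp _) _; apply: le_trans xr _.
  by have := ler_norm r; have := normr_ge0 r; nra.
by rewrite ler_sqr ?nnegrE// ?addr_ge0.
Qed.

Lemma nbhs_eball x (P : set 'rV[R]_k) : nbhs x P -> exists2 r, 0 < r & closed_eball x r `<=` P.
Proof.
move=> /nbhs_ballP[e /= e0 Pe]; exists (e ^+ 2 / 2); first by rewrite divr_gt0 ?exprn_gt0.
move=> y /= yr; apply: Pe; rewrite -ball_normE/= distrC.
rewrite -ltr_sqr ?nnegrE// ?ltW//; apply: le_lt_trans (norm_sqr_le_dotp _) _.
by apply: le_lt_trans yr _; have := exprn_gt0 2 e0; lra.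
Qed.

Lemma eball_nbhs y r x : sqdist y x < r -> \forall t \near x, sqdist y t < r.
Proof.
move=> xr; have := @sqdist_continuous y x => /cvgrPdist_lt /(_ (r - sqdist y x)).
rewrite subr_gt0 => /(_ xr); apply: filterS => t; rewrite ltr_norml => /andP[]; lra.
Qed.

Lemma sqdist_xx x : sqdist x x = 0.
Proof. by rewrite /sqdist subrr; apply/eqP; rewrite dotp_eq0. Qed.

End euclidean_balls.

(** * Hopf's barrier argument *)

Section hopf.
Variables (R : realType) (k d : nat).
Implicit Types (U : set 'rV[R]_k) (f g : 'rV[R]_k -> R) (v w x y z : 'rV[R]_k).

Lemma smoothX U f n : open U -> smooth U f -> smooth U (fun x => f x ^+ n).
Proof.
move=> oU sf; elim: n => [|n IH].
  by apply: smooth_ext (smooth_cst 1 oU) => // x _; rewrite expr0.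
by apply: smooth_ext (smoothM oU sf IH) => // x _; rewrite exprS.
Qed.

Lemma derive_inv_pow U f n x v : smooth U f -> U x -> f x != 0 ->
  'D_v (fun x => (f x)^-1 ^+ n) x = - (n%:R * (f x)^-1 ^+ n.+1 * 'D_v f x).
Proof.
move=> sf Ux f0; have df : derivable f x v := smooth_derivable sf Ux.
have -> : (fun x => (f x)^-1 ^+ n) = (fun x => (f x)^-1) ^+ n.
  by apply/funext => t; rewrite exprfctE.
rewrite deriveX; last exact: derivableV.
rewrite deriveV//; case: n => [|n]; first by rewrite !mul0r oppr0 scale0r.
move: ('D_v f x) => D; have sc (a b : R) : a *: b = a * b by
  []. rewrite !sc -exprVn /= [in RHS]exprSr [in RHS]exprSr.
by move: (_ ^-1) (_ ^+ n) => r rn; ring.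
Qed.

(** The vectors [row s (W x)] and [c x] are frozen at [x] before differentiating: the second-order
    part is the Hessian contracted with [(W x)^T *m W x], and [c] carries all first-order terms. *)
Definition elliptic_op (W : 'rV[R]_k -> 'M[R]_(d, k)) (c : 'rV[R]_k -> 'rV[R]_k) f x :=
  \sum_s 'D_(row s (W x)) ('D_(row s (W x)) f) x - 'D_(c x) f x.

Definition symbol (W : 'rV[R]_k -> 'M[R]_(d, k)) y x :=
  \sum_s dotp (row s (W x)) (x - y) ^+ 2.

(** Half the value of the operator on [sqdist y]. *)
Definition lower_order (W : 'rV[R]_k -> 'M[R]_(d, k)) (c : 'rV[R]_k -> 'rV[R]_k) y x :=
  \sum_s dotp (row s (W x)) (row s (W x)) - dotp (c x) (x - y).

(** This is the chain rule for a negative power of [sqdist y]. Only the term with [symbol] gains the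
    factor [n.+1], so it prevails for large [n] wherever the symbol is positive. *)
Lemma elliptic_op_barrier W c U y n x : open U -> (forall x, U x -> x != y) -> U x ->
  elliptic_op W c (fun x => (sqdist y x)^-1 ^+ n) x =
  n%:R * (sqdist y x)^-1 ^+ n.+2 *
    ((4 * n.+1)%:R * symbol W y x - 2 * sqdist y x * lower_order W c y x).
Proof.
move=> oU Uy Ux; have sq := smooth_sqdist y oU.
have q0 t : U t -> sqdist y t != 0 by move=> /Uy ty; rewrite /sqdist dotp_eq0 subr_eq0.
have D1 v t : U t -> 'D_v (fun x => (sqdist y x)^-1 ^+ n) t =
    - (n%:R * (sqdist y t)^-1 ^+ n.+1 * 'D_v (sqdist y) t).
  by move=> Ut; apply: derive_inv_pow sq Ut (q0 _ Ut).
have D2 v : 'D_v ('D_v (fun x => (sqdist y x)^-1 ^+ n)) x =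
    n%:R * (n.+1%:R * (sqdist y x)^-1 ^+ n.+2 * ('D_v (sqdist y) x) ^+ 2 -
     (sqdist y x)^-1 ^+ n.+1 * 'D_v ('D_v (sqdist y)) x).
  rewrite (near_eq_derive _ (open_near oU Ux (D1 v))).
  have sp := smoothX n.+1 oU (smoothV oU q0 sq).
  have -> : (fun t => - (n%:R * (sqdist y t)^-1 ^+ n.+1 * 'D_v (sqdist y) t)) =
    (- n%:R) *: ((fun t => (sqdist y t)^-1 ^+ n.+1) * 'D_v (sqdist y)).
    by apply/funext => t; rewrite -mulrA -mulNr.
  have d1 : derivable (fun t => (sqdist y t)^-1 ^+ n.+1) x v := smooth_derivable sp Ux.
  have d2 : derivable ('D_v (sqdist y)) x v := smooth_derivable (smooth_derive v sq) Ux.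
  rewrite (deriveZ _ (derivableM d1 d2)) (deriveM d1 d2) (derive_inv_pow n.+1 v sq Ux (q0 _ Ux)).
  have sc (a b : R) : a *: b = a * b by [].
  rewrite !sc.
  move: ('D_v ('D_v (sqdist y)) x) ('D_v (sqdist y) x) (sqdist y x)^-1 => a b t.
  ring.
rewrite /elliptic_op (eq_bigr _ (fun s _ => D2 _)) D1//.
rewrite derive_sqdist.
under eq_bigr do rewrite derive_sqdist derive2_sqdist.
rewrite /symbol /lower_order; have := q0 _ Ux.
set q := sqdist y x => q0x.
set A := \sum_s dotp _ _ ^+ 2; set B := \sum_s dotp _ _; set C := dotp (c x) _.
have -> : \sum_s n%:R * (n.+1%:R * q^-1 ^+ n.+2 * (2 * dotp (row s (W x)) (x - y)) ^+ 2 -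
   q^-1 ^+ n.+1 * (2 * dotp (row s (W x)) (row s (W x)))) =
   n%:R * (n.+1%:R * q^-1 ^+ n.+2 * (4 * A) - q^-1 ^+ n.+1 * (2 * B)).
  rewrite /A /B !mulr_sumr -sumrB mulr_sumr; apply: eq_bigr => s _; ring.
have -> : q^-1 ^+ n.+1 = q^-1 ^+ n.+2 * q by rewrite [in RHS]exprSr mulfVK.
by rewrite natrM; ring.
Qed.

Lemma open_neq_pt y : open [set x | x != y].
Proof.
rewrite openE => x /= xy; rewrite /interior.
have q0 : 0 < sqdist y x by rewrite /sqdist dotp_gt0 subr_eq0.
move/cvgrPdist_lt: (@sqdist_continuous _ _ y x) => /(_ _ q0); apply: filterS => t /gt0_of_dist_lt.
by rewrite /sqdist dotp_gt0 subr_eq0.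
Qed.

(* f is compared with the barrier |x - y|^(-2 n), on which the operator is
   positive near z for n large. *)
Lemma hopf_touching W c U f y z :
  open U -> smooth U f -> U z -> z != y ->
  (forall x, U x -> {for x, continuous (symbol W y)}) ->
  (forall x, U x -> {for x, continuous (lower_order W c y)}) ->
  0 < symbol W y z ->
  (forall x, U x -> 0 <= elliptic_op W c f x) ->
  (forall x, U x -> f x <= f z) ->
  (forall x, U x -> x != z -> sqdist y x <= sqdist y z -> f x < f z) ->
  False.
Proof.
move=> oU sf Uz zy cS cL Sz Lf fle flt.
have qz : 0 < sqdist y z by rewrite /sqdist dotp_gt0 subr_eq0.
(* This makes [n%:R * symbol W y z] exceed [sqdist y z] times the absolute value of
   [lower_order W c y z], so that the bracket of [elliptic_op_barrier] is positive at [z]. *)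
pose n := (Num.bound (sqdist y z * `|lower_order W c y z| / symbol W y z)).+1.
pose E x := (4 * n.+1)%:R * symbol W y x - 2 * sqdist y x * lower_order W c y x.
have Ez : 0 < E z.
  have : sqdist y z * `|lower_order W c y z| / symbol W y z < n%:R.
    apply: lt_trans (archi_boundP _) _; last by rewrite ltr_nat.
    by rewrite divr_ge0 ?mulr_ge0// ltW.
  rewrite ltr_pdivrMr// /E => nb.
  have := ler_wpM2l (ltW qz) (ler_norm (lower_order W c y z)).
  have : 0 <= n%:R * symbol W y z by rewrite mulr_ge0// ltW.
  rewrite natrM -natr1; nra.
have cE : {for z, continuous E}.
  have c1 : {for z, continuous (fun x => (4 * n.+1)%:R * symbol W y x)}.
    by apply: (@continuousM _ _ (cst _) (symbol W y)); [exact: cst_continuous|exact: cS].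
  have c2 : {for z, continuous (fun x => 2 * sqdist y x)}.
    by apply: (@continuousM _ _ (cst 2) (sqdist y));
      [exact: cst_continuous|exact: sqdist_continuous].
  apply: (@continuousB _ _ _ (fun x => (4 * n.+1)%:R * symbol W y x)
    (fun x => 2 * sqdist y x * lower_order W c y x)) => //.
  by apply: (@continuousM _ _ (fun x => 2 * sqdist y x) (lower_order W c y)) => //; exact: cL.
have nE : \forall x \near z, 0 < E x.
  by move/cvgrPdist_lt: cE => /(_ _ Ez); apply: filterS => x; exact: gt0_of_dist_lt.
have nq : \forall x \near z, 0 < sqdist y x.
  by move/cvgrPdist_lt: (@sqdist_continuous _ _ y z) => /(_ _ qz); apply: filterS => x;
    exact: gt0_of_dist_lt.
have [r r0 rsub] := nbhs_eball (filterI (open_near oU Uz (fun _ h => h)) (filterI nE nq)).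
pose K := closed_eball z r.
have KU x : K x -> U x by move=> /rsub[].
have Kq x : K x -> 0 < sqdist y x by move=> /rsub[_ []].
pose h x := (sqdist y x)^-1 ^+ n.
have cK : compact K := @closed_eball_compact R k z r.
have Kz : K z by rewrite /K /closed_eball/= sqdist_xx ltW.
have ch x : K x -> {for x, continuous h}.
  move=> Kx; apply: (smooth_continuous (U := [set x | x != y])) => /=.
    apply: smoothX; first exact: open_neq_pt.
    apply: smoothV; [exact: open_neq_pt|by move=> t /= ty; rewrite /sqdist dotp_eq0 subr_eq0|].
    by apply: smooth_sqdist; exact: open_neq_pt.
  by apply/eqP => xy; move: (Kq _ Kx); rewrite xy sqdist_xx ltxx.
have qK x : K x -> sqdist z x = r -> x != z.
  by move=> _ xr; apply/eqP => xz; move: r0; rewrite -xr xz sqdist_xx ltxx.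
have hlt x : K x -> sqdist y z < sqdist y x -> h x < h z.
  move=> Kx qzx; rewrite /h ltr_pXn2r// ?nnegrE ?invr_ge0 ?(ltW qz) ?(ltW (Kq _ Kx))//.
  by rewrite ltf_pV2// posrE// Kq.
(* On the sphere bounding [K], points outside the ball about [y] through [z] have [h x < h z], and
   every positive [e] works there. On the remaining compact part [A], [f] stays below [f z] by a
   fixed gap, which determines [e]. *)
have [e e0 he] : exists2 e : R, 0 < e & forall x, K x -> sqdist z x = r ->
  f x + e * (h x - h z) < f z.
  pose A := [set x | K x /\ (sqdist z x = r /\ sqdist y x <= sqdist y z)].
  have outA e x : 0 < e -> K x -> sqdist z x = r -> ~ A x -> f x + e * (h x - h z) < f z.
    move=> e0 Kx xr nA; have qzx : sqdist y z < sqdist y x.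
      by rewrite ltNge; apply/negP => xz; apply: nA.
    have := fle _ (KU _ Kx); have := hlt _ Kx qzx.
    rewrite -subr_lt0 -(pmulr_rlt0 _ e0); set t := e * _ => t0; lra.
  have [A0|A0] := pselect (A !=set0); last first.
    exists 1 => // x Kx xr; apply: outA => // Ax; apply: A0; by exists x.
  have cA : compact A.
    apply: (@subclosed_compact _ _ K) => //; last by move=> x [].
    apply: closedI; first by apply: compact_closed => //; exact: norm_hausdorff.
    apply: closedI.
      by apply: (@closed_comp _ _ (sqdist z) [set t | t = r]) => [x _|];
        [exact: sqdist_continuous|exact: closed_eq].
    by apply: (@closed_comp _ _ (sqdist y) [set t | t <= sqdist y z]) => [x _|];
      [exact: sqdist_continuous|exact: closed_le].
  have [a aA fa] : exists2 a, a \in A & forall t, t \in A -> f t <= f a.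
    apply: compact_EVT_max => //; apply: continuous_in_subspaceT => x; rewrite inE => -[Kx _].
    exact: smooth_continuous sf (KU _ Kx).
  have [b bA hb] : exists2 b, b \in A & forall t, t \in A -> h t <= h b.
    apply: compact_EVT_max => //; apply: continuous_in_subspaceT => x; rewrite inE => -[Kx _].
    exact: ch.
  move: aA; rewrite inE => -[Ka [ar qa]].
  have faz : 0 < f z - f a by rewrite subr_gt0; apply: flt => //; [exact: KU|exact: qK].
  have N0 : 0 < 1 + `|h b - h z| by rewrite ltr_pwDl.
  pose e := (f z - f a) / (1 + `|h b - h z|).
  have e0 : 0 < e by rewrite divr_gt0.
  exists e => // x Kx xr; have [Ax|] := pselect (A x); last exact: outA.
  have f1 : f x <= f a by apply: fa; rewrite inE.
  have h1 : h x - h z <= `|h b - h z|.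
    by apply: le_trans (ler_norm _); rewrite lerD2r; apply: hb; rewrite inE.
  have h2 := ler_wpM2l (ltW e0) h1.
  have h3 : e * (1 + `|h b - h z|) = f z - f a by rewrite /e divfK// gt_eqF.
  move: h2 h3 f1 e0; clear.
  by move: (h x) (h b) (h z) (f x) (f a) (f z) => *; lra.
pose V := U `&` [set x | x != y].
have oV : open V by apply: openI => //; exact: open_neq_pt.
have sfV : smooth V f by apply: smooth_subset sf => x [].
have shV : smooth V h.
  apply: smoothX => //; apply: smoothV => //; last exact: smooth_sqdist.
  by move=> t [_ ty]; rewrite /sqdist dotp_eq0 subr_eq0.
(* [Psi z = f z] exceeds the values of [Psi] on the bounding sphere, so the maximum over [K] is
   interior. There the operator applied to [Psi] is at most 0, although it is nonnegative on [f] and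
   positive on [h]. *)
pose Psi x := f x + (e * h x + - (e * h z)).
have sPsi : smooth V Psi.
  apply: smoothD => //; apply: smoothD => //; last exact: smooth_cst.
  by apply: smoothM => //; exact: smooth_cst.
have KV x : K x -> V x.
  by move=> Kx; split; [exact: KU|apply/eqP => xy; move: (Kq _ Kx); rewrite xy sqdist_xx ltxx].
have [p pK Pp] : exists2 p, p \in K & forall t, t \in K -> Psi t <= Psi p.
  apply: compact_EVT_max => //; first by exists z.
  apply: continuous_in_subspaceT => x; rewrite inE => Kx.
  exact: smooth_continuous sPsi (KV _ Kx).
move: pK; rewrite inE => Kp.
have Psiz : Psi z = f z by rewrite /Psi subrr addr0.
have pr : sqdist z p < r.
  have := Kp : sqdist z p <= r; rewrite le_eqVlt => /orP[/eqP pr|//].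
  have := he _ Kp pr; rewrite mulrBr -/(Psi p) ltNge -Psiz Pp//; exact/mem_set.
have lmax : \forall x \near p, Psi x <= Psi p.
  apply: filterS (eball_nbhs pr) => x xr; apply: Pp; apply/mem_set; exact: ltW.
have D1 w t : V t -> 'D_w Psi t = 'D_w f t + e * 'D_w h t.
  move=> Vt; have df : derivable f t w := smooth_derivable sfV Vt.
  have dh : derivable h t w := smooth_derivable shV Vt.
  have -> : Psi = f + (e *: h + cst (- (e * h z))) by [].
  have dz : derivable (e *: h) t w by exact: derivableZ dh.
  have dc : derivable (cst (- (e * h z)) : _ -> R) t w by exact: derivable_cst.
  by rewrite (deriveD df (derivableD dz dc)) (deriveD dz dc) derive_cst addr0 (deriveZ _ dh).
have D2 w : 'D_w ('D_w Psi) p = 'D_w ('D_w f) p + e * 'D_w ('D_w h) p.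
  rewrite (near_eq_derive _ (open_near oV (KV _ Kp) (D1 w))).
  have df : derivable ('D_w f) p w := smooth_derivable (smooth_derive w sfV) (KV _ Kp).
  have dh : derivable ('D_w h) p w := smooth_derivable (smooth_derive w shV) (KV _ Kp).
  have -> : (fun t => 'D_w f t + e * 'D_w h t) = 'D_w f + e *: 'D_w h by [].
  have dz : derivable (e *: 'D_w h) p w by exact: derivableZ dh.
  by rewrite (deriveD df dz) (deriveZ _ dh).
have opE : elliptic_op W c Psi p = elliptic_op W c f p + e * elliptic_op W c h p.
  have key (I : finType) (a b : I -> R) (u v : R) : \sum_i (a i + e * b i) - (u + e * v) =
      \sum_i a i - u + e * (\sum_i b i - v).
    by rewrite big_split/= -mulr_sumr; ring.
  rewrite /elliptic_op (D1 (c p) p (KV _ Kp)) -key; congr (_ - _).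
  exact: (eq_bigr _ (fun s _ => D2 (row s (W p)))).
have opPsi : elliptic_op W c Psi p <= 0.
  rewrite /elliptic_op (derive_local_max_eq0 _ oV sPsi (KV _ Kp) lmax) subr0.
  by apply: sumr_le0 => s _; exact: derive2_local_max_le0 oV sPsi (KV _ Kp) lmax.
have oph : 0 < elliptic_op W c h p.
  rewrite (elliptic_op_barrier W c n oV) => [|x []//|]; last exact: KV.
  rewrite -/(E p); apply: mulr_gt0; last by case: (rsub _ Kp) => _ [].
  by rewrite mulr_gt0// exprn_gt0// invr_gt0 Kq.
have := Lf _ (KU _ Kp); have := mulr_gt0 e0 oph; move: opPsi; rewrite opE.
by move: (elliptic_op W c f p) (e * _) => *; lra.
Qed.

End hopf.

Section strong_maximum.
Variables (R : realType) (k d : nat).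
Implicit Types (U : set 'rV[R]_k) (f g : 'rV[R]_k -> R) (v w x y z : 'rV[R]_k).

Lemma smooth_dotp (e : nat) U (A B : 'rV[R]_k -> 'rV[R]_e) : open U ->
  smoothmx U A -> smoothmx U B -> smooth U (fun x => dotp (A x) (B x)).
Proof.
move=> oU sA sB; apply: (@smooth_ext _ _ _ (fun x => \sum_i A x 0 i * B x 0 i)) => //.
  by move=> x _; rewrite dotpE.
by apply: smooth_sum => // i _; exact: smoothM.
Qed.

Lemma smoothmx_sub U y : open U -> smoothmx U (fun x => x - y).
Proof.
move=> oU i j; apply: (@smooth_ext _ _ _ (fun x => x 0 j + - y 0 j)) => //.
  by move=> x _; rewrite !mxE (ord1 i).
by apply: smoothD => //; [exact: smooth_coord|exact: smooth_cst].
Qed.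

Lemma dotpZr (e : nat) a (v w : 'rV[R]_e) : dotp v (a *: w) = a * dotp v w.
Proof. by rewrite dotpC dotpZl dotpC. Qed.

Lemma dotp_sqrD (e : nat) (v w : 'rV[R]_e) :
  dotp (v + w) (v + w) = dotp v v + 2 * dotp v w + dotp w w.
Proof. by rewrite dotpDl ![dotp _ (v + w)]dotpC !dotpDl (dotpC w v); ring. Qed.

Lemma dotp_sqrB (e : nat) (v w : 'rV[R]_e) :
  dotp (v - w) (v - w) = dotp v v - 2 * dotp v w + dotp w w.
Proof. by rewrite dotp_sqrD dotpNl [dotp w (- w)]dotpC [dotp v (- w)]dotpC !dotpNl (dotpC w v);
  ring. Qed.

Lemma sqdistC x y : sqdist x y = sqdist y x.
Proof. by rewrite /sqdist -opprB dotpNl dotpC dotpNl opprK. Qed.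

Lemma sqdist_triangle x y z : sqdist x z <= 2 * (sqdist x y + sqdist y z).
Proof.
rewrite /sqdist; have -> : z - x = (z - y) + (y - x) by rewrite subrKA.
by move: (z - y) (y - x) => a b; have := dotp_ge0 (a - b); rewrite dotp_sqrB dotp_sqrD; lra.
Qed.

(** The ball about the midpoint of [y] and [z] through [z] is internally tangent at [z] to the ball
    about [y] through [z]. *)
Lemma midpoint_ball y z x : x != z ->
  sqdist (2^-1 *: (y + z)) x <= sqdist (2^-1 *: (y + z)) z -> sqdist y x < sqdist y z.
Proof.
rewrite -subr_eq0 -dotp_gt0 /sqdist.
have -> : x - 2^-1 *: (y + z) = (x - z) + 2^-1 *: (z - y).
  by apply/rowP => i; rewrite !mxE; field.
have -> : z - 2^-1 *: (y + z) = 2^-1 *: (z - y).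
  by apply/rowP => i; rewrite !mxE; field.
have -> : x - y = (x - z) + (z - y) by rewrite subrKA.
move: (x - z) (z - y) => a b.
rewrite !dotp_sqrD !dotpZl !dotpZr.
by move: (dotp a a) (dotp a b) (dotp b b) => p q r; lra.
Qed.

(** If [f] were not constant near [x1], a point [y] close to [x1] with [f y != M] would have a
    nearest point [z] among nearby points where [f = M]; a ball touching that set only at [z]
    contradicts [hopf_touching]. *)
Lemma strong_max_principle (W : 'rV[R]_k -> 'M[R]_(d, k)) (c : 'rV[R]_k -> 'rV[R]_k) U f x1 :
  open U -> smooth U f -> U x1 -> smoothmx U W -> smoothmx U c ->
  (forall x v, U x -> v != 0 -> 0 < \sum_s dotp (row s (W x)) v ^+ 2) ->
  (forall x, U x -> 0 <= elliptic_op W c f x) ->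
  (\forall x \near x1, f x <= f x1) -> \forall x \near x1, f x = f x1.
Proof.
move=> oU sf Ux1 sW sc ell Lf fmax; set M := f x1 in fmax *.
have [r r0 rsub] := nbhs_eball (filterI (open_near oU Ux1 (fun _ h => h)) fmax).
apply: contrapT => nconst.
(* With the bound [r / 16], every [x] closer to [y] than the nearest point [z] satisfies
   [sqdist x1 x < r / 4] by [sqdist_triangle], so the cut-off [r / 2] in the set [S] does not
   exclude it. *)
have [y yr fy] : exists2 y, sqdist x1 y < r / 16 & f y != M.
  apply: contrapT => H; apply: nconst.
  have r16 : sqdist x1 x1 < r / 16 by rewrite sqdist_xx divr_gt0.
  apply: filterS (eball_nbhs r16) => t tr; apply/eqP; apply: contrapT => ft.
  by apply: H; exists t => //; exact/negP.
pose S := [set x | sqdist x1 x <= r / 2 /\ f x = M].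
have rU x : sqdist x1 x <= r / 2 -> U x.
  move=> xr; suff /rsub[] : closed_eball x1 r x by [].
  by apply: le_trans xr _; lra.
have cS : compact S.
  apply: (@subclosed_compact _ _ (closed_eball x1 (r / 2))); last by move=> x [].
    move=> x clx.
    have xr : sqdist x1 x <= r / 2.
      rewrite leNgt; apply/negP => xr.
      have [|t [[tr _]]] := clx [set t | r / 2 < sqdist x1 t].
        move/cvgrPdist_lt: (@sqdist_continuous _ _ x1 x) => /(_ (sqdist x1 x - r / 2)).
        by rewrite subr_gt0 => /(_ xr); apply: filterS => t; rewrite ltr_norml => /andP[_]/=; lra.
      by rewrite /= ltNge tr.
    split=> //; apply/eqP; apply: contrapT => /negP fxM.
    have fx0 : 0 < `|f x - M| by rewrite normr_gt0 subr_eq0.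
    have := smooth_continuous sf (rU _ xr) => /cvgrPdist_lt /(_ _ fx0) fnear.
    by have [t [[_ ft]]] := clx _ fnear; rewrite /= ft ltxx.
  exact: closed_eball_compact.
have S1 : S x1 by split=> //; rewrite sqdist_xx; lra.
have [z zS zmin] : exists2 z, z \in S & forall t, t \in S -> sqdist y z <= sqdist y t.
  apply: compact_EVT_min => //; first by exists x1.
  by apply: continuous_subspaceT; exact: sqdist_continuous.
move: zS; rewrite inE => -[zr fz].
have yz : sqdist y z < r / 16.
  by apply: le_lt_trans yr; rewrite [leRHS]sqdistC; apply: zmin; rewrite inE.
have zy : z != y by apply/eqP => zy; move: fy; rewrite -zy fz eqxx.
(* z is a point of {f = M} closest to y, so that the closed ball centred at the
   midpoint y' and passing through z meets {f = M} only at z. *)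
pose y' := 2^-1 *: (y + z).
pose V := U `&` [set x | sqdist x1 x < r].
have oV : open V.
  apply: openI => //; rewrite openE => x /= xr; exact: eball_nbhs.
have zxr : sqdist x1 z < r by apply: le_lt_trans zr _; lra.
have [sS sL] : smooth U (symbol W y') /\ smooth U (lower_order W c y').
  have srow s : smoothmx U (fun x => row s (W x)).
    by move=> i j; apply: smooth_ext (sW s j) => // x _; rewrite mxE.
  split.
    apply: smooth_sum => // s _; apply: smoothX => //.
    by apply: smooth_dotp => //; exact: smoothmx_sub.
  apply: smoothD => //.
    by apply: smooth_sum => // s _; exact: smooth_dotp.
  by apply: smoothN => //; apply: smooth_dotp => //; exact: smoothmx_sub.
apply: (@hopf_touching R k d W c V f y' z) => //.
- by apply: smooth_subset sf => x [].
- by split=> //; exact: rU.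
- rewrite -subr_eq0 (_ : z - y' = 2^-1 *: (z - y)).
    by rewrite scaler_eq0 invr_eq0 pnatr_eq0/= subr_eq0.
  by apply/rowP => i; rewrite !mxE; field.
- by move=> x [Ux _]; exact: smooth_continuous sS Ux.
- by move=> x [Ux _]; exact: smooth_continuous sL Ux.
- apply: ell; first exact: rU.
  rewrite (_ : z - y' = 2^-1 *: (z - y)).
    by rewrite scaler_eq0 invr_eq0 pnatr_eq0/= subr_eq0.
  by apply/rowP => i; rewrite !mxE; field.
- by move=> x [Ux _]; exact: Lf.
- move=> x [Ux xr]; rewrite fz; suff /rsub[] : closed_eball x1 r x by [].
  exact: ltW.
move=> x [Ux xr] xz xy; rewrite fz lt_neqAle; apply/andP; split; last first.
  by suff /rsub[] : closed_eball x1 r x by []; exact: ltW.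
apply/eqP => fx; have xyz := midpoint_ball xz xy.
suff : sqdist y z <= sqdist y x by rewrite leNgt xyz.
apply: zmin; rewrite inE; split=> //.
have := sqdist_triangle x1 y x; rewrite /= in yr yz xyz *.
by move: (sqdist x1 x) (sqdist x1 y) (sqdist y x) (sqdist y z) yr yz xyz r0; clear => *; lra.
Qed.

End strong_maximum.

(** * Matrix calculus *)

Section matrix_calculus.
Variables (R : realType) (k : nat).
Implicit Types (U : set 'rV[R]_k) (v w x : 'rV[R]_k).

Lemma smoothmx_derivable p q U (A : 'rV[R]_k -> 'M[R]_(p, q)) x v :
  smoothmx U A -> U x -> derivable A x v.
Proof. by move=> sA Ux; apply/derivable_mxP => i j; exact: smooth_derivable (sA i j) Ux. Qed.

Lemma derive_entry p q U (A : 'rV[R]_k -> 'M[R]_(p, q)) x v i j :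
  smoothmx U A -> U x -> 'D_v A x i j = 'D_v (fun y => A y i j) x.
Proof. by move=> sA Ux; rewrite (derive_mx (smoothmx_derivable (v := v) sA Ux)) mxE. Qed.

Lemma smoothmx_derive p q U (A : 'rV[R]_k -> 'M[R]_(p, q)) v :
  open U -> smoothmx U A -> smoothmx U ('D_v A).
Proof.
move=> oU sA i j; apply: smooth_ext (smooth_derive v (sA i j)) => // x Ux.
by rewrite (derive_entry _ _ _ sA Ux).
Qed.

Lemma smoothmx_ext p q U (A B : 'rV[R]_k -> 'M[R]_(p, q)) :
  open U -> (forall x, U x -> A x = B x) -> smoothmx U A -> smoothmx U B.
Proof. by move=> oU AB sA i j; apply: smooth_ext (sA i j) => // x Ux; rewrite AB. Qed.

Lemma smoothmx_cst p q U (A : 'M[R]_(p, q)) : open U -> smoothmx U (cst A).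
Proof. by move=> oU i j; exact: smooth_cst. Qed.

Lemma smoothmxD p q U (A B : 'rV[R]_k -> 'M[R]_(p, q)) : open U ->
  smoothmx U A -> smoothmx U B -> smoothmx U (fun x => A x + B x).
Proof.
move=> oU sA sB i j; apply: smooth_ext (smoothD oU (sA i j) (sB i j)) => // x _.
by rewrite mxE.
Qed.

Lemma smoothmx_mul p q r U (A : 'rV[R]_k -> 'M[R]_(p, q)) (B : 'rV[R]_k -> 'M[R]_(q, r)) :
  open U -> smoothmx U A -> smoothmx U B -> smoothmx U (fun x => A x *m B x).
Proof.
move=> oU sA sB i j.
apply: (@smooth_ext _ _ _ (fun x => \sum_l A x i l * B x l j)) => //.
  by move=> x _; rewrite mxE.
by apply: smooth_sum => // l _; exact: smoothM.
Qed.

Lemma smoothmx_tr p q U (A : 'rV[R]_k -> 'M[R]_(p, q)) : open U ->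
  smoothmx U A -> smoothmx U (fun x => (A x)^T).
Proof. by move=> oU sA i j; apply: smooth_ext (sA j i) => // x _; rewrite mxE. Qed.

Lemma smoothmx_row p q U (A : 'rV[R]_k -> 'M[R]_(p, q)) i : open U ->
  smoothmx U A -> smoothmx U (fun x => row i (A x)).
Proof. by move=> oU sA i' j; apply: smooth_ext (sA i j) => // x _; rewrite mxE. Qed.

Lemma smoothmx_col_mx p1 p2 q U (A : 'rV[R]_k -> 'M[R]_(p1, q)) (B : 'rV[R]_k -> 'M[R]_(p2, q)) :
  open U -> smoothmx U A -> smoothmx U B -> smoothmx U (fun x => col_mx (A x) (B x)).
Proof.
move=> oU sA sB i j; case: (split_ordP i) => i' ->.
  by apply: smooth_ext (sA i' j) => // x _; rewrite col_mxEu.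
by apply: smooth_ext (sB i' j) => // x _; rewrite col_mxEd.
Qed.

Lemma smooth_det p U (A : 'rV[R]_k -> 'M[R]_p) : open U ->
  smoothmx U A -> smooth U (fun x => \det (A x)).
Proof.
move=> oU sA; apply: smooth_sum => // s _; apply: smoothM => //; first exact: smooth_cst.
by apply: smooth_prod => // i _; exact: sA.
Qed.

Lemma smoothmx_invmx p U (A : 'rV[R]_k -> 'M[R]_p) : open U ->
  smoothmx U A -> (forall x, U x -> A x \in unitmx) ->
  smoothmx U (fun x => invmx (A x)).
Proof.
move=> oU sA uA i j.
apply: (@smooth_ext _ _ _ (fun x => (\det (A x))^-1 * \adj (A x) i j)) => //.
  by move=> x Ux; rewrite /invmx (uA x Ux) [RHS]mxE.
apply: smoothM => //.
  apply: smoothV => //; last exact: smooth_det.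
  by move=> x /uA; rewrite unitmxE unitfE.
apply: (@smooth_ext _ _ _ (fun x => (-1) ^+ (j + i) * \det (row' j (col' i (A x))))) => //.
  by move=> x _; rewrite mxE.
apply: smoothM => //; first exact: smooth_cst.
apply: smooth_det => // i' j'; apply: smooth_ext (sA (lift j i') (lift i j')) => // x _.
by rewrite !mxE.
Qed.

Lemma derive_mx_cst p q (A : 'M[R]_(p, q)) x v : 'D_v (cst A) x = 0.
Proof. exact: derive_cst. Qed.

Lemma derive_mxD p q U (A B : 'rV[R]_k -> 'M[R]_(p, q)) x v :
  smoothmx U A -> smoothmx U B -> U x ->
  'D_v (fun y => A y + B y) x = 'D_v A x + 'D_v B x.
Proof. by move=> sA sB Ux; exact: deriveD (smoothmx_derivable (v :=
  v) sA Ux) (smoothmx_derivable (v := v) sB Ux). Qed.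

Lemma scale_addC (a b c e : R) : a *: b + c *: e = e * c + a * b.
Proof. by rewrite addrC; congr (_ + _); exact: mulrC. Qed.

Lemma derive_mulmx p q r U (A : 'rV[R]_k -> 'M[R]_(p, q)) (B : 'rV[R]_k -> 'M[R]_(q, r)) x v :
  open U -> smoothmx U A -> smoothmx U B -> U x ->
  'D_v (fun y => A y *m B y) x = 'D_v A x *m B x + A x *m 'D_v B x.
Proof.
move=> oU sA sB Ux; have sAB := smoothmx_mul oU sA sB.
apply/matrixP => i j; rewrite (derive_entry _ _ _ sAB Ux) !mxE.
have -> : (fun y => (A y *m B y) i j) = \sum_l ((fun y => A y i l) * (fun y => B y l j)).
  by apply/funext => y; rewrite mxE fct_sumE.
have dA l : derivable (fun y => A y i l) x v := smooth_derivable (sA i l) Ux.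
have dB l : derivable (fun y => B y l j) x v := smooth_derivable (sB l j) Ux.
rewrite derive_sum; last by move=> l; exact: derivableM (dA l) (dB l).
rewrite -big_split/=; apply: eq_bigr => l _.
rewrite (deriveM (dA l) (dB l)) (derive_entry _ _ _ sA Ux) (derive_entry _ _ _ sB Ux).
exact: scale_addC.
Qed.

Lemma derive_tr p q U (A : 'rV[R]_k -> 'M[R]_(p, q)) x v :
  open U -> smoothmx U A -> U x -> 'D_v (fun y => (A y)^T) x = ('D_v A x)^T.
Proof.
move=> oU sA Ux; apply/matrixP => i j.
rewrite (derive_entry _ _ _ (smoothmx_tr oU sA) Ux) [in RHS]mxE (derive_entry _ _ _ sA Ux).
by congr ('D_v _ x); apply/funext => y; rewrite mxE.
Qed.

Lemma derive_row p q U (A : 'rV[R]_k -> 'M[R]_(p, q)) x v i :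
  open U -> smoothmx U A -> U x -> 'D_v (fun y => row i (A y)) x = row i ('D_v A x).
Proof.
move=> oU sA Ux; apply/matrixP => i' j.
rewrite (derive_entry _ _ _ (smoothmx_row i oU sA) Ux) [in RHS]mxE (derive_entry _ _ _ sA Ux).
by congr ('D_v _ x); apply/funext => y; rewrite mxE.
Qed.

Lemma derive_col_mx p1 p2 q U (A : 'rV[R]_k -> 'M[R]_(p1, q)) (B : 'rV[R]_k -> 'M[R]_(p2, q)) x v :
  open U -> smoothmx U A -> smoothmx U B -> U x ->
  'D_v (fun y => col_mx (A y) (B y)) x = col_mx ('D_v A x) ('D_v B x).
Proof.
move=> oU sA sB Ux; apply/matrixP => i j.
rewrite (derive_entry _ _ _ (smoothmx_col_mx oU sA sB) Ux).
case: (split_ordP i) => i' ->.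
  rewrite col_mxEu (derive_entry _ _ _ sA Ux).
  by congr ('D_v _ x); apply/funext => y; rewrite col_mxEu.
rewrite col_mxEd (derive_entry _ _ _ sB Ux).
by congr ('D_v _ x); apply/funext => y; rewrite col_mxEd.
Qed.

Lemma derive_prod (I : finType) U (a : I -> 'rV[R]_k -> R) x v :
  open U -> (forall i, smooth U (a i)) -> U x ->
  'D_v (fun y => \prod_i a i y) x = \sum_i 'D_v (a i) x * \prod_(j | j != i) a j x.
Proof.
move=> oU sa Ux.
suff H (s : seq I) : uniq s -> 'D_v (fun y => \prod_(i <- s) a i y) x =
    \sum_(i <- s) 'D_v (a i) x * \prod_(j <- s | j != i) a j x.
  by rewrite H ?index_enum_uniq.
elim: s => [|i s IH] /=.
  by rewrite !big_nil (_ : (fun y => _) = cst 1) ?derive_cst//; apply/funext => y; rewrite big_nil.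
move=> /andP[iNs us]; have ds : derivable (fun y => \prod_(i <- s) a i y) x v.
  have sp : smooth U (fun y => \prod_(i <- s) a i y) by apply: smooth_prod.
  exact: smooth_derivable sp Ux.
have di : derivable (a i) x v := smooth_derivable (sa i) Ux.
rewrite (_ : (fun y => _) = a i * (fun y => \prod_(i <- s) a i y)); last first.
  by apply/funext => y; rewrite big_cons.
rewrite (deriveM di ds) (IH us) !big_cons eqxx /= scale_addC; congr (_ * _ + _).
  rewrite [RHS]big_seq_cond [LHS]big_seq.
  apply: eq_bigl => j; case: (boolP (j \in s)) => //= js; symmetry.
  by apply: contraNneq iNs => <-.
rewrite [LHS]mulr_sumr; apply: eq_big_seq => j js.
have ij : i != j by apply: contraNneq iNs => ->.
by rewrite big_cons ij; exact: mulrCA.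
Qed.

Lemma derive_bigsum (I : Type) (s : seq I) (F : I -> 'rV[R]_k -> R) x v :
  (forall i, derivable (F i) x v) ->
  'D_v (fun y => \sum_(i <- s) F i y) x = \sum_(i <- s) 'D_v (F i) x.
Proof.
move=> dF.
suff [_] : derivable (fun y => \sum_(i <- s) F i y) x v /\
    'D_v (fun y => \sum_(i <- s) F i y) x = \sum_(i <- s) 'D_v (F i) x by [].
elim: s => [|i s [ds IH]].
  rewrite (_ : (fun y => _) = cst 0); last by apply/funext => y; rewrite big_nil.
  by rewrite derive_cst big_nil; split=> //; exact: derivable_cst.
rewrite (_ : (fun y => _) = F i + (fun y => \sum_(i <- s) F i y)); last first.
  by apply/funext => y; rewrite big_cons.
split; first exact: derivableD (dF i) ds.
by rewrite big_cons (deriveD (dF i) ds) IH.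
Qed.

(** Jacobi's formula: the product rule on the Leibniz expansion replaces one row at a time by its
    derivative, and expanding each determinant along that row produces the adjugate. *)
Lemma derive_det p U (A : 'rV[R]_k -> 'M[R]_p) x v :
  open U -> smoothmx U A -> U x ->
  'D_v (fun y => \det (A y)) x = \tr (\adj (A x) *m 'D_v A x).
Proof.
move=> oU sA Ux.
have sp (s : 'S_p) : smooth U (fun y => \prod_i A y i (s i)).
  by apply: smooth_prod => // i _; exact: sA.
rewrite /determinant derive_bigsum; last first.
  move=> s; have ds : derivable (fun y => \prod_i A y i (s i)) x v := smooth_derivable (sp s) Ux.
  by apply: derivableM; [exact: derivable_cst|exact: ds].
have Ds (s : 'S_p) : 'D_v (fun y => (-1) ^+ s * \prod_i A y i (s i)) x =
    \sum_i (-1) ^+ s * ('D_v A x i (s i) * \prod_(j | j != i) A x j (s j)).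
  have ds : derivable (fun y => \prod_i A y i (s i)) x v := smooth_derivable (sp s) Ux.
  rewrite (_ : (fun y => _) = (-1) ^+ s *: (fun y => \prod_i A y i (s i))); last by [].
  rewrite (deriveZ _ ds) (derive_prod _ oU _ Ux); last by move=> i; exact: sA.
  rewrite [LHS]mulr_sumr; apply: eq_bigr => i _.
  by rewrite (derive_entry _ _ _ sA Ux).
rewrite (eq_bigr _ (fun s _ => Ds s)) exchange_big/=.
pose B i := \matrix_(r, c) (if r == i then 'D_v A x i c else A x r c).
have -> : \sum_i \sum_(s : 'S_p) (-1) ^+ s * ('D_v A x i (s i) * \prod_(j | j != i) A x j (s j)) =
    \sum_i \det (B i).
  apply: eq_bigr => i _; apply: eq_bigr => s _; rewrite [in RHS](bigD1 i)//=.
  rewrite mxE eqxx; congr (_ * (_ * _)); apply: eq_bigr => j ji.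
  by rewrite mxE (negbTE ji).
rewrite mxtrace_mulC /mxtrace; apply: eq_bigr => i _.
rewrite (expand_det_row _ i) mxE; apply: eq_bigr => j _.
rewrite mxE eqxx mxE /cofactor; congr (_ * (_ * \det _)).
by apply/matrixP => r c; rewrite !mxE eq_sym (negbTE (neq_lift _ _)).
Qed.

End matrix_calculus.

(** * Jets of a minimal cone written as a graph *)

Lemma mulmx_tr0 (R : comPzRingType) (m n p : nat) (X : 'M[R]_(m, p)) (Y : 'M[R]_(n, p)) :
  X *m Y^T = 0 -> Y *m X^T = 0.
Proof. by move=> XY; rewrite -[Y]trmxK -trmx_mul XY trmx0. Qed.

Section graph_coordinates.
Variables (R : fieldType) (n m d : nat).
Variables (P T : 'M[R]_(n, d)) (E : 'M[R]_(m, d)) (Z : 'M[R]_(n, m)).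
Hypotheses (PP : P *m P^T = 1%:M) (EE : E *m E^T = 1%:M) (EP : E *m P^T = 0).
Hypothesis PE1 : P^T *m P + E^T *m E = 1%:M.
Hypothesis CZ : T *m P^T *m Z = T *m E^T.

(** The row space of [T] lies in the graph spanned by [P + Z *m E]. These columns are normal to that
    graph, and their Gram matrix is [1%:M + Z^T *m Z]. *)
Definition slope_normal : 'M[R]_(d, m) := E^T - P^T *m Z.

Lemma frame_graphE : T = T *m P^T *m (P + Z *m E).
Proof. by rewrite -[LHS]mulmx1 -PE1 !mulmxDr !mulmxA CZ. Qed.

Lemma frame_slope_normal : T *m slope_normal = 0.
Proof. by rewrite /slope_normal mulmxBr mulmxA CZ subrr. Qed.

Lemma gram_graphE : T *m T^T = T *m P^T *m (1%:M + Z *m Z^T) *m (T *m P^T)^T.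
Proof.
rewrite {1 2}frame_graphE [in LHS]trmx_mul !mulmxA; congr (_ *m _); rewrite -!mulmxA;
  congr (_ *m (_ *m _)).
rewrite linearD/= trmx_mul mulmxDl !mulmxDr PP (mulmxA P) (mulmx_tr0 EP) mul0mx addr0.
by rewrite -!mulmxA EP mulmx0 add0r (mulmxA E) EE mul1mx.
Qed.

Lemma inv_comm_slope : 1%:M + Z *m Z^T \in unitmx -> 1%:M + Z^T *m Z \in unitmx ->
  Z^T *m invmx (1%:M + Z *m Z^T) = invmx (1%:M + Z^T *m Z) *m Z^T.
Proof.
move=> u1 u2; apply: (canRL (mulKmx u2)); rewrite mulmxA.
have -> : (1%:M + Z^T *m Z) *m Z^T = Z^T *m (1%:M + Z *m Z^T).
  by rewrite mulmxDl mulmxDr mul1mx mulmx1 mulmxA.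
by rewrite mulmxK.
Qed.

(** Both sides are minus the component of [P^T] normal to the graph: with [B = slope_normal], the
    normal projection is [B *m invmx (1%:M + Z^T *m Z) *m B^T], and [B^T *m P^T = - Z^T]. *)
Lemma projection_graph : T *m P^T \in unitmx -> T *m T^T \in unitmx ->
  1%:M + Z *m Z^T \in unitmx -> 1%:M + Z^T *m Z \in unitmx ->
  T^T *m invmx (T *m T^T) *m (T *m P^T) - P^T =
  slope_normal *m invmx (1%:M + Z^T *m Z) *m Z^T.
Proof.
move=> uC uG u1 u2; set C := T *m P^T in uC *; set K := invmx (1%:M + Z *m Z^T).
have GC : invmx (T *m T^T) *m C = invmx C^T *m K.
  apply: (canLR (mulKmx uG)).
  rewrite gram_graphE -/C -!mulmxA; congr (_ *m _).
  by rewrite (mulmxA C^T) mulmxV ?unitmx_tr// mul1mx mulmxV// mulmx1.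
rewrite -mulmxA GC mulmxA {1}frame_graphE -/C trmx_mul mulmxK ?unitmx_tr//.
rewrite linearD/= trmx_mul mulmxDl -!mulmxA (inv_comm_slope u1 u2) /slope_normal mulmxBl.
rewrite addrAC [RHS]addrC; congr (_ + _); rewrite -!mulmxA -mulmxN -[X in _ - X]mulmx1 -mulmxBr;
  congr (_ *m _).
rewrite -(inv_comm_slope u1 u2) -[X in _ - X](mulmxV u1) -/K mulmxDl mul1mx mulmxA.
by rewrite opprD addrA subrr sub0r.
Qed.

End graph_coordinates.

(* Here and below J1 a, J2 a b, ... stand for first and second partial
   derivatives, gi for the inverse metric and mu for the trace of J1. *)
Section minimal_jets.
Variables (R : fieldType) (k m d : nat).
Variables (f : 'rV[R]_d) (J : 'M[R]_(k, d)).
Variables (J1 : 'I_k -> 'M[R]_(k, d)) (J2 : 'I_k -> 'I_k -> 'M[R]_(k, d)).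
Variables (gi : 'M[R]_k) (gi1 : 'I_k -> 'M[R]_k).
Variables (B : 'M[R]_(d, m)) (B1 : 'I_k -> 'M[R]_(d, m)).
Let T := col_mx f J.
Let T1 a := col_mx (row a J) (J1 a).
Let T2 a b := col_mx (row b (J1 a)) (J2 a b).
Hypotheses (JB : J *m B = 0).
Hypothesis giJ : gi *m (J *m J^T) = 1%:M.
Hypothesis gi_sym : gi^T = gi.
Hypothesis gi1E : forall c, gi1 c *m (J *m J^T) + gi *m (J1 c *m J^T + J *m (J1 c)^T) = 0.
Hypothesis J1sym : forall a b, row a (J1 b) = row b (J1 a).
Hypothesis J2sym : forall a b c, row c (J2 a b) = row b (J2 c a).
Let mu := \sum_a row a gi *m J1 a.
Hypothesis muB : mu *m B = 0.
Hypothesis muB1 : forall c,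
  (\sum_a (row a (gi1 c) *m J1 a + row a gi *m J2 c a)) *m B + mu *m B1 c = 0.
Variable ga : 'rV[R]_k.
Hypothesis muB1E : forall c, mu *m B1 c = - (ga *m J1 c *m B).

Lemma rowZ (p q : nat) (i : 'I_p) a (A : 'M[R]_(p, q)) : row i (a *: A) = a *: row i A.
Proof. by apply/rowP => j; rewrite !mxE. Qed.

Lemma row_bigsum (I : Type) (s : seq I) (p q : nat) (i : 'I_p) (A : I -> 'M[R]_(p, q)) :
  row i (\sum_(j <- s) A j) = \sum_(j <- s) row i (A j).
Proof. by apply/rowP => j; rewrite mxE !summxE; apply: eq_bigr => l _; rewrite mxE. Qed.

Lemma col_mx_bigsum (I : Type) (s : seq I) (p1 p2 q : nat) (A1 : I -> 'M[R]_(p1, q))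
    (A2 : I -> 'M[R]_(p2, q)) :
  \sum_(j <- s) col_mx (A1 j) (A2 j) = col_mx (\sum_(j <- s) A1 j) (\sum_(j <- s) A2 j).
Proof.
elim: s => [|j s IH]; first by rewrite !big_nil col_mx0.
by rewrite !big_cons IH add_col_mx.
Qed.

Lemma sum_row_sym (X : 'M[R]_k) :
  \sum_a row a X *m J1 a = \sum_a row a X^T *m J1 a.
Proof.
under eq_bigr do rewrite mulmx_sum_row.
under [RHS]eq_bigr do rewrite mulmx_sum_row.
rewrite exchange_big/=; apply: eq_bigr => a _; apply: eq_bigr => b _.
by rewrite !mxE J1sym.
Qed.

(** In the top row both sides vanish by minimality. The other rows are the differentiated minimality
    equation: [gi1 c = - (X + X^T)] with [X = gi *m J1 c *m J^T *m gi], and the two halves count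
    equally because [J1] is symmetric in its indices. *)
Lemma laplacian_frame :
  (\sum_a \sum_b gi a b *: T2 a b - \sum_e ga 0 e *: T1 e) *m B =
  2 *: \sum_a \sum_b gi a b *: (T1 a *m (J^T *m gi *m (J1 b *m B))).
Proof.
have Jgi : J *m J^T *m gi = 1%:M by rewrite -[gi]gi_sym -{1}[J]trmxK -!trmx_mul giJ trmx1.
have up : (\sum_a \sum_b gi a b *: row b (J1 a) - ga *m J) *m B = 0.
  have -> : \sum_a \sum_b gi a b *: row b (J1 a) = mu.
    by apply: eq_bigr => a _; rewrite mulmx_sum_row; apply: eq_bigr => b _; rewrite mxE.
  by rewrite mulmxBl muB -mulmxA JB mulmx0 subrr.
have gs a b : gi a b = gi b a by rewrite -{1}gi_sym mxE.
have up2 : \sum_a \sum_b gi a b *: (row a J *m (J^T *m gi *m (J1 b *m B))) = 0.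
  transitivity (mu *m B); last exact: muB.
  rewrite /mu mulmx_suml exchange_big/=; apply: eq_bigr => b _.
  rewrite -[RHS]mulmxA [RHS]mulmx_sum_row; apply: eq_bigr => a _.
  by rewrite !mxE gs -row_mul !mulmxA Jgi mul1mx.
have lo : (\sum_a \sum_b gi a b *: J2 a b - \sum_e ga 0 e *: J1 e) *m B =
    2 *: \sum_a \sum_b gi a b *: (J1 a *m (J^T *m gi *m (J1 b *m B))).
  apply/row_matrixP => c.
  rewrite row_mul linearB/= rowZ !row_bigsum.
  have -> : \sum_a row c (\sum_b gi a b *: J2 a b) = \sum_a row a gi *m J2 c a.
    apply: eq_bigr => a _; rewrite row_bigsum [RHS]mulmx_sum_row; apply: eq_bigr => b _.
    by rewrite rowZ mxE J2sym.
  have -> : \sum_e row c (ga 0 e *: J1 e) = ga *m J1 c.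
    by rewrite [RHS]mulmx_sum_row; apply: eq_bigr => e _; rewrite rowZ J1sym.
  have gE : gi1 c = - (gi *m (J1 c *m J^T + J *m (J1 c)^T) *m gi).
    apply/eqP; rewrite -addr_eq0; apply/eqP.
    have := congr1 (mulmxr gi) (gi1E c); rewrite /= mul0mx mulmxDl => <-.
    by rewrite -(mulmxA (gi1 c)) Jgi mulmx1.
  have -> : (\sum_a row a gi *m J2 c a - ga *m J1 c) *m B = - (\sum_a row a (gi1 c) *m J1 a) *m B.
    have := muB1 c; rewrite muB1E big_split/= mulmxDl mulmxBl mulNmx => /eqP.
    by rewrite -addrA addr_eq0 => /eqP->; rewrite opprK.
  set X := gi *m J1 c *m J^T *m gi.
  have -> : - (\sum_a row a (gi1 c) *m J1 a) = 2 *: \sum_a row a X *m J1 a.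
    have -> : gi1 c = - (X + X^T).
      rewrite gE /X !trmx_mul trmxK gi_sym mulmxDr mulmxDl.
      by rewrite !mulmxA.
    rewrite -sumrN scaler_nat mulr2n {2}sum_row_sym -big_split/=; apply: eq_bigr => a _.
    by rewrite linearN/= mulNmx opprK linearD/= mulmxDl.
  rewrite -scalemxAl; congr (_ *: _); rewrite mulmx_suml.
  under [RHS]eq_bigr do rewrite row_bigsum.
  rewrite [RHS]exchange_big/=; apply: eq_bigr => b _.
  rewrite /X -!mulmxA row_mul (mulmx_sum_row (row _ gi)) mulmx_suml; apply: eq_bigr => a _.
  by rewrite mxE rowZ -!scalemxAl gs !row_mul (J1sym a c) !mulmxA.
have -> : \sum_a \sum_b gi a b *: T2 a b - \sum_e ga 0 e *: T1 e =
    col_mx (\sum_a \sum_b gi a b *: row b (J1 a) - ga *m J)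
           (\sum_a \sum_b gi a b *: J2 a b - \sum_e ga 0 e *: J1 e).
  rewrite (mulmx_sum_row ga J) -add_col_mx -opp_col_mx; congr (_ - _).
    rewrite -col_mx_bigsum; apply: eq_bigr => a _; rewrite -col_mx_bigsum; apply: eq_bigr => b _.
    by rewrite scale_col_mx.
  by rewrite -col_mx_bigsum; apply: eq_bigr => e _; rewrite scale_col_mx.
rewrite mul_col_mx up lo.
have -> : \sum_a \sum_b gi a b *: (T1 a *m (J^T *m gi *m (J1 b *m B))) =
    col_mx 0 (\sum_a \sum_b gi a b *: (J1 a *m (J^T *m gi *m (J1 b *m B)))).
  rewrite -up2 -col_mx_bigsum; apply: eq_bigr => a _; rewrite -col_mx_bigsum.
  by apply: eq_bigr => b _; rewrite mul_col_mx scale_col_mx.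
by rewrite scale_col_mx scaler0.
Qed.

End minimal_jets.

Lemma gram_col_mx (R : fieldType) (k d : nat) (f : 'rV[R]_d) (J : 'M[R]_(k, d)) :
  f *m f^T = 1%:M -> f *m J^T = 0 ->
  col_mx f J *m (col_mx f J)^T = block_mx 1%:M 0 0 (J *m J^T).
Proof.
move=> ff fJ; rewrite tr_col_mx mul_col_row ff fJ.
by rewrite (mulmx_tr0 fJ).
Qed.

Lemma invmx_block_diag1 (R : fieldType) (k : nat) (g gi : 'M[R]_k) :
  gi *m g = 1%:M ->
  block_mx (1%:M : 'M[R]_1) 0 0 g \in unitmx /\
  invmx (block_mx (1%:M : 'M[R]_1) 0 0 g) = block_mx 1%:M 0 0 gi.
Proof.
move=> gig.
have E : block_mx (1%:M : 'M[R]_1) 0 0 gi *m block_mx 1%:M 0 0 g = 1%:M.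
  by rewrite mulmx_block !mul0mx !mulmx0 !addr0 !add0r mul1mx gig -scalar_mx_block.
have [_ u] := mulmx1_unit E; split=> //.
by rewrite -[RHS](mulmxK u) E mul1mx.
Qed.

Section harmonic_slope.
Variables (R : fieldType) (k m d : nat).
Variables (P : 'M[R]_(1 + k, d)) (E : 'M[R]_(m, d)) (Z : 'M[R]_(1 + k, m)).
Variables (f : 'rV[R]_d) (J : 'M[R]_(k, d)).
Variables (J1 : 'I_k -> 'M[R]_(k, d)) (J2 : 'I_k -> 'I_k -> 'M[R]_(k, d)).
Variables (Z1 : 'I_k -> 'M[R]_(1 + k, m)) (Z2 : 'I_k -> 'I_k -> 'M[R]_(1 + k, m)).
Variables (gi : 'M[R]_k) (gi1 : 'I_k -> 'M[R]_k).
Let T := col_mx f J.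
Let T1 a := col_mx (row a J) (J1 a).
Let T2 a b := col_mx (row b (J1 a)) (J2 a b).
Let C := T *m P^T.
Let B := slope_normal P E Z.
Let mu := \sum_a row a gi *m J1 a.
Let ga := mu *m J^T *m gi.
Hypotheses (PP : P *m P^T = 1%:M) (EE : E *m E^T = 1%:M) (EP : E *m P^T = 0).
Hypothesis PE1 : P^T *m P + E^T *m E = 1%:M.
Hypotheses (ff : f *m f^T = 1%:M) (fJ : f *m J^T = 0).
Hypothesis giJ : gi *m (J *m J^T) = 1%:M.
Hypothesis uC : C \in unitmx.
Hypothesis uZ : 1%:M + Z *m Z^T \in unitmx.
Hypothesis uZ' : 1%:M + Z^T *m Z \in unitmx.
Hypothesis CZ : C *m Z = T *m E^T.
Hypothesis CZ1 : forall a, T1 a *m P^T *m Z + C *m Z1 a = T1 a *m E^T.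
Hypothesis CZ2 : forall a b, T2 a b *m P^T *m Z + T1 a *m P^T *m Z1 b +
  (T1 b *m P^T *m Z1 a + C *m Z2 a b) = T2 a b *m E^T.
Hypothesis gi1E : forall c, gi1 c *m (J *m J^T) + gi *m (J1 c *m J^T + J *m (J1 c)^T) = 0.
Hypothesis J1sym : forall a b, row a (J1 b) = row b (J1 a).
Hypothesis J2sym : forall a b c, row c (J2 a b) = row b (J2 c a).
Hypothesis muB : mu *m B = 0.
Hypothesis muB1 : forall c,
  (\sum_a (row a (gi1 c) *m J1 a + row a gi *m J2 c a)) *m B - mu *m P^T *m Z1 c = 0.

Lemma inverse_metric_sym : gi^T = gi.
Proof.
have u : J *m J^T \in unitmx by have [] := mulmx1_unit giJ.
have -> : gi = invmx (J *m J^T) by rewrite -[LHS](mulmxK u) giJ mul1mx.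
by rewrite trmx_inv trmx_mul trmxK.
Qed.

Lemma slope_derivE a : C *m Z1 a = T1 a *m B.
Proof. by rewrite mulmxBr mulmxA -CZ1 addrC addKr. Qed.

(** Converse of [frame_slope_normal]: the slope normal cuts out exactly the row space of [T], and
    the block form of the Gram matrix of [T] separates the radial from the tangential
    coefficients. *)
Lemma tangentialE (u : 'rV[R]_d) : u *m B = 0 ->
  u = (u *m f^T) *m f + (u *m J^T *m gi) *m J.
Proof.
move=> uB; have TT := gram_col_mx ff fJ; have [uG iG] := invmx_block_diag1 giJ.
rewrite -TT in uG.
have pr := projection_graph PP EE EP PE1 CZ uC uG uZ uZ'.
have uP : u *m T^T *m invmx (T *m T^T) *m C = u *m P^T.
  apply/eqP; rewrite -subr_eq0; apply/eqP.
  by have := congr1 (mulmx u) pr; rewrite mulmxBr !mulmxA uB !mul0mx.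
have uE : u *m E^T = u *m P^T *m Z by apply/eqP; rewrite -subr_eq0 -mulmxA -mulmxBr uB.
have uG2 : u = u *m P^T *m (P + Z *m E).
  by rewrite mulmxDr [in RHS]mulmxA -uE -!mulmxA -mulmxDr PE1 mulmx1.
rewrite {1}uG2 -uP -(mulmxA _ C) -(frame_graphE PE1 CZ) TT iG tr_col_mx mul_mx_row mul_row_block.
by rewrite !mulmx0 addr0 add0r mulmx1 mul_row_col.
Qed.

Lemma tangent_slope_normal : J *m B = 0.
Proof.
have : T *m B = 0 := frame_slope_normal CZ; rewrite /T mul_col_mx => /(congr1 dsubmx).
by rewrite col_mxKd linear0.
Qed.

(** By minimality [mu] is tangent to the cone, so its product with the derivative of [B] only sees
    its coefficients in the frame; the radial one drops out because [J *m B = 0]. *)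
Lemma mu_normal_derivative c : mu *m (- (P^T *m Z1 c)) = - (ga *m J1 c *m B).
Proof.
rewrite mulmxN; congr (- _); rewrite {1}(tangentialE muB) -/ga -mul_row_col.
have -> : row_mx (mu *m f^T) ga *m col_mx f J *m (P^T *m Z1 c) =
    row_mx (mu *m f^T) ga *m (C *m Z1 c) by rewrite /C !mulmxA.
rewrite slope_derivE mul_col_mx mul_row_col -row_mul tangent_slope_normal.
by rewrite linear0 mulmx0 add0r mulmxA.
Qed.

(** The twice differentiated equation [C *m Z = T *m E^T] involves second derivatives of [T], which
    [laplacian_frame] replaces; the products of first derivatives that remain differ by the
    projection defect of [projection_graph]. The result is the harmonic map equation in graph
    coordinates of the Grassmannian. *)
Lemma harmonic_slope :
  \sum_a \sum_b gi a b *: Z2 a b - \sum_e ga 0 e *: Z1 e =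
  2 *: \sum_a \sum_b gi a b *: (Z1 a *m invmx (1%:M + Z^T *m Z) *m Z^T *m Z1 b).
Proof.
have JB := tangent_slope_normal.
have TT := gram_col_mx ff fJ; have [uG iG] := invmx_block_diag1 giJ.
rewrite -TT in uG iG.
have pr := projection_graph PP EE EP PE1 CZ uC uG uZ uZ'.
have LT := laplacian_frame JB giJ inverse_metric_sym gi1E J1sym J2sym muB
  (B1 := fun c => - (P^T *m Z1 c)).
have {LT}LT := LT _ ga mu_normal_derivative.
have {}LT : (\sum_a \sum_b gi a b *: T2 a b - \sum_e ga 0 e *: T1 e) *m B =
  2 *: \sum_a \sum_b gi a b *: (T1 a *m (T^T *m invmx (T *m T^T) *m C *m Z1 b)).
  rewrite LT; last by move=> c; rewrite -(muB1 c) mulmxN mulmxA.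
  congr (_ *: _); apply: eq_bigr => a _; apply: eq_bigr => b _; congr (_ *: (_ *m _)).
  rewrite -(mulmxA _ C) slope_derivE iG /T1 mul_col_mx -row_mul JB linear0 /T.
  rewrite tr_col_mx !mulmxA mul_row_block !mulmx0 addr0 add0r.
  by rewrite -!mulmxA mul_row_col mulmx0 add0r -[RHS]mulmxA.
apply: (can_inj (mulKmx uC)); rewrite -/C.
have CZ2' a b : C *m Z2 a b = T2 a b *m B - T1 a *m P^T *m Z1 b - T1 b *m P^T *m Z1 a.
  rewrite mulmxBr -CZ2 !mulmxA.
  by apply/matrixP => i j; rewrite !mxE; ring.
rewrite mulmxBr [in RHS]linearZ/=.
have -> : C *m (\sum_a \sum_b gi a b *: Z2 a b) =
    (\sum_a \sum_b gi a b *: T2 a b) *m B - 2 *: \sum_a \sum_b gi a b *: (T1 a *m P^T *m Z1 b).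
  have -> : 2 *: \sum_a \sum_b gi a b *: (T1 a *m P^T *m Z1 b) =
      \sum_a \sum_b gi a b *: (T1 a *m P^T *m Z1 b) + \sum_a \sum_b gi a b *: (T1 b *m P^T *m Z1 a).
    rewrite scaler_nat mulr2n; congr (_ + _); rewrite exchange_big/=.
    by apply: eq_bigr => a _; apply: eq_bigr => b _; rewrite -{1}inverse_metric_sym mxE.
  rewrite -!big_split/= mulmx_sumr mulmx_suml -sumrB; apply: eq_bigr => a _.
  rewrite -big_split/= mulmx_sumr mulmx_suml -sumrB; apply: eq_bigr => b _.
  by rewrite -scalemxAr -scalemxAl CZ2' -scalerDr -scalerBr opprD addrA.
have -> : C *m (\sum_e ga 0 e *: Z1 e) = (\sum_e ga 0 e *: T1 e) *m B.
  rewrite mulmx_sumr mulmx_suml; apply: eq_bigr => e _.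
  by rewrite -scalemxAr slope_derivE -scalemxAl.
rewrite addrAC -mulmxBl LT -scalerBr; congr (_ *: _).
rewrite mulmx_sumr -sumrB; apply: eq_bigr => a _; rewrite mulmx_sumr -sumrB.
apply: eq_bigr => b _; rewrite -scalerBr -scalemxAr; congr (_ *: _).
rewrite -[T1 a *m P^T *m _]mulmxA -mulmxBr -mulmxBl pr.
by rewrite !mulmxA slope_derivE.
Qed.

End harmonic_slope.

(** * Laplacian of the determinant of a harmonic slope *)

Section laplacian_det.
Variables (R : fieldType) (k n m : nat).
Variables (Z : 'M[R]_(n, m)) (Z1 : 'I_k -> 'M[R]_(n, m)) (Z2 : 'I_k -> 'I_k -> 'M[R]_(n, m)).
Variables (gi : 'M[R]_k) (ga : 'rV[R]_k) (K1 : 'I_k -> 'M[R]_n) (D : R) (D1 : 'I_k -> R).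
Let S := 1%:M + Z *m Z^T.
Let K := invmx S.
Let K' := invmx (1%:M + Z^T *m Z).
Let S1 a := Z1 a *m Z^T + Z *m (Z1 a)^T.
Let S2 a b := (Z2 a b *m Z^T + Z1 a *m (Z1 b)^T) + (Z1 b *m (Z1 a)^T + Z *m (Z2 a b)^T).
Hypotheses (uS : S \in unitmx) (uS' : 1%:M + Z^T *m Z \in unitmx).
Hypothesis K1E : forall b, K1 b *m S + K *m S1 b = 0.
Hypothesis D1E : forall a, D1 a = D * \tr (K *m S1 a).
Hypothesis LZ : \sum_a \sum_b gi a b *: Z2 a b - \sum_e ga 0 e *: Z1 e =
  2 *: \sum_a \sum_b gi a b *: (Z1 a *m K' *m Z^T *m Z1 b).

(** The Hessian of [D], divided by [2 * D], for the invariant metric of the Grassmannian in graph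
    coordinates. The first term is that metric; the last comes from the gradient of [D]. *)
Definition slope_form (X Y : 'M[R]_(n, m)) : R :=
  \tr (invmx (1%:M + Z *m Z^T) *m X *m invmx (1%:M + Z^T *m Z) *m Y^T)
  + \tr (X *m (invmx (1%:M + Z^T *m Z) *m Z^T) *m Y *m (invmx (1%:M + Z^T *m Z) *m Z^T))
  + 2 * (\tr (X *m (invmx (1%:M + Z^T *m Z) *m Z^T)) * \tr (Y *m (invmx (1%:M + Z^T *m Z) *m Z^T))).

Lemma gram_slope_sym : K^T = K.
Proof. by rewrite /K trmx_inv /S linearD/= trmx1 trmx_mul trmxK. Qed.

Lemma inv_slope_complement : K' = 1%:M - Z^T *m K *m Z.
Proof.
rewrite /K (inv_comm_slope uS uS') -/K' -[X in X - _](mulVmx uS') -/K'.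
by rewrite mulmxDr mulmx1 mulmxA addrK.
Qed.

(** The left side is the Laplacian of [D] expanded by Jacobi's formula. With [q] the metric term and
    [s] the mixed trace, [K1] and [S2] contribute [2 * q - 2 * s]; the harmonic equation for [Z2]
    adds [4 * s] and so reverses the sign. *)
Lemma laplacian_det :
  \sum_a \sum_b gi a b * (D1 b * \tr (K *m S1 a) + D * \tr (K1 b *m S1 a + K *m S2 a b))
  - \sum_e ga 0 e * D1 e = 2 * D * \sum_a \sum_b gi a b * slope_form (Z1 a) (Z1 b).
Proof.
set Y := Z^T *m K.
have YE : K' *m Z^T = Y by rewrite /Y /K (inv_comm_slope uS uS').
have trT (p : nat) (A : 'M[R]_p) : \tr A^T = \tr A by exact: mxtrace_tr.
have trZ2 (X : 'M[R]_(n, m)) : \tr (K *m (X *m Z^T)) = \tr (X *m Y).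
  by rewrite mxtrace_mulC -mulmxA.
have trZ2' (X : 'M[R]_(n, m)) : \tr (K *m (Z *m X^T)) = \tr (X *m Y).
  by rewrite -trT !trmx_mul trmxK gram_slope_sym -mulmxA.
have trS1 a : \tr (K *m S1 a) = 2 * \tr (Z1 a *m Y).
  by rewrite mulmxDr linearD/= trZ2 trZ2'; ring.
have K1' b : K1 b = - (K *m S1 b *m K).
  apply/eqP; rewrite -addr_eq0; apply/eqP.
  have := congr1 (mulmxr K) (K1E b); rewrite /= mul0mx mulmxDl => <-.
  by rewrite mulmxK.
pose q a b := \tr (K *m Z1 a *m K' *m (Z1 b)^T).
have qsym a b : q b a = q a b.
  have K's : K'^T = K' by rewrite /K' trmx_inv linearD/= trmx1 trmx_mul trmxK.
  by rewrite /q -[LHS]trT !trmx_mul !trmxK gram_slope_sym K's !mulmxA mxtrace_mulC !mulmxA.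
pose s a b := \tr (Z1 a *m Y *m (Z1 b) *m Y).
have ZKZ : Z^T *m K *m Z = 1%:M - K' by rewrite inv_slope_complement opprB addrC subrK.
have trKSKS a b : \tr (K *m S1 b *m K *m S1 a) = 2 * s a b - 2 * q a b +
    (\tr (K *m (Z1 a *m (Z1 b)^T)) + \tr (K *m (Z1 b *m (Z1 a)^T))).
  have t1 : \tr (K *m (Z1 b *m Z^T) *m K *m (Z1 a *m Z^T)) = s a b.
    by rewrite !mulmxA mxtrace_mulC !mulmxA mxtrace_mulC /s /Y !mulmxA.
  have t2 : \tr (K *m (Z1 b *m Z^T) *m K *m (Z *m (Z1 a)^T)) =
      \tr (K *m (Z1 b *m (Z1 a)^T)) - q a b.
    have -> : K *m (Z1 b *m Z^T) *m K *m (Z *m (Z1 a)^T) =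
      K *m Z1 b *m (Z^T *m K *m Z) *m (Z1 a)^T by rewrite !mulmxA.
    by rewrite ZKZ mulmxBr mulmx1 mulmxBl linearB/= -qsym mulmxA.
  have t3 : \tr (K *m (Z *m (Z1 b)^T) *m K *m (Z1 a *m Z^T)) =
      \tr (K *m (Z1 a *m (Z1 b)^T)) - q a b.
    rewrite mulmxA mxtrace_mulC.
    have -> : Z^T *m (K *m (Z *m (Z1 b)^T) *m K *m Z1 a) =
      (Z^T *m K *m Z) *m (Z1 b)^T *m (K *m Z1 a) by rewrite !mulmxA.
    rewrite mxtrace_mulC ZKZ mulmxBl mul1mx mulmxBr linearB/= /q.
    by rewrite !mulmxA.
  have t4 : \tr (K *m (Z *m (Z1 b)^T) *m K *m (Z *m (Z1 a)^T)) = s a b.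
    by rewrite -trT !trmx_mul !trmxK gram_slope_sym /s /Y !mulmxA.
  rewrite {1}/S1 (mulmxDr K) mulmxDl mulmxDl /S1 mulmxDr mulmxDr !linearD/= t1 t2 t3 t4.
  ring.
have point a b : D1 b * \tr (K *m S1 a) + D * \tr (K1 b *m S1 a + K *m S2 a b) =
    D * (4 * (\tr (Z1 a *m Y) * \tr (Z1 b *m Y)) + 2 * q a b - 2 * s a b + 2 * \tr (Z2 a b *m Y)).
  rewrite D1E !trS1 linearD/= K1' mulNmx linearN/= trKSKS.
  rewrite /S2 !mulmxDr !linearD/= trZ2 trZ2'; ring.
have LZt : \sum_a \sum_b gi a b * \tr (Z2 a b *m Y) - \sum_e ga 0 e * \tr (Z1 e *m Y) =
    2 * \sum_a \sum_b gi a b * s a b.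
  have := congr1 (fun X => \tr (X *m Y)) LZ; rewrite mulmxBl linearB/= -scalemxAl linearZ/=.
  rewrite !mulmx_suml !linear_sum/=.
  have -> : \sum_e \tr (ga 0 e *: Z1 e *m Y) = \sum_e ga 0 e * \tr (Z1 e *m Y).
    by apply: eq_bigr => e _; rewrite -scalemxAl linearZ.
  have -> : \sum_a \tr ((\sum_b gi a b *: Z2 a b) *m Y) = \sum_a \sum_b gi a b * \tr (Z2 a b *m Y).
    apply: eq_bigr => a _; rewrite mulmx_suml linear_sum; apply: eq_bigr => b _.
    by rewrite -scalemxAl linearZ.
  move=> ->; congr (_ * _); apply: eq_bigr => a _; rewrite mulmx_suml linear_sum; apply: eq_bigr =>
    b _.
  by rewrite -scalemxAl linearZ/= /s -YE !mulmxA.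
have -> : \sum_a \sum_b gi a b * (D1 b * \tr (K *m S1 a) + D * \tr (K1 b *m S1 a + K *m S2 a b)) =
    D * (\sum_a \sum_b gi a b * (4 * (\tr (Z1 a *m Y) * \tr (Z1 b *m Y)) + 2 * q a b - 2 * s a b)
      + 2 * \sum_a \sum_b gi a b * \tr (Z2 a b *m Y)).
  rewrite mulr_sumr -big_split mulr_sumr; apply: eq_bigr => a _.
  rewrite mulr_sumr -big_split mulr_sumr; apply: eq_bigr => b _.
  by rewrite point/=; ring.
have -> : \sum_e ga 0 e * D1 e = 2 * D * \sum_e ga 0 e * \tr (Z1 e *m Y).
  by rewrite mulr_sumr; apply: eq_bigr => e _; rewrite D1E trS1; ring.
have E : 2 * \sum_a \sum_b gi a b * slope_form (Z1 a) (Z1 b) =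
    \sum_a \sum_b gi a b * (4 * (\tr (Z1 a *m Y) * \tr (Z1 b *m Y)) + 2 * q a b - 2 * s a b) +
    4 * \sum_a \sum_b gi a b * s a b.
  rewrite !mulr_sumr -big_split; apply: eq_bigr => a _.
  rewrite !mulr_sumr -big_split; apply: eq_bigr => b _ /=.
  by rewrite /slope_form -/K' -/K !YE -/(s a b) -/(q a b); ring.
rewrite [RHS]mulrAC E; move/eqP: LZt; rewrite subr_eq => /eqP->; ring.
Qed.

End laplacian_det.

Lemma linear_sumE (R : pzRingType) (V : lmodType R) (I : Type) (s : seq I) (c : I -> R) (h : I -> V)
    (f : V -> R) : (forall a X Y, f (a *: X + Y) = a * f X + f Y) ->
  f (\sum_(i <- s) c i *: h i) = \sum_(i <- s) c i * f (h i).
Proof.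
move=> lf; have f0 : f 0 = 0.
  by apply: (addrI (f 0)); rewrite addr0 -{1}[f 0]mul1r -lf scale1r addr0.
by elim: s => [|i s IH]; [rewrite !big_nil|rewrite !big_cons lf IH].
Qed.

(** * The Laplacian in frames adapted to the singular values *)

Section adapted_frames.
Variables (R : realFieldType) (n m N : nat).
Variables (C : 'M[R]_n) (Z : 'M[R]_(n, m)) (H : 'I_n -> 'M[R]_(n, m)).
Variables (M1 : 'M[R]_(N, n)) (M2 : 'M[R]_(N, m)) (l : 'rV[R]_N).
Let S := 1%:M + Z *m Z^T.
Let K' := invmx (1%:M + Z^T *m Z).
Let Gi := invmx (C *m S *m C^T).
Hypotheses (uC : C \in unitmx) (uS : S \in unitmx) (uS' : 1%:M + Z^T *m Z \in unitmx).
Hypothesis M1E : M1^T *m M1 = Gi.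
Hypothesis M2E : M2^T *m M2 = K'.
Hypothesis ME : M2 *m Z^T = diag_mx l *m M1 *m C.
Hypothesis Hsym : forall a b, row a (H b) = row b (H a).
Let hh a := M1 *m H a *m M2^T.
Let A p := \sum_a M1 p a *: hh a.
(** The second fundamental form of the cone with normal index [a] and tangent indices [i] and [p],
    in possibly redundant frames given by the rows of [M1] and [M2]; [H b] stands for [C] times the
    derivative of the slope along direction [b]. *)
Definition frame_coeff (a i p : 'I_N) := (\sum_a M1 p a *: (M1 *m H a *m M2^T)) i a.

Lemma frame_coeff_sym a i p : frame_coeff a i p = frame_coeff a p i.
Proof.
have E i' p' : frame_coeff a i' p' = \sum_b \sum_c M1 p' b * M1 i' c * (row c (H b) *m M2^T) 0 a.
  rewrite /frame_coeff summxE; apply: eq_bigr => b _.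
  rewrite mxE -mulmxA mxE mulr_sumr; apply: eq_bigr => c _.
  by rewrite mulrA -row_mul [in RHS]mxE.
rewrite !E exchange_big/=; apply: eq_bigr => b _; apply: eq_bigr => c _.
by rewrite Hsym (mulrC (M1 p c)).
Qed.

(** [ME] rewrites [K' *m Z^T] as [M2^T *m diag_mx l *m M1 *m C], and the factors [C] cancel under
    the traces by cyclicity. *)
Lemma slope_form_frame a b :
  slope_form Z (invmx C *m H a) (invmx C *m H b) =
  \tr (hh a *m (hh b)^T) + \tr (hh a *m diag_mx l *m hh b *m diag_mx l)
  + 2 * (\tr (hh a *m diag_mx l) * \tr (hh b *m diag_mx l)).
Proof.
have Y c : invmx C *m H c *m (K' *m Z^T) = invmx C *m (H c *m M2^T *m diag_mx l *m M1) *m C.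
  by rewrite -M2E -(mulmxA _ M2) ME !mulmxA.
have t1 c : \tr (invmx C *m H c *m (K' *m Z^T)) = \tr (hh c *m diag_mx l).
  rewrite Y mxtrace_mulC mulKVmx// mxtrace_mulC /hh !mulmxA.
  by [].
have t2 : \tr (invmx C *m H a *m (K' *m Z^T) *m (invmx C *m H b) *m (K' *m Z^T)) =
    \tr (hh a *m diag_mx l *m hh b *m diag_mx l).
  rewrite -mulmxA !Y -!mulmxA mxtrace_mulC -!mulmxA mulmxV// mulmx1 mulKVmx//.
  rewrite !mulmxA mxtrace_mulC /hh !mulmxA.
  by [].
have KE : invmx S = C^T *m Gi *m C.
  have uCSC : C *m S *m C^T \in unitmx by rewrite !unitmx_mul uC uS unitmx_tr.
  have h : C *m S *m C^T *m Gi = 1%:M by rewrite mulmxV.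
  rewrite -[LHS]mulmx1 -[RHS](mulKmx uS); congr (_ *m _).
  have := congr1 (fun X => invmx C *m X *m C) h.
  by rewrite mulmx1 mulVmx// !mulmxA mulVmx// mul1mx => ->.
have t3 : \tr (invmx S *m (invmx C *m H a) *m K' *m (invmx C *m H b)^T) = \tr (hh a *m (hh b)^T).
  rewrite KE -M1E -M2E trmx_mul trmx_inv -[C^T *m _ *m C *m _]mulmxA mulKVmx//.
  rewrite -!mulmxA mxtrace_mulC -!mulmxA mulVmx ?unitmx_tr// mulmx1 mxtrace_mulC.
  by rewrite /hh !trmx_mul !trmxK !mulmxA.
by rewrite /slope_form -/K' !t1 t2 -/S t3.
Qed.

Lemma gauss_form_frame :
  gauss_form (l 0) frame_coeff =
  \sum_a \sum_b Gi a b * slope_form Z (invmx C *m H a) (invmx C *m H b).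
Proof.
pose q X Y := \tr (X *m Y^T) + \tr (X *m diag_mx l *m Y *m diag_mx l)
  + 2 * (\tr (X *m diag_mx l) * \tr (Y *m diag_mx l)).
have qsum : \sum_p q (A p) (A p) =
    \sum_a \sum_b Gi a b * slope_form Z (invmx C *m H a) (invmx C *m H b).
  have linr X Y Y' c : q X (c *: Y + Y') = c * q X Y + q X Y'.
    rewrite /q linearP/= mulmxDr mulmxDl mulmxDr mulmxDl -!scalemxAr -!scalemxAl.
    by rewrite !mxtraceD !mxtraceZ; ring.
  have linl X X' Y c : q (c *: X + X') Y = c * q X Y + q X' Y.
    rewrite /q !mulmxDl -!scalemxAl.
    by rewrite !mxtraceD !mxtraceZ; ring.
  have qE p : q (A p) (A p) = \sum_a \sum_b M1 p a * M1 p b * q (hh a) (hh b).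
    rewrite {1}/A (@linear_sumE _ _ _ _ _ _ (q^~ (A p))) => [|c X X']; last exact: linl.
    apply: eq_bigr => a _; rewrite /A (@linear_sumE _ _ _ _ _ _ (q (hh a))) => [|c X X'];
      last exact: linr.
    by rewrite mulr_sumr; apply: eq_bigr => b _; rewrite mulrA.
  rewrite (eq_bigr _ (fun p _ => qE p)) exchange_big/=; apply: eq_bigr => a _.
  rewrite exchange_big/=; apply: eq_bigr => b _.
  rewrite slope_form_frame -/(q (hh a) (hh b)) -M1E mxE mulr_suml.
  by apply: eq_bigr => p _; rewrite mxE.
rewrite -qsum /gauss_form.
have -> : \sum_a \sum_i \sum_j (frame_coeff a i j ^+ 2 + l 0 a * l 0 i * frame_coeff a i j *
  frame_coeff i a j) =
    \sum_p (\tr (A p *m (A p)^T) + \tr (A p *m diag_mx l *m A p *m diag_mx l)).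
  rewrite exchange_big/=; under eq_bigr do rewrite exchange_big/=.
  rewrite exchange_big/=; apply: eq_bigr => p _.
  rewrite /mxtrace -big_split/=; apply: eq_bigr => i _.
  rewrite mxE mul_mx_diag mxE -mulmxA mxE mulr_suml -big_split/=; apply: eq_bigr => a _.
  by rewrite mul_diag_mx !mxE /frame_coeff -/(A p); ring.
rewrite mulr_sumr -big_split/=; apply: eq_bigr => p _; rewrite /q; congr (_ + _ * _).
have -> : \tr (A p *m diag_mx l) = \sum_a l 0 a * frame_coeff a a p; last by rewrite expr2.
by apply: eq_bigr => a _; rewrite mul_mx_diag mxE mulrC.
Qed.

Lemma slope_form_sum_ge0 : \prod_i (1 + l 0 i ^+ 2) <= 9 ->
  let Q := \sum_a \sum_b Gi a b * slope_form Z (invmx C *m H a) (invmx C *m H b) in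
  0 <= Q /\ (Q = 0 -> forall e : 'rV[R]_n, (forall b, e *m H b = 0) ->
    (forall b, H b = 0) \/ e *m C *m Z = 0).
Proof.
move=> l9 /=; rewrite -gauss_form_frame.
have [Q0 Qeq] := gauss_form_ge0 frame_coeff_sym l9; split=> // /Qeq{}Qeq e eH.
have uG : C *m S *m C^T \in unitmx by rewrite !unitmx_mul uC uS unitmx_tr.
(* [M1] need not be square; [M1^T *m M1 = Gi] provides this preimage of [e], to which the equality
   case is applied. *)
pose xi := e *m (C *m S *m C^T) *m M1^T.
have xiM : xi *m M1 = e by rewrite /xi -mulmxA M1E mulmxK.
have null a p : \sum_i xi 0 i * frame_coeff a i p = 0.
  have -> : \sum_i xi 0 i * frame_coeff a i p = (xi *m A p) 0 a.
    by rewrite mxE.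
  rewrite /A mulmx_sumr big1 ?mxE// => b _.
  by rewrite -scalemxAr /hh !mulmxA xiM eH mul0mx scaler0.
have [h0|lx] := Qeq _ null; [left|right].
  have A0 p : A p = 0 by apply/matrixP => i a; rewrite [RHS]mxE -(h0 a i p).
  have hh0 b : hh b = 0.
    have GA c : \sum_a Gi c a *: hh a = 0.
      transitivity (\sum_p M1 p c *: A p); last by rewrite big1// => p _; rewrite A0 scaler0.
      rewrite /A; under [RHS]eq_bigr do rewrite scaler_sumr.
      rewrite exchange_big/=; apply: eq_bigr => a _; rewrite -M1E mxE scaler_suml.
      by apply: eq_bigr => p _; rewrite scalerA mxE.
    transitivity (\sum_c (C *m S *m C^T) b c *: \sum_a Gi c a *: hh a); last first.
      by rewrite big1// => c _; rewrite GA scaler0.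
    under eq_bigr do rewrite scaler_sumr; rewrite exchange_big/=.
    have GG : C *m S *m C^T *m Gi = 1%:M by rewrite mulmxV.
    have -> : \sum_j \sum_i (C *m S *m C^T) b i *: (Gi i j *: hh j) = \sum_j (1%:M : 'M[R]_n)
      b j *: hh j.
      apply: eq_bigr => j _; rewrite -GG mxE scaler_suml; apply: eq_bigr => i _.
      by rewrite scalerA.
    rewrite (bigD1 b)//= big1 => [|j jb]; first by rewrite mxE eqxx scale1r addr0.
    by rewrite mxE eq_sym (negbTE jb) scale0r.
  move=> b; have := congr1 (fun X => M1^T *m X *m M2) (hh0 b).
  rewrite /hh mulmx0 mul0mx !mulmxA M1E -mulmxA M2E.
  move=> h; have := congr1 (fun X => (C *m S *m C^T) *m X *m (1%:M + Z^T *m Z)) h.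
  by rewrite mulmx0 mul0mx !mulmxA mulmxV// mul1mx mulmxKV.
have xl : xi *m diag_mx l = 0.
  by apply/rowP => i; rewrite mul_mx_diag mxE [RHS]mxE mulrC lx.
have E1 : M1^T *m diag_mx l = (invmx C)^T *m Z *m M2^T.
  have := congr1 (fun X => (X *m invmx C)^T) ME; rewrite mulmxK// !trmx_mul tr_diag_mx trmxK => <-.
  by rewrite mulmxA.
move: xl; rewrite /xi -mulmxA E1 !mulmxA => h.
have := congr1 (fun X => X *m M2) h; rewrite mul0mx -mulmxA M2E => {}h.
have := h; rewrite -!mulmxA (mulmxA C^T) -trmx_mul mulVmx// trmx1 mul1mx.
rewrite (mulmxA S) {1}/S mulmxDl mul1mx -(mulmxA Z) -[X in X + _]mulmx1 -mulmxDr.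
by rewrite -mulmxA mulmxV// mulmx1.
Qed.

End adapted_frames.

(** * Singular values and adapted frames *)

Section singular_values.
Variable R : realType.

Definition rect_diag (n m : nat) (L : 'M[R]_(n, m)) :=
  forall (i : 'I_n) (j : 'I_m), (i != j :> nat) -> L i j = 0.

Lemma dotp_delta (n : nat) (i : 'I_n) (v : 'rV[R]_n) : dotp (delta_mx 0 i) v = v 0 i.
Proof.
rewrite dotpE (bigD1 i)//= big1 ?addr0 => [|j ji]; rewrite mxE ?eqxx ?mul1r//.
by rewrite (negbTE ji) andbF mul0r.
Qed.

(* A Householder reflection exchanges [u] and the first basis vector. *)
Lemma orthogonal_first_row (n : nat) (u : 'rV[R]_n.+1) : dotp u u = 1 ->
  exists2 O : 'M[R]_n.+1, O *m O^T = 1%:M & row 0 O = u.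
Proof.
move=> u1; set e := delta_mx 0 0 : 'rV[R]_n.+1.
have [ue|ue] := eqVneq u e.
  exists 1%:M; first by rewrite trmx1 mulmx1.
  by rewrite ue /e; apply/rowP => j; rewrite !mxE eqxx eq_sym.
have [w wE] : exists w, w = u - e by exists (u - e).
pose c := (dotp w w)^-1 * 2.
have w0 : dotp w w != 0 by rewrite wE dotp_eq0 subr_eq0.
have ww : dotp w w = 2 - 2 * u 0 0.
  by rewrite wE dotp_sqrB u1 (dotpC u e) !dotp_delta mxE !eqxx /=; ring.
have wwT : w *m w^T = (dotp w w)%:M by apply/matrixP => i j; rewrite !ord1 [RHS]mxE eqxx.
exists (1%:M - c *: (w^T *m w)).
  have -> : (1%:M - c *: (w^T *m w))^T = 1%:M - c *: (w^T *m w).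
    by rewrite [LHS]linearB/= trmx1 linearZ/= trmx_mul trmxK.
  rewrite mulmxBl mul1mx mulmxBr mulmx1.
  rewrite -scalemxAl -scalemxAr !mulmxA -(mulmxA w^T) wwT mul_mx_scalar -scalemxAl scalerA scalerA.
  rewrite (_ : c * (c * dotp w w) = c + c); last by rewrite /c; field.
  by rewrite scalerDl; move: (c *: _) => Y; apply/matrixP => i j; rewrite !mxE; ring.
rewrite [LHS]linearB/= row1 [X in _ - X]linearZ/=.
have -> : row 0 (w^T *m w) = w 0 0 *: w.
  by apply/rowP => j; rewrite !mxE big_ord_recl big_ord0 addr0 !mxE.
have -> : c *: (w 0 0 *: w) = - w.
  rewrite scalerA (_ : c * w 0 0 = -1) ?scaleN1r//.
  have -> : w 0 0 = - (dotp w w / 2) by rewrite ww wE !mxE !eqxx /=; field.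
  by rewrite /c; field.
by rewrite opprK wE addrC -/e subrK.
Qed.

Lemma block_orthogonal (n : nat) (O : 'M[R]_n) : O *m O^T = 1%:M ->
  block_mx (1%:M : 'M[R]_1) 0 0 O *m (block_mx (1%:M : 'M[R]_1) 0 0 O)^T = 1%:M.
Proof.
move=> OO; rewrite tr_block_mx mulmx_block !trmx0 tr_scalar_mx !mulmx0 !mul0mx !addr0 add0r mulmx1
  OO.
by rewrite -scalar_mx_block.
Qed.

Lemma unit_sphere_compact (n : nat) : compact [set u : 'rV[R]_n | dotp u u = 1].
Proof.
apply: (@subclosed_compact _ _ (closed_eball 0 1)); last first.
- by move=> u /= u1; rewrite /closed_eball/= /sqdist subr0 u1.
- exact: closed_eball_compact.
have -> : [set u : 'rV[R]_n | dotp u u = 1] = [set u | sqdist 0 u = 1].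
  by apply/seteqP; split=> u /=; rewrite /sqdist subr0.
by apply: (@closed_comp _ _ (sqdist 0) [set t | t = 1]) => [x _|];
  [exact: sqdist_continuous|exact: closed_eq].
Qed.

(** Induction: a unit vector [u] maximizing the length of [u *m Z] has an image [s *: v], and
    maximality forces vectors orthogonal to [u] to have images orthogonal to [v]. In orthonormal
    bases starting with [u] and [v], a block of size one splits off. *)
Lemma svd (n m : nat) (Z : 'M[R]_(n, m)) : exists (O1 : 'M[R]_n) (O2 : 'M[R]_m),
  [/\ O1 *m O1^T = 1%:M, O2 *m O2^T = 1%:M & rect_diag (O1 *m Z *m O2^T)].
Proof.
elim: n m Z => [|n IH] m Z.
  by exists 1%:M, 1%:M; rewrite !trmx1 !mulmx1; split=> // -[].
case: m Z => [|m] Z.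
  by exists 1%:M, 1%:M; rewrite !trmx1 !mulmx1; split=> // ? -[].
have [->|Z0] := eqVneq Z 0.
  by exists 1%:M, 1%:M; rewrite !trmx1 !mulmx1; split=> // i j _; rewrite mulmx0 mxE.
pose q (u : 'rV[R]_n.+1) := dotp (u *m Z) (u *m Z).
have [u u1 umax] : exists2 u, dotp u u = 1 & forall w, q w <= q u * dotp w w.
  have [u] : exists2 u, u \in [set u : 'rV[R]_n.+1 | dotp u u = 1] &
      forall t, t \in [set u : 'rV[R]_n.+1 | dotp u u = 1] -> q t <= q u.
    apply: compact_EVT_max; last 2 first.
    - exact: unit_sphere_compact.
    - apply: continuous_subspaceT => x.
      apply: (smooth_continuous (U := setT)) => //.
      have sc : smoothmx [set: 'rV[R]_n.+1] (fun u : 'rV[R]_n.+1 => u *m Z).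
        move=> i j; apply: (@smooth_ext _ _ _ (fun u : 'rV[R]_n.+1 => \sum_l u 0 l * Z l j)) => //.
        - exact: openT.
        - by move=> y _; rewrite mxE (ord1 i).
        apply: smooth_sum; first exact: openT.
        move=> l _; apply: smoothM; [exact: openT|apply: smooth_coord; exact: openT|].
        by apply: smooth_cst; exact: openT.
      by apply: smooth_dotp => //; exact: openT.
    by exists (delta_mx 0 0); rewrite /= dotp_delta mxE !eqxx.
  rewrite inE/= => u1 umax; exists u => // w; have [->|w0] := eqVneq w 0.
    by rewrite /q mul0mx /dotp !mul0mx !mxE mulr0.
  have ww : 0 < dotp w w by rewrite dotp_gt0.
  pose s := Num.sqrt (dotp w w); have s0 : 0 < s by rewrite sqrtr_gt0.
  have ss : s ^+ 2 = dotp w w by rewrite sqr_sqrtr ?ltW.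
  have : q (s^-1 *: w) <= q u.
    by apply: umax; rewrite inE/= dotpZl dotpZr -ss; field; rewrite gt_eqF.
  rewrite /q -scalemxAl dotpZl dotpZr -/(q w) -ss mulrA -invfM -expr2.
  by rewrite mulrC ler_pdivrMr// exprn_gt0.
have qu0 : 0 < q u.
  rewrite lt_def dotp_ge0 andbT; apply/eqP => qu; move/eqP: Z0; apply.
  apply/row_matrixP => i; have := umax (delta_mx 0 i).
  rewrite qu mul0r /q -rowE => qi; apply/eqP.
  by rewrite linear0 -dotp_eq0 eq_le dotp_ge0 andbT.
pose s := Num.sqrt (q u); have s0 : 0 < s by rewrite sqrtr_gt0.
have ss : s ^+ 2 = q u by rewrite sqr_sqrtr ?ltW.
pose v := s^-1 *: (u *m Z).
have v1 : dotp v v = 1 by rewrite /v dotpZl dotpZr -/(q u) -ss; field; rewrite gt_eqF.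
have uZ : u *m Z = s *: v by rewrite /v scalerA divff ?scale1r// gt_eqF.
have [A1 AA1 r1] := orthogonal_first_row u1.
have [A2 AA2 r2] := orthogonal_first_row v1.
have orth w : dotp w u = 0 -> dotp (w *m Z) v = 0.
  move=> wu; apply/eqP; apply: contraT => nz.
  pose b := s * dotp (w *m Z) v; pose a := q w - q u * dotp w w.
  have H t : 2 * t * b + t ^+ 2 * a <= 0.
    have E1 : dotp (u *m Z) (w *m Z) = b by rewrite uZ dotpZl dotpC.
    have := umax (u + t *: w).
    rewrite {1}/q mulmxDl -scalemxAl !dotp_sqrD !dotpZr !dotpZl E1 (dotpC u w) wu u1 -/(q u)
      -/(q w) /a.
    by move: (q u) (q w) (dotp w w) => x y z; lra.
  have b0 : b != 0 by apply: mulf_neq0; [exact: lt0r_neq0|exact: nz].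
  have a1 : 0 < 1 + `|a| by have := normr_ge0 a; lra.
  (* This [t] is small enough for the linear term [2 * t * b] to prevail over [t ^+ 2 * a]. *)
  have := H (b / (1 + `|a|)).
  have -> : 2 * (b / (1 + `|a|)) * b + (b / (1 + `|a|)) ^+ 2 * a =
     (b / (1 + `|a|)) ^+ 2 * (2 * (1 + `|a|) + a) by field; exact: lt0r_neq0.
  rewrite pmulr_rle0; last first.
    by rewrite exprn_even_gt0//=; apply: mulf_neq0 => //; rewrite invr_neq0 ?lt0r_neq0.
  by have := lerNnormlW (lexx `|a|); have := normr_ge0 a; lra.
have r2c : v *m A2^T = delta_mx 0 0.
  by rewrite -r2 -row_mul AA2 row1.
have [Y YA] : exists Y : 'M[R]_(1 + n, 1 + m), Y = A1 *m Z *m A2^T by exists (A1 *m Z *m A2^T).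
have Y0 j : Y 0 j = s * (j == 0)%:R.
  have : row 0 Y = s *: delta_mx 0 0.
    by rewrite YA !row_mul r1 uZ -scalemxAl r2c.
  by move=> /rowP/(_ j); rewrite !mxE eqxx.
have Yl i : i != 0 -> Y i 0 = 0.
  move=> i0; have wu : dotp (row i A1) u = 0.
    have := congr1 (fun X : 'M[R]_n.+1 => X i 0) AA1; rewrite !mxE (negbTE i0) mulr0n => E0.
    by rewrite dotpE -[RHS]E0; apply: eq_bigr => l _; rewrite -r1 !mxE.
  rewrite -(orth _ wu) dotpE YA mxE; apply: eq_bigr => l _.
  by rewrite -r2 !mxE; congr (_ * _); apply: eq_bigr => l' _; rewrite mxE.
have YE : Y = block_mx s%:M 0 0 (drsubmx Y).
  rewrite -[LHS]submxK; congr block_mx.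
  - by apply/matrixP => i j; rewrite !ord1 !mxE !lshift0 Y0 eqxx mulr1.
  - apply/matrixP => i j; rewrite (ord1 i) !mxE lshift0 Y0.
    by rewrite (_ : rshift 1 j == 0 = false) ?mulr0//; apply/eqP.
  - apply/matrixP => i j; rewrite (ord1 j) [RHS]mxE !mxE lshift0 Yl//.
have [B1 [B2 [BB1 BB2 dB]]] := IH m (drsubmx Y).
have e1 := block_orthogonal BB1; have e2 := block_orthogonal BB2.
exists (block_mx (1%:M : 'M[R]_1) 0 0 B1 *m A1), (block_mx (1%:M : 'M[R]_1) 0 0 B2 *m A2); split.
- by rewrite trmx_mul mulmxA -(mulmxA _ A1) AA1 mulmx1.
- by rewrite trmx_mul mulmxA -(mulmxA _ A2) AA2 mulmx1.
pose D1 := block_mx (1%:M : 'M[R]_1) 0 0 B1; pose D2 := block_mx (1%:M : 'M[R]_1) 0 0 B2.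
have -> : D1 *m A1 *m Z *m (D2 *m A2)^T = D1 *m Y *m D2^T by rewrite YA trmx_mul !mulmxA.
rewrite /D1 /D2 YE (tr_block_mx (1%:M : 'M[R]_1)).
rewrite !mulmx_block !trmx0 tr_scalar_mx !mulmx0 !mul0mx !addr0 !add0r mul1mx mulmx1.
move=> i j; case: (@split_ordP 1 n i) => i' ->; case: (@split_ordP 1 m j) => j' -> ij.
- by move: ij; rewrite (ord1 i') (ord1 j') eqxx.
- by apply: etrans (block_mxEur _ _ _ _ _ _) _; rewrite mul0mx mxE.
- by apply: etrans (block_mxEdl _ _ _ _ _ _) _; rewrite mul0mx mxE.
- by apply: etrans (block_mxEdr _ _ _ _ _ _) _; apply: dB; move: ij; rewrite /= eqn_add2l.
Qed.

End singular_values.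

Section frames_from_svd.
Variable R : realType.

Lemma unitmx_one_plus_gram (n m : nat) (Z : 'M[R]_(n, m)) : 1%:M + Z *m Z^T \in unitmx.
Proof.
rewrite -row_free_unit -kermx_eq0; apply/rowV0P => v /sub_kermxP.
rewrite mulmxDr mulmx1 mulmxA => vS; apply/eqP; rewrite -dotp_eq0 eq_le dotp_ge0 andbT.
have : dotp v v + dotp (v *m Z) (v *m Z) = 0.
  have E : v *m v^T + v *m Z *m (v *m Z)^T = 0 by rewrite trmx_mul mulmxA -mulmxDl vS mul0mx.
  by have := congr1 (fun X : 'M[R]_1 => X 0 0) E; rewrite mxE [RHS]mxE.
by have := dotp_ge0 (v *m Z); lra.
Qed.

Lemma rect_diag_gram (n m : nat) (L : 'M[R]_(n, m)) i j : rect_diag L -> i != j ->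
  (L *m L^T) i j = 0.
Proof.
move=> dL ij; rewrite mxE big1// => a _; rewrite mxE.
have [ia|ia] := eqVneq (i : nat) a; last by rewrite (dL i a ia) mul0r.
by rewrite (dL j a) ?mulr0// -ia eq_sym.
Qed.

Lemma rect_diag_gram_diag (n m : nat) (L : 'M[R]_(n, m)) i a : rect_diag L -> L i a != 0 ->
  (L *m L^T) i i = L i a ^+ 2.
Proof.
move=> dL Lia; have ia : i = a :> nat by apply/eqP; apply: contraNT Lia => /dL->.
rewrite mxE (bigD1 a)//= big1 ?addr0 ?mxE ?expr2// => b ba.
by rewrite (dL i b) ?mul0r// ia eq_sym.
Qed.

Lemma gram_diag_ge0 (n m : nat) (L : 'M[R]_(n, m)) i : 0 <= (L *m L^T) i i.
Proof. by rewrite mxE; apply: sumr_ge0 => a _; rewrite mxE -expr2 sqr_ge0. Qed.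

Definition inv_sqrt_gram (n m : nat) (L : 'M[R]_(n, m)) : 'rV[R]_n :=
  \row_i (Num.sqrt (1 + (L *m L^T) i i))^-1.

Lemma inv_sqrt_gramE (n m : nat) (L : 'M[R]_(n, m)) : rect_diag L ->
  diag_mx (inv_sqrt_gram L) *m diag_mx (inv_sqrt_gram L) *m (1%:M + L *m L^T) = 1%:M.
Proof.
move=> dL; rewrite -mulmxA; apply/matrixP => i j; rewrite !mul_diag_mx mxE.
have gi := gram_diag_ge0 L i.
have [<-|ij] := eqVneq i j.
  rewrite !mxE eqxx; set g := \sum_(_ < _) _; have -> : g = (L *m L^T) i i by rewrite mxE.
  have := sqr_sqrtr (addr_ge0 ler01 gi); set s := Num.sqrt _ => ss.
  have s0 : s != 0 by apply/eqP => s0; move: ss; rewrite s0 expr0n /=; lra.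
  by rewrite mulr1n -ss; field.
by rewrite !mxE (negbTE ij) add0r; have := rect_diag_gram dL ij; rewrite mxE => ->; rewrite !mulr0.
Qed.

(* Both frames are padded by zeros to the common size n + m, which lets tangent
   and normal indices be identified in [gauss_form]. *)
Lemma adapted_frames_exist (n m : nat) (C : 'M[R]_n) (Z : 'M[R]_(n, m)) : C \in unitmx ->
  exists (M1 : 'M[R]_(n + m, n)) (M2 : 'M[R]_(n + m, m)) (l : 'rV[R]_(n + m)),
  [/\ M1^T *m M1 = invmx (C *m (1%:M + Z *m Z^T) *m C^T),
      M2^T *m M2 = invmx (1%:M + Z^T *m Z),
      M2 *m Z^T = diag_mx l *m M1 *m C &
      \prod_i (1 + l 0 i ^+ 2) = \det (1%:M + Z *m Z^T)].
Proof.
move=> uC; have [A1 [A2 [AA1 AA2 dL]]] := svd Z.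
have [L LE] : exists L, L = A1 *m Z *m A2^T by exists (A1 *m Z *m A2^T).
rewrite -LE in dL.
have AA1' : A1^T *m A1 = 1%:M by apply: mulmx1C.
have AA2' : A2^T *m A2 = 1%:M by apply: mulmx1C.
have dLt : rect_diag L^T by move=> i j ij; rewrite mxE dL// eq_sym.
have uS := unitmx_one_plus_gram Z.
have uS' : 1%:M + Z^T *m Z \in unitmx by have := unitmx_one_plus_gram Z^T; rewrite trmxK.
have ZE : Z = A1^T *m L *m A2 by rewrite LE !mulmxA AA1' mul1mx -mulmxA AA2' mulmx1.
pose r1 := diag_mx (inv_sqrt_gram L); pose r2 := diag_mx (inv_sqrt_gram L^T).
have r1E : r1 *m r1 *m (1%:M + L *m L^T) = 1%:M := inv_sqrt_gramE dL.
have r2E : r2 *m r2 *m (1%:M + L^T *m L) = 1%:M.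
  by have := inv_sqrt_gramE dLt; rewrite trmxK.
have A1Z : A1 *m Z = L *m A2 by rewrite {1}ZE !mulmxA AA1 mul1mx.
have A2Z : A2 *m Z^T = L^T *m A1 by rewrite {1}ZE !trmx_mul trmxK !mulmxA AA2 mul1mx.
have S1 : A1 *m (1%:M + Z *m Z^T) = (1%:M + L *m L^T) *m A1.
  by rewrite mulmxDr mulmxDl mulmx1 mul1mx mulmxA A1Z -mulmxA A2Z mulmxA.
have S2 : A2 *m (1%:M + Z^T *m Z) = (1%:M + L^T *m L) *m A2.
  by rewrite mulmxDr mulmxDl mulmx1 mul1mx mulmxA A2Z -mulmxA A1Z mulmxA.
have K1 : invmx (1%:M + Z *m Z^T) = A1^T *m r1 *m r1 *m A1.
  rewrite -[RHS](mulmxK uS) -(mulmxA _ A1) S1 !mulmxA -(mulmxA _ r1 r1) -(mulmxA A1^T).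
  by rewrite r1E mulmx1 AA1' mul1mx.
have K2 : invmx (1%:M + Z^T *m Z) = A2^T *m r2 *m r2 *m A2.
  rewrite -[RHS](mulmxK uS') -(mulmxA _ A2) S2 !mulmxA -(mulmxA _ r2 r2) -(mulmxA A2^T).
  by rewrite r2E mulmx1 AA2' mul1mx.
have rL : r2 *m L^T = L^T *m r1.
  apply/matrixP => a i; rewrite mul_diag_mx mul_mx_diag mxE [RHS]mxE mulrC.
  have [->|Lia] := eqVneq (L^T a i) 0; first by rewrite !mul0r.
  congr (_ * _); rewrite !mxE; congr (Num.sqrt (1 + _))^-1.
  have L2 : L i a != 0 by move: Lia; rewrite mxE.
  have := rect_diag_gram_diag dL L2; have := rect_diag_gram_diag dLt Lia; rewrite !mxE.
  by move=> -> ->.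
pose U : 'M[R]_(n, n + m) := row_mx 1%:M 0.
have UU : U *m U^T = 1%:M by rewrite tr_row_mx mul_row_col trmx1 mulmx1 mul0mx addr0.
(* [V] places the normal index [j] at position [j], not after the [n] tangent ones, so that matching
   singular directions share an index and [U^T *m L *m V] is diagonal. *)
pose V : 'M[R]_(m, n + m) := \matrix_(i, j) (i == j :> nat)%:R.
have VV : V *m V^T = 1%:M.
  apply/matrixP => i j; have lt : (i < n + m)%N by apply: leq_trans (leq_addl _ _).
  rewrite mxE (bigD1 (Ordinal lt))//= big1 => [|x xi].
    by rewrite !mxE/= eqxx mul1r addr0 eq_sym.
  by rewrite !mxE eq_sym (_ : (_ == _) = false) ?mul0r//; apply: contraNF xi => /eqP/= xi;
    apply/eqP/val_inj.
have [l lE] : exists l : 'rV[R]_(n + m), l = \row_x (U^T *m L *m V) x x.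
  by exists (\row_x (U^T *m L *m V) x x).
have dl : diag_mx l = U^T *m L *m V.
  apply/matrixP => x y; rewrite mxE; have [<-|xy] := eqVneq x y; first by rewrite mulr1n lE mxE.
  rewrite mulr0n mxE big1// => j _; rewrite mxE mulr_suml big1// => i _.
  have [ix|ix] := eqVneq (i : nat) x; last first.
    rewrite (_ : U^T x i = 0) ?mul0r// !mxE; case: splitP => x' xE; rewrite ?mxE//.
    by rewrite (_ : (i == x') = false)//; apply: contraNF ix => /eqP->; rewrite xE.
  have [jy|jy] := eqVneq (j : nat) y; last by rewrite [V j y]mxE (negbTE jy) mulr0.
  by rewrite dL ?mulr0 ?mul0r// ix jy.
have dlt : diag_mx l = V^T *m L^T *m U.
  by rewrite -tr_diag_mx dl !trmx_mul trmxK mulmxA.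
exists (U^T *m r1 *m A1 *m invmx C), (V^T *m r2 *m A2), l; split.
- rewrite !trmx_mul !trmxK tr_diag_mx !mulmxA -(mulmxA _ U) UU mulmx1.
  have -> : invmx (C *m (1%:M + Z *m Z^T) *m C^T) = (invmx C)^T *m invmx (1%:M + Z *m Z^T)
    *m invmx C.
    have u : C *m (1%:M + Z *m Z^T) *m C^T \in unitmx by rewrite !unitmx_mul uC uS unitmx_tr.
    rewrite -[RHS](mulmxK u) trmx_inv !mulmxA mulmxKV// -(mulmxA _ (invmx _) (1%:M + _))
      mulVmx// mulmx1.
    by rewrite mulVmx ?unitmx_tr// mul1mx.
  by rewrite K1 !mulmxA.
- rewrite !trmx_mul !trmxK tr_diag_mx !mulmxA -(mulmxA _ V) VV mulmx1.
  by rewrite K2.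
- rewrite dlt !mulmxA mulmxKV// -(mulmxA _ U) UU mulmx1 -(mulmxA _ L^T) -rL.
  by rewrite -[LHS]mulmxA A2Z !mulmxA.
have -> : \det (1%:M + Z *m Z^T) = \det (1%:M + L *m L^T).
  have d1 : \det A1 * \det A1 = 1 by rewrite -{2}det_tr -det_mulmx AA1 det1.
  have := congr1 determinant S1; rewrite !det_mulmx mulrC => /(congr1 (fun t => t * \det A1)).
  by rewrite -!mulrA d1 !mulr1.
have -> : 1%:M + L *m L^T = diag_mx (\row_i (1 + (L *m L^T) i i)).
  apply/matrixP => i j; rewrite [LHS]mxE [in LHS]mxE !mxE.
  have [->|ij] := eqVneq i j; first by rewrite !mulr1n.
  by rewrite add0r mulr0n; have := rect_diag_gram dL ij; rewrite mxE.
rewrite det_diag big_split_ord/=.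
have ll : diag_mx l *m diag_mx l = block_mx (L *m L^T) 0 0 0.
  rewrite {1}dl dlt !mulmxA -(mulmxA _ V) VV mulmx1 /U tr_row_mx trmx1 trmx0.
  by rewrite -(mulmxA _ L L^T) mul_col_mx mul1mx mul0mx mul_col_row mulmx1 !mulmx0 mul0mx.
have le x : l 0 x ^+ 2 = (block_mx (L *m L^T) 0 0 (0 : 'M[R]_m)) x x.
  by rewrite -ll mul_diag_mx mxE [diag_mx l x x]mxE eqxx mulr1n expr2.
rewrite [X in _ * X]big1 ?mulr1 => [|i _]; last by rewrite le block_mxEdr mxE addr0.
by apply: eq_bigr => i _; rewrite le block_mxEul mxE.
Qed.

End frames_from_svd.

(** * The slope of a minimal submanifold in a chart *)

Lemma smooth_on_smoothmx (R : realType) (k d : nat) (U : set 'rV[R]_k) (f : 'rV[R]_k -> 'rV[R]_d) :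
  open U -> smooth_on U f -> smoothmx U f.
Proof.
move=> oU sf i j r; rewrite (ord1 i) {i}; elim: r f {sf}(sf r) => //= r IH f [df ddf].
split=> [x Ux|v].
  by apply: (@differentiable_comp _ _ _ _ f (fun u : 'rV[R]_d => u 0 j));
    [exact: df|exact: differentiable_coord].
apply: diffn_ext (IH _ (ddf v)) => // x Ux.
by rewrite (derive_mx (diff_derivable (df x Ux))) mxE.
Qed.

(** In a singular value decomposition of [E], the rows of [A2] after the first [m] are orthogonal to
    the rows of [E]. *)
Lemma orthonormal_complement (R : realType) (n m : nat) (E : 'M[R]_(m, n + m)) :
  E *m E^T = 1%:M -> exists P : 'M[R]_(n, n + m),
  [/\ P *m P^T = 1%:M, E *m P^T = 0 & P^T *m P + E^T *m E = 1%:M].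
Proof.
move=> EE; have [A1 [A2 [AA1 AA2 dL]]] := svd E.
pose s (i : 'I_n) := cast_ord (addnC m n) (rshift m i).
have sinj : injective s by move=> i j /cast_ord_inj/rshift_inj.
pose P := \matrix_i row (s i) A2.
have PP : P *m P^T = 1%:M.
  apply/matrixP => i j; have := congr1 (fun X : 'M[R]_(n + m) => X (s i) (s j)) AA2.
  rewrite /= !mxE (inj_eq sinj) => <-; apply: eq_bigr => l _; by rewrite !mxE.
have EP : E *m P^T = 0.
  have h : A1 *m E *m P^T = 0.
    apply/matrixP => i j; rewrite [RHS]mxE -[RHS](dL i (s j)); last first.
      by rewrite /= neq_ltn (leq_trans (ltn_ord i) (leq_addr _ _)).
    by rewrite mxE [RHS]mxE; apply: eq_bigr => l _; rewrite !mxE.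
  by rewrite -[E]mul1mx -(mulmx1C AA1) -!mulmxA (mulmxA A1) h mulmx0.
exists P; split=> //.
have : col_mx P E *m (col_mx P E)^T = 1%:M.
  rewrite tr_col_mx mul_col_row PP EP EE -[P *m E^T]trmxK trmx_mul trmxK EP trmx0.
  by rewrite -scalar_mx_block.
by move=> /mulmx1C; rewrite tr_col_mx mul_row_col.
Qed.

Section chart.
Variables (R : realType) (k m d : nat).
Variables (U : set 'rV[R]_k) (f : 'rV[R]_k -> 'rV[R]_d).
Variables (P : 'M[R]_(1 + k, d)) (E : 'M[R]_(m, d)).
Hypothesis oU : open U.
Hypothesis sf : smoothmx U f.

Definition basis_vec (a : 'I_k) : 'rV[R]_k := delta_mx 0 a.
Local Notation e := basis_vec.

(** This is the Jacobian, by [jacobian_tangent_frame], written with directional derivatives so that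
    it can be differentiated again. *)
Definition tangent_frame x : 'M[R]_(k, d) := \matrix_a 'D_(e a) f x.
Local Notation J := tangent_frame.
Definition cone_frame x : 'M[R]_(1 + k, d) := col_mx (f x) (J x).
Local Notation T := cone_frame.
Definition slope x : 'M[R]_(1 + k, m) := invmx (T x *m P^T) *m (T x *m E^T).
Local Notation Z := slope.
Definition slope_gram x : 'M[R]_(1 + k) := 1%:M + Z x *m (Z x)^T.
Local Notation S := slope_gram.
Definition slope_det x : R := \det (S x).
Definition inv_metric x : 'M[R]_k := invmx (J x *m (J x)^T).
Local Notation gi := inv_metric.
(** The inverse metric contracted with the second derivatives of [f]; it differs from the mean
    curvature vector by a combination of the rows of the cone frame. *)
Definition frame_laplacian x : 'rV[R]_d := \sum_a row a (gi x) *m 'D_(e a) J x.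
Local Notation mu := frame_laplacian.

Hypothesis ff : forall x, U x -> dotp (f x) (f x) = 1.
Hypothesis uJ : forall x, U x -> J x *m (J x)^T \in unitmx.
Hypothesis uC : forall x, U x -> T x *m P^T \in unitmx.

Lemma smoothmx_frame : smoothmx U J.
Proof.
move=> a j; apply: smooth_ext (smoothmx_derive (e a) oU sf 0 j) => // x _.
by rewrite mxE.
Qed.

Lemma smoothmx_cone_frame : smoothmx U T.
Proof. exact: smoothmx_col_mx oU sf smoothmx_frame. Qed.

Lemma smoothmx_frame_coord : smoothmx U (fun x => T x *m P^T).
Proof. exact: smoothmx_mul oU smoothmx_cone_frame (smoothmx_cst _ oU). Qed.

Lemma smoothmx_slope : smoothmx U Z.
Proof.
apply: smoothmx_mul => //; first exact: smoothmx_invmx oU smoothmx_frame_coord uC.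
exact: smoothmx_mul oU smoothmx_cone_frame (smoothmx_cst _ oU).
Qed.

Lemma smoothmx_slope_gram : smoothmx U S.
Proof.
apply: smoothmxD => //; first exact: smoothmx_cst.
exact: smoothmx_mul oU smoothmx_slope (smoothmx_tr oU smoothmx_slope).
Qed.

Lemma smooth_slope_det : smooth U slope_det.
Proof. exact: smooth_det oU smoothmx_slope_gram. Qed.

Lemma smoothmx_metric : smoothmx U (fun x => J x *m (J x)^T).
Proof. exact: smoothmx_mul oU smoothmx_frame (smoothmx_tr oU smoothmx_frame). Qed.

Lemma smoothmx_inv_metric : smoothmx U gi.
Proof. exact: smoothmx_invmx oU smoothmx_metric uJ. Qed.

Lemma smoothmx_sum (I : Type) (s : seq I) p q (G : I -> 'rV[R]_k -> 'M[R]_(p, q)) :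
  (forall i, smoothmx U (G i)) -> smoothmx U (fun x => \sum_(i <- s) G i x).
Proof.
move=> sG i j; apply: (@smooth_ext _ _ _ (fun x => \sum_(l <- s) G l x i j)) => //.
  by move=> x _; rewrite summxE.
by apply: smooth_sum => // l _; exact: sG.
Qed.

Lemma smoothmx_frame_laplacian : smoothmx U mu.
Proof.
apply: smoothmx_sum => a; apply: smoothmx_mul oU (smoothmx_row _ oU smoothmx_inv_metric) _.
exact: smoothmx_derive oU smoothmx_frame.
Qed.

Lemma derive_f x a : 'D_(e a) f x = row a (J x).
Proof. by rewrite rowK. Qed.

Lemma derive_eq_on p q (G G' : 'rV[R]_k -> 'M[R]_(p, q)) x v : U x ->
  (forall y, U y -> G y = G' y) -> 'D_v G x = 'D_v G' x.
Proof. by move=> Ux h; apply: near_eq_derive; exact: open_near oU Ux h. Qed.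

Lemma f_unit x : U x -> f x *m (f x)^T = 1%:M.
Proof. by move=> Ux; apply/matrixP => i j; rewrite !ord1 [RHS]mxE eqxx -(ff Ux). Qed.

Lemma f_perp_frame x : U x -> f x *m (J x)^T = 0.
Proof.
move=> Ux; have sft := smoothmx_tr oU sf.
apply/rowP => a; rewrite [RHS]mxE.
have E1 : (f x *m (J x)^T) 0 a = dotp (f x) (row a (J x)).
  by rewrite /dotp !mxE; apply: eq_bigr => l _; rewrite !mxE.
have := derive_eq_on (e a) Ux f_unit.
rewrite (derive_mulmx _ oU sf sft Ux) (derive_tr _ oU sf Ux) derive_mx_cst derive_f.
move=> h; have := congr1 (fun X : 'M[R]_1 => X 0 0) h; rewrite mxE [RHS]mxE.
rewrite -/(dotp _ _) -/(dotp _ _) dotpC E1; lra.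
Qed.

Definition normal_frame x : 'M[R]_(d, m) := slope_normal P E (Z x).
Local Notation B := normal_frame.

Lemma slope_eq x : U x -> T x *m P^T *m Z x = T x *m E^T.
Proof. by move=> Ux; rewrite /Z mulKVmx ?uC. Qed.

Local Notation J1 c x := ('D_(e c) J x).
Local Notation J2 a b x := ('D_(e b) ('D_(e a) J) x).
Local Notation Z1 c x := ('D_(e c) Z x).
Local Notation Z2 a b x := ('D_(e b) ('D_(e a) Z) x).

Let sJ := smoothmx_frame.
Let sT := smoothmx_cone_frame.
Let sC := smoothmx_frame_coord.
Let sZ := smoothmx_slope.
Let sS := smoothmx_slope_gram.
Let sgi := smoothmx_inv_metric.
Let smu := smoothmx_frame_laplacian.

Lemma derive_cone_frame x a : U x -> 'D_(e a) T x = col_mx (row a (J x)) (J1 a x).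
Proof. by move=> Ux; rewrite (derive_col_mx _ oU sf sJ Ux) derive_f. Qed.

Lemma schwarz_mx p q (G : 'rV[R]_k -> 'M[R]_(p, q)) x v w : smoothmx U G -> U x ->
  'D_v ('D_w G) x = 'D_w ('D_v G) x.
Proof.
move=> sG Ux; apply/matrixP => i j.
have ent v' w' : ('D_v' ('D_w' G) x) i j = 'D_v' ('D_w' (fun y => G y i j)) x.
  rewrite (derive_entry _ _ _ (smoothmx_derive w' oU sG) Ux).
  apply: near_eq_derive; apply: open_near oU Ux _ => y Uy.
  by rewrite (derive_entry _ _ _ sG Uy).
exact: (etrans (ent v w) (etrans (schwarz v w oU (sG i j) Ux) (esym (ent w v)))).
Qed.

Lemma frame_rowE x a b : U x -> row b (J1 a x) = 'D_(e a) ('D_(e b) f) x.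
Proof.
move=> Ux; rewrite -(derive_row _ _ oU sJ Ux).
by apply: derive_eq_on => // y Uy; rewrite derive_f.
Qed.

Lemma frame1_sym x a b : U x -> row a (J1 b x) = row b (J1 a x).
Proof.
move=> Ux; rewrite (frame_rowE b a Ux) (frame_rowE a b Ux).
exact: schwarz_mx sf Ux.
Qed.

Lemma frame2_comm x a b : U x -> J2 a b x = J2 b a x.
Proof. by move=> Ux; exact: schwarz_mx sJ Ux. Qed.

Lemma frame2_sym x a b c : U x -> row c (J2 a b x) = row b (J2 c a x).
Proof.
move=> Ux; have sJ1 v := smoothmx_derive v oU sJ.
have swap a' b' c' : row c' (J2 a' b' x) = row a' (J2 c' b' x).
  rewrite -(derive_row (e b') c' oU (sJ1 (e a')) Ux) -(derive_row (e b') a' oU (sJ1 (e c')) Ux).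
  by apply: derive_eq_on Ux _ => y Uy; exact: frame1_sym Uy.
exact: (etrans (swap a b c) (etrans (congr1 (row a) (frame2_comm c b Ux))
  (etrans (swap b c a) (congr1 (row b) (frame2_comm a c Ux))))).
Qed.

Lemma slope_derive1 x a : U x ->
  'D_(e a) T x *m P^T *m Z x + T x *m P^T *m Z1 a x = 'D_(e a) T x *m E^T.
Proof.
move=> Ux; have := derive_eq_on (e a) Ux slope_eq.
rewrite (derive_mulmx _ oU sC sZ Ux).
rewrite (derive_mulmx _ oU sT (smoothmx_cst P^T oU) Ux) (derive_mulmx _ oU sT (smoothmx_cst E^T oU)
  Ux).
by rewrite !derive_mx_cst !mulmx0 !addr0.
Qed.

Lemma slope_derive2 x a b : U x ->
  'D_(e b) ('D_(e a) T) x *m P^T *m Z x + 'D_(e a) T x *m P^T *m Z1 b x +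
  ('D_(e b) T x *m P^T *m Z1 a x + T x *m P^T *m Z2 a b x) = 'D_(e b) ('D_(e a) T) x *m E^T.
Proof.
move=> Ux; have := derive_eq_on (e b) Ux (fun y Uy => @slope_derive1 y a Uy).
have sT1 := smoothmx_derive (e a) oU sT; have sZ1 := smoothmx_derive (e a) oU sZ.
have cst1 q (X : 'M[R]_(d, q)) (G : 'rV[R]_k -> 'M[R]_(1 + k, d)) : smoothmx U G ->
    'D_(e b) (fun y => G y *m X) x = 'D_(e b) G x *m X.
  by move=> sG; rewrite (derive_mulmx _ oU sG (smoothmx_cst X oU) Ux) derive_mx_cst mulmx0 addr0.
have sT1P : smoothmx U (fun y => 'D_(e a) T y *m P^T) := smoothmx_mul oU sT1 (smoothmx_cst P^T oU).
rewrite (derive_mxD _ (smoothmx_mul oU sT1P sZ) (smoothmx_mul oU sC sZ1) Ux).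
by rewrite (derive_mulmx _ oU sT1P sZ Ux) (derive_mulmx _ oU sC sZ1 Ux) !cst1.
Qed.

Lemma derive2_cone_frame x a b : U x ->
  'D_(e b) ('D_(e a) T) x = col_mx (row b (J1 a x)) (J2 a b x).
Proof.
move=> Ux; have sJ1 := smoothmx_derive (e a) oU sJ.
rewrite (derive_eq_on (e b) Ux (fun y Uy => @derive_cone_frame y a Uy)).
by rewrite (derive_col_mx _ oU (smoothmx_row a oU sJ) sJ1 Ux) (derive_row _ _ oU sJ Ux) frame1_sym.
Qed.

Lemma inv_metricE x : U x -> gi x *m (J x *m (J x)^T) = 1%:M.
Proof. by move=> Ux; rewrite mulVmx ?uJ. Qed.

Lemma derive_inv_metric x c : U x ->
  'D_(e c) gi x *m (J x *m (J x)^T) + gi x *m (J1 c x *m (J x)^T + J x *m (J1 c x)^T) = 0.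
Proof.
move=> Ux; have := derive_eq_on (e c) Ux inv_metricE.
rewrite (derive_mulmx _ oU sgi smoothmx_metric Ux) derive_mx_cst.
by rewrite (derive_mulmx _ oU sJ (smoothmx_tr oU sJ) Ux) (derive_tr _ oU sJ Ux).
Qed.

Lemma derive_mxsum (I : finType) p q (G : I -> 'rV[R]_k -> 'M[R]_(p, q)) x v :
  (forall i, smoothmx U (G i)) -> U x ->
  'D_v (fun y => \sum_i G i y) x = \sum_i 'D_v (G i) x.
Proof.
move=> sG Ux; apply/matrixP => r c.
rewrite (derive_entry _ _ _ (smoothmx_sum _ sG) Ux) summxE.
have -> : (fun y => (\sum_i G i y) r c) = (fun y => \sum_i G i y r c).
  by apply/funext => y; rewrite summxE.
rewrite derive_bigsum; last by move=> i; exact: smooth_derivable (sG i r c) Ux.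
by apply: eq_bigr => i _; rewrite (derive_entry _ _ _ (sG i) Ux).
Qed.

Hypothesis minB : forall x, U x -> mu x *m B x = 0.

Lemma derive_minimal x c : U x ->
  (\sum_a (row a ('D_(e c) gi x) *m J1 a x + row a (gi x) *m J2 c a x)) *m B x
    - mu x *m P^T *m Z1 c x = 0.
Proof.
move=> Ux; have := derive_eq_on (e c) Ux minB.
have sB : smoothmx U B.
  apply: (@smoothmx_ext _ _ _ _ _ (fun x => E^T + (- P^T) *m Z x)) => //.
    by move=> y _; rewrite mulNmx.
  exact: smoothmxD oU (smoothmx_cst _ oU) (smoothmx_mul oU (smoothmx_cst _ oU) sZ).
have dB : 'D_(e c) B x = - (P^T *m Z1 c x).
  rewrite (@derive_eq_on _ _ B (fun x => E^T + (- P^T) *m Z x) x) //; last first.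
    by move=> y _; rewrite mulNmx.
  have sPZ := smoothmx_mul oU (smoothmx_cst (- P^T) oU) sZ.
  rewrite (derive_mxD _ (smoothmx_cst E^T oU) sPZ Ux) derive_mx_cst add0r.
  by rewrite (derive_mulmx _ oU (smoothmx_cst (- P^T) oU) sZ Ux) derive_mx_cst mul0mx add0r mulNmx.
rewrite (derive_mulmx _ oU smu sB Ux) derive_mx_cst dB mulmxN mulmxA => <-; congr (_ *m _ - _).
have sterm a : smoothmx U (fun y => row a (gi y) *m J1 a y).
  exact: smoothmx_mul oU (smoothmx_row _ oU sgi) (smoothmx_derive _ oU sJ).
rewrite (derive_mxsum _ sterm Ux); apply: eq_bigr => a _.
rewrite (derive_mulmx _ oU (smoothmx_row a oU sgi) (smoothmx_derive (e a) oU sJ) Ux).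
have E1 := esym (derive_row (e c) a oU sgi Ux); have E2 := frame2_comm c a Ux.
exact: (f_equal2 (fun X Y => X *m J1 a x + row a (gi x) *m Y) E1 E2).
Qed.

Lemma unit_slope_gram x : S x \in unitmx.
Proof. exact: unitmx_one_plus_gram. Qed.

Lemma unit_slope_gram_tr x : 1%:M + (Z x)^T *m Z x \in unitmx.
Proof. by have := unitmx_one_plus_gram (Z x)^T; rewrite trmxK. Qed.

Definition slope_gram1 a x := Z1 a x *m (Z x)^T + Z x *m (Z1 a x)^T.
Definition slope_gram2 a b x :=
  (Z2 a b x *m (Z x)^T + Z1 a x *m (Z1 b x)^T) + (Z1 b x *m (Z1 a x)^T + Z x *m (Z2 a b x)^T).
Local Notation S1 := slope_gram1.
Local Notation S2 := slope_gram2.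
Local Notation K x := (invmx (S x)).

Let sZ1 a := smoothmx_derive (e a) oU sZ.
Let sZt := smoothmx_tr oU sZ.
Let sZ1t a := smoothmx_tr oU (sZ1 a).
Let sK : smoothmx U (fun x => K x) := smoothmx_invmx oU sS (fun x _ => unit_slope_gram x).

Lemma derive_slope_gram x a : U x -> 'D_(e a) S x = S1 a x.
Proof.
move=> Ux; rewrite (derive_mxD _ (smoothmx_cst 1%:M oU) (smoothmx_mul oU sZ sZt) Ux)
  derive_mx_cst add0r.
by rewrite (derive_mulmx _ oU sZ sZt Ux) (derive_tr _ oU sZ Ux).
Qed.

Lemma derive2_slope_gram x a b : U x -> 'D_(e b) (S1 a) x = S2 a b x.
Proof.
move=> Ux.
have p1 := smoothmx_mul oU (sZ1 a) sZt; have p2 := smoothmx_mul oU sZ (sZ1t a).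
rewrite (derive_mxD _ p1 p2 Ux) (derive_mulmx _ oU (sZ1 a) sZt Ux) (derive_mulmx _ oU sZ (sZ1t a)
  Ux).
by rewrite (derive_tr _ oU sZ Ux) (derive_tr _ oU (sZ1 a) Ux).
Qed.

Lemma derive_inv_slope_gram x b : U x -> 'D_(e b) (fun y => K y) x *m S x + K x *m S1 b x = 0.
Proof.
move=> Ux; have h y : U y -> K y *m S y = 1%:M by move=> _; rewrite mulVmx// unit_slope_gram.
have := derive_eq_on (e b) Ux h.
by rewrite (derive_mulmx _ oU sK sS Ux) derive_mx_cst (derive_slope_gram b Ux).
Qed.

Lemma derive_slope_det x a : U x -> 'D_(e a) slope_det x = slope_det x * \tr (K x *m S1 a x).
Proof.
move=> Ux; rewrite (derive_det _ oU sS Ux) (derive_slope_gram a Ux).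
have dS : \det (S x) != 0 by have := unit_slope_gram x; rewrite unitmxE unitfE.
rewrite /invmx unit_slope_gram -scalemxAl mxtraceZ mulrA mulfV//.
by rewrite mul1r.
Qed.

Lemma smooth_trace p (A : 'rV[R]_k -> 'M[R]_p) : smoothmx U A -> smooth U (fun x => \tr (A x)).
Proof. by move=> sA; apply: smooth_sum => // i _; exact: sA. Qed.

Lemma derive_trace p (A : 'rV[R]_k -> 'M[R]_p) x v : smoothmx U A -> U x ->
  'D_v (fun y => \tr (A y)) x = \tr ('D_v A x).
Proof.
move=> sA Ux; rewrite /mxtrace derive_bigsum; last by move=> i; exact: smooth_derivable (sA i i) Ux.
by apply: eq_bigr => i _; rewrite (derive_entry _ _ _ sA Ux).
Qed.

Lemma derive2_slope_det x a b : U x ->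
  'D_(e b) ('D_(e a) slope_det) x = 'D_(e b) slope_det x * \tr (K x *m S1 a x) +
    slope_det x * \tr ('D_(e b) (fun y => K y) x *m S1 a x + K x *m S2 a b x).
Proof.
move=> Ux.
have sS1 : smoothmx U (S1 a).
  exact: smoothmxD oU (smoothmx_mul oU (sZ1 a) sZt) (smoothmx_mul oU sZ (sZ1t a)).
have sKS := smoothmx_mul oU sK sS1; have st := smooth_trace sKS.
have -> : 'D_(e b) ('D_(e a) slope_det) x = 'D_(e b) (slope_det * (fun y => \tr (K y *m S1 a y))) x.
  by apply: near_eq_derive; apply: open_near oU Ux _ => y Uy; exact: derive_slope_det.
have d1 : derivable slope_det x (e b) := smooth_derivable smooth_slope_det Ux.
have d2 : derivable (fun y => \tr (K y *m S1 a y)) x (e b) := smooth_derivable st Ux.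
rewrite (deriveM d1 d2) scale_addC.
by rewrite (derive_trace _ sKS Ux) (derive_mulmx _ oU sK sS1 Ux) (derive2_slope_gram a b Ux).
Qed.

Hypotheses (PP : P *m P^T = 1%:M) (EE : E *m E^T = 1%:M) (EP : E *m P^T = 0).
Hypothesis PE1 : P^T *m P + E^T *m E = 1%:M.

(* Its Gram matrix is the inverse metric: the Laplacian becomes a sum of squares
   of vector fields without extracting a square root. *)
Definition grad_frame x : 'M[R]_(d, k) := (J x)^T *m gi x.
(** The contraction of the Christoffel symbols with the inverse metric, so that
    [elliptic_op grad_frame drift] is the Laplace-Beltrami operator. *)
Definition drift x : 'rV[R]_k := mu x *m (J x)^T *m gi x.

Lemma laplacian_slope_det x : U x ->
  \sum_a \sum_b gi x a b * 'D_(e b) ('D_(e a) slope_det) x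
  - \sum_a drift x 0 a * 'D_(e a) slope_det x =
  2 * slope_det x * \sum_a \sum_b gi x a b * slope_form (Z x) (Z1 a x) (Z1 b x).
Proof.
move=> Ux; have CZ1 a := slope_derive1 a Ux.
have CZ1' a : col_mx (row a (J x)) (J1 a x) *m P^T *m Z x + T x *m P^T *m Z1 a x =
    col_mx (row a (J x)) (J1 a x) *m E^T by rewrite -(derive_cone_frame a Ux); exact: CZ1.
have CZ2' a b : col_mx (row b (J1 a x)) (J2 a b x) *m P^T *m Z x +
    col_mx (row a (J x)) (J1 a x) *m P^T *m Z1 b x +
    (col_mx (row b (J x)) (J1 b x) *m P^T *m Z1 a x + T x *m P^T *m Z2 a b x) =
    col_mx (row b (J1 a x)) (J2 a b x) *m E^T.
  have := slope_derive2 a b Ux.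
  by rewrite (derive2_cone_frame a b Ux) (derive_cone_frame a Ux) (derive_cone_frame b Ux).
have LZ := harmonic_slope PP EE EP PE1 (f_unit Ux) (f_perp_frame Ux) (inv_metricE Ux)
  (uC Ux) (unit_slope_gram x) (unit_slope_gram_tr x) (slope_eq Ux) CZ1' CZ2'
  (fun c => derive_inv_metric c Ux) (fun a b => frame1_sym a b Ux)
  (fun a b c => frame2_sym a b c Ux) (minB Ux) (fun c => derive_minimal c Ux).
have D2E a b := derive2_slope_det a b Ux.
rewrite -(laplacian_det (unit_slope_gram x) (unit_slope_gram_tr x)
  (K1 := fun b => 'D_(e b) (fun y => K y) x) (D := slope_det x)
  (D1 := fun a => 'D_(e a) slope_det x) (fun b => derive_inv_slope_gram b Ux)
  (fun a => derive_slope_det a Ux) LZ).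
congr (_ - _); apply: eq_bigr => a _; apply: eq_bigr => b _; congr (_ * _).
exact: D2E.
Qed.

Lemma sum_basis_vec (w : 'rV[R]_k) : w = \sum_a w 0 a *: e a.
Proof. exact: row_sum_delta. Qed.

Lemma derive2_basis (g : 'rV[R]_k -> R) w x : smooth U g -> U x ->
  'D_w ('D_w g) x = \sum_a \sum_b w 0 a * w 0 b * 'D_(e b) ('D_(e a) g) x.
Proof.
move=> sg Ux.
have d1 y : U y -> 'D_w g y = \sum_a w 0 a * 'D_(e a) g y.
  move=> Uy; rewrite {1}(sum_basis_vec w); apply: derive_sumv; exact: smooth_differentiable sg Uy.
rewrite (near_eq_derive _ (open_near oU Ux d1)).
have sa a : smooth U (fun y => w 0 a * 'D_(e a) g y).
  exact: smoothM oU (smooth_cst _ oU) (smooth_derive _ sg).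
rewrite derive_bigsum; last by move=> a; exact: smooth_derivable (sa a) Ux.
apply: eq_bigr => a _.
have da : derivable ('D_(e a) g) x w := smooth_derivable (smooth_derive (e a) sg) Ux.
have -> : 'D_w (fun y => w 0 a * 'D_(e a) g y) x = w 0 a * 'D_w ('D_(e a) g) x.
  exact: (deriveZ (w 0 a) da).
have dd := smooth_differentiable (smooth_derive (e a) sg) Ux.
have -> : 'D_w ('D_(e a) g) x = \sum_b w 0 b * 'D_(e b) ('D_(e a) g) x.
  by rewrite {1}(sum_basis_vec w); exact: derive_sumv.
by rewrite mulr_sumr; apply: eq_bigr => b _; rewrite mulrA.
Qed.

Lemma inv_metric_sym x : U x -> (gi x)^T = gi x.
Proof. by move=> Ux; exact: inverse_metric_sym (inv_metricE Ux). Qed.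

Lemma grad_frame_gram x : U x -> (grad_frame x)^T *m grad_frame x = gi x.
Proof.
move=> Ux; rewrite /grad_frame trmx_mul trmxK (inv_metric_sym Ux).
by rewrite -!mulmxA (mulmxA (J x)) mulmxV ?uJ// mulmx1.
Qed.

Lemma elliptic_op_slope_det x : U x ->
  elliptic_op grad_frame drift slope_det x =
  2 * slope_det x * \sum_a \sum_b gi x a b * slope_form (Z x) (Z1 a x) (Z1 b x).
Proof.
move=> Ux; rewrite -(laplacian_slope_det Ux) /elliptic_op; congr (_ - _); last first.
  rewrite {1}(sum_basis_vec (drift x)); apply: derive_sumv.
  exact: smooth_differentiable smooth_slope_det Ux.
have D2 s := derive2_basis (row s (grad_frame x)) smooth_slope_det Ux.
rewrite (eq_bigr _ (fun s _ => D2 s)) exchange_big/=; apply: eq_bigr => a _.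
rewrite exchange_big/=; apply: eq_bigr => b _; rewrite -mulr_suml; congr (_ * _).
rewrite -(grad_frame_gram Ux) mxE; apply: eq_bigr => s _.
by rewrite !mxE.
Qed.

(** The cone has one direction more than [M]: [H] gives index 0 to the radial one, along which the
    slope is constant. The Gram matrix of the cone frame is block diagonal, so this index adds
    nothing to the form, but it supplies the null vector for the equality case. *)
Lemma slope_det_laplacian_ge0 x : U x -> 0 < slope_det x <= 9 ->
  0 <= elliptic_op grad_frame drift slope_det x /\
  (elliptic_op grad_frame drift slope_det x = 0 ->
    (forall a, J1 a x *m B x = 0) \/ f x *m E^T = 0).
Proof.
move=> Ux /andP[D0 D9]; have [M1 [M2 [l [M1E M2E ME lE]]]] := adapted_frames_exist (Z x) (uC Ux).
pose H (i : 'I_(1 + k)) : 'M[R]_(1 + k, m) :=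
  if fintype.split i is inr a then T x *m P^T *m Z1 a x else 0.
have H0 : H (lshift k 0) = 0.
  by rewrite /H; case: (split_ordP (lshift k 0)) => // j /eqP; rewrite eq_lrshift.
have Ha a : H (rshift 1 a) = T x *m P^T *m Z1 a x.
  rewrite /H; case: (split_ordP (rshift 1 a)) => j /eqP; first by rewrite eq_rlshift.
  by rewrite eq_rshift => /eqP->.
have CZ1 a : T x *m P^T *m Z1 a x = col_mx 0 (J1 a x *m B x).
  have JB : J x *m B x = 0.
    have := frame_slope_normal (slope_eq Ux); rewrite mul_col_mx => /(congr1 dsubmx).
    by rewrite col_mxKd linear0.
  have -> : T x *m P^T *m Z1 a x = 'D_(e a) T x *m B x.
    by rewrite /normal_frame mulmxBr mulmxA -(slope_derive1 a Ux) addrC addKr.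
  by rewrite (derive_cone_frame a Ux) mul_col_mx -row_mul JB linear0.
have Hsym i j : row i (H j) = row j (H i).
  case: (split_ordP i) => i' ->; case: (split_ordP j) => j' ->;
    rewrite ?(ord1 i') ?(ord1 j') ?H0 ?Ha.
  - by [].
  - by rewrite CZ1 rowKu !linear0.
  - by rewrite CZ1 rowKu !linear0.
  - have r a b : row (rshift 1 a) (T x *m P^T *m Z1 b x) = row a (J1 b x) *m B x.
      by rewrite CZ1 rowKd row_mul.
    exact: (etrans (r i' j') (etrans (congr1 (mulmxr (B x)) (frame1_sym i' j' Ux))
      (esym (r j' i')))).
have uG : T x *m P^T *m (1%:M + Z x *m (Z x)^T)
  *m (T x *m P^T)^T = block_mx 1%:M 0 0 (J x *m (J x)^T).
  by rewrite -(gram_graphE PP EE EP PE1 (slope_eq Ux));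
    exact: gram_col_mx (f_unit Ux) (f_perp_frame Ux).
have [uB iG] := invmx_block_diag1 (inv_metricE Ux).
rewrite uG iG in M1E.
have l9 : \prod_i (1 + l 0 i ^+ 2) <= 9 by rewrite lE.
have := slope_form_sum_ge0 (uC Ux) (unit_slope_gram x) (unit_slope_gram_tr x) _ M2E ME Hsym l9.
rewrite -/(S x) uG iG => /(_ M1E).
have iCH a : invmx (T x *m P^T) *m H (rshift 1 a) = Z1 a x by rewrite Ha (mulKmx (uC Ux)).
have s0 Y : slope_form (Z x) 0 Y = 0.
  by rewrite /slope_form mulmx0 !mul0mx mxtrace0 mul0r mulr0 !addr0.
have -> : \sum_a \sum_b block_mx 1%:M 0 0 (gi x) a b *
    slope_form (Z x) (invmx (T x *m P^T) *m H a) (invmx (T x *m P^T) *m H b) =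
    \sum_a \sum_b gi x a b * slope_form (Z x) (Z1 a x) (Z1 b x).
  rewrite big_split_ord/= [X in X + _]big1 ?add0r => [|i _]; last first.
    by rewrite (ord1 i) big1// => j _; rewrite H0 mulmx0 s0 mulr0.
  apply: eq_bigr => a _; rewrite big_split_ord/= [X in X + _]big1 ?add0r => [|i _]; last first.
    by rewrite block_mxEdl mxE mul0r.
  apply: eq_bigr => b _; rewrite block_mxEdr.
  exact: (f_equal2 (fun X Y => gi x a b * slope_form (Z x) X Y) (iCH a) (iCH b)).
move=> [Q0 Qeq]; rewrite (elliptic_op_slope_det Ux).
have D20 : 0 < 2 * slope_det x by rewrite mulr_gt0.
split; first by rewrite pmulr_rge0.
move/eqP; rewrite mulf_eq0 gt_eqF//= => /eqP/Qeq/(_ (delta_mx 0 (lshift k 0))) [b|h0|h0].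
- by rewrite -rowE; case: (split_ordP b) => b' ->;
  rewrite ?(ord1 b') ?H0 ?linear0// Ha CZ1 rowKu linear0.
- left=> a; have := h0 (rshift 1 a); rewrite Ha CZ1 => /(congr1 dsubmx).
  by rewrite col_mxKd linear0.
right; move: h0; rewrite -mulmxA (slope_eq Ux) -rowE row_mul.
by rewrite (_ : row (lshift k 0) (T x) = f x)//; rewrite rowKu; apply/rowP => j; rewrite mxE.
Qed.

End chart.

Lemma dist_lt_norm_neq0 (K : numDomainType) (u v : K) : `|u - v| < `|u| -> v <> 0.
Proof. by move=> + v0; rewrite v0 subr0 ltxx. Qed.

Lemma mx0E (V : nmodType) p q i j : (0 : 'M[V]_(p, q)) i j = 0.
Proof. by rewrite mxE. Qed.

(** * Vanishing of the normal second derivatives in a chart *)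

Section chart_rigidity.
Variables (R : realType) (k m d : nat).
Variables (U : set 'rV[R]_k) (f : 'rV[R]_k -> 'rV[R]_d).
Variables (P : 'M[R]_(1 + k, d)) (E : 'M[R]_(m, d)).
Hypothesis oU : open U.
Hypothesis sf : smoothmx U f.
Hypothesis ff : forall x, U x -> dotp (f x) (f x) = 1.
Hypothesis uJ : forall x, U x -> tangent_frame f x *m (tangent_frame f x)^T \in unitmx.
Hypothesis uC : forall x, U x -> cone_frame f x *m P^T \in unitmx.
Hypothesis minB : forall x, U x -> frame_laplacian f x *m normal_frame f P E x = 0.
Hypotheses (PP : P *m P^T = 1%:M) (EE : E *m E^T = 1%:M) (EP : E *m P^T = 0).
Hypothesis PE1 : P^T *m P + E^T *m E = 1%:M.
Local Notation D := (slope_det f P E).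
Local Notation L := (elliptic_op (grad_frame f) (drift f)).
Local Notation J := (tangent_frame f).
Local Notation e := (@basis_vec R k).
Hypothesis D9 : forall x, U x -> 0 < D x <= 9.

(** The operator is elliptic because [grad_frame] has the invertible Gram matrix [inv_metric]. *)
Lemma slope_det_local_max x : U x -> (\forall y \near x, D y <= D x) ->
  \forall y \near x, D y = D x.
Proof.
have sJ := smoothmx_frame oU sf; have sgi := smoothmx_inv_metric oU sf uJ.
have sW : smoothmx U (grad_frame f) := smoothmx_mul oU (smoothmx_tr oU sJ) sgi.
have sc : smoothmx U (drift f).
  exact: smoothmx_mul oU (smoothmx_mul oU (smoothmx_frame_laplacian oU sf uJ) (smoothmx_tr oU sJ))
    sgi.
move=> Ux; refine (strong_max_principle oU (smooth_slope_det E oU sf uC) Ux sW sc _ _).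
  move=> y v Uy v0; have -> : \sum_s dotp (row s (grad_frame f y)) v ^+ 2 =
      dotp (v *m (grad_frame f y)^T) (v *m (grad_frame f y)^T).
    rewrite dotpE; apply: eq_bigr => s _; rewrite expr2.
    suff -> : (v *m (grad_frame f y)^T) 0 s = dotp (row s (grad_frame f y)) v by [].
    by rewrite mxE dotpE; apply: eq_bigr => l _; rewrite !mxE mulrC.
  rewrite dotp_gt0; apply: contra_neq v0 => v0.
  have : v *m (grad_frame f y)^T *m (grad_frame f y) = 0 by rewrite v0 mul0mx.
  rewrite -mulmxA (grad_frame_gram uJ Uy) => /(congr1 (mulmxr (J y *m (J y)^T))).
  by rewrite /= mul0mx mulmxKV// uJ.
move=> y Uy.
by have [] := slope_det_laplacian_ge0 oU sf ff uJ uC minB PP EE EP PE1 Uy (D9 Uy).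
Qed.

Hypothesis Dconst : forall x, U x -> \forall y \near x, D y = D x.

Lemma elliptic_op_const x : U x -> L D x = 0.
Proof.
have D1 w y : U y -> 'D_w D y = 0.
  by move=> Uy; rewrite (near_eq_derive w (Dconst Uy)) derive_cst.
have D2 w y : U y -> 'D_w ('D_w D) y = 0.
  move=> Uy; rewrite (near_eq_derive w (open_near oU Uy (D1 w))); exact: derive_cst.
move=> Ux; rewrite /elliptic_op D1// subr0 big1// => s _; exact: D2.
Qed.

(** The alternative following from a zero Laplacian is only pointwise. But a nonzero entry at [x]
    stays nonzero nearby, which selects [f y *m E^T = 0] on a whole neighbourhood; this can be
    differentiated twice, while the slope is 0 at [x] and the normal frame there is [E^T]. *)
Lemma normal_second_derivative0 x a : U x -> 'D_(e a) J x *m normal_frame f P E x = 0.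
Proof.
move=> Ux; apply: contrapT => /eqP nz.
have sJ := smoothmx_frame oU sf.
have sG : smoothmx U (fun y => 'D_(e a) J y *m normal_frame f P E y).
  apply: smoothmx_mul => //; first exact: smoothmx_derive oU sJ.
  apply: (@smoothmx_ext _ _ _ _ _ (fun x => E^T + (- P^T) *m slope f P E x)) => //.
    by move=> y _; rewrite mulNmx.
  by apply: smoothmxD => //; [exact: smoothmx_cst|apply: smoothmx_mul => //;
    [exact: smoothmx_cst|exact: smoothmx_slope E oU sf uC]].
have [i [j ij]] : exists i j, ('D_(e a) J x *m normal_frame f P E x) i j != 0.
  apply: contrapT => H; move/eqP: nz; apply; apply/matrixP => i j; rewrite [RHS]mxE.
  by apply: contrapT => /eqP h; apply: H; exists i, j.
have ij0 : 0 < `|('D_(e a) J x *m normal_frame f P E x) i j| by rewrite normr_gt0.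
have cG := smooth_continuous (sG i j) Ux.
have nE : \forall y \near x, U y /\ f y *m E^T = 0.
  move/cvgrPdist_lt: cG => /(_ _ ij0) cG.
  apply: filterS2 (open_near oU Ux (fun _ h => h)) cG => y Uy yij; split=> //.
  have [_ /(_ (elliptic_op_const Uy))[h|//]] :=
    slope_det_laplacian_ge0 oU sf ff uJ uC minB PP EE EP PE1 Uy (D9 Uy).
  have h0 := etrans (congr1 (fun X : 'M[R]_(k, m) => X i j) (h a)) (@mx0E R k m i j).
  exact: False_ind (dist_lt_norm_neq0 yij h0).
have JE y : (\forall z \near y, U z /\ f z *m E^T = 0) -> J y *m E^T = 0.
  move=> nz'; have Uy : U y := (nbhs_singleton nz').1.
  apply/row_matrixP => b; rewrite row_mul linear0 -derive_f.
  have -> : 'D_(e b) f y *m E^T = 'D_(e b) (fun z => f z *m E^T) y.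
    by rewrite (derive_mulmx _ oU sf (smoothmx_cst E^T oU) Uy) derive_mx_cst mulmx0 addr0.
  rewrite (@near_eq_derive _ _ _ _ (cst 0)) ?derive_cst//.
  by apply: filterS nz' => z [].
have J1E : 'D_(e a) J x *m E^T = 0.
  have -> : 'D_(e a) J x *m E^T = 'D_(e a) (fun z => J z *m E^T) x.
    by rewrite (derive_mulmx _ oU sJ (smoothmx_cst E^T oU) Ux) derive_mx_cst mulmx0 addr0.
  rewrite (@near_eq_derive _ _ _ _ (cst 0)) ?derive_cst//.
  by apply: filterS (nbhs_interior nE) => z; exact: JE.
move/eqP: nz; apply.
have fE : f x *m E^T = 0 := (nbhs_singleton nE).2.
have Z0 : slope f P E x = 0.
  have TE : cone_frame f x *m E^T = 0 by rewrite mul_col_mx fE (JE _ nE) col_mx0.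
  by rewrite /slope TE mulmx0.
by rewrite /normal_frame /slope_normal Z0 mulmx0 subr0.
Qed.

End chart_rigidity.

(** * Second fundamental form in a chart *)

Lemma unitmx_row_gram (R : realType) (k d : nat) (J : 'M[R]_(k, d)) :
  row_free J -> J *m J^T \in unitmx.
Proof.
move=> fJ; rewrite -row_free_unit -kermx_eq0; apply/rowV0P => v /sub_kermxP vJ.
have /eqP : dotp (v *m J) (v *m J) = 0 by rewrite /dotp trmx_mul mulmxA -(mulmxA v) vJ mul0mx mxE.
rewrite dotp_eq0 => /eqP vJ0; apply: (row_free_inj fJ); by rewrite vJ0 mul0mx.
Qed.

Section graph_determinant.
Variables (R : fieldType) (n m : nat).
Variables (P T : 'M[R]_(n, n + m)) (E u : 'M[R]_(m, n + m)).
Hypotheses (PP : P *m P^T = 1%:M) (EE : E *m E^T = 1%:M) (EP : E *m P^T = 0).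
Hypothesis PE1 : P^T *m P + E^T *m E = 1%:M.
Hypotheses (uu : u *m u^T = 1%:M) (Tu : T *m u^T = 0).

(** Stacking [T] over [u], [P] over [u] and [P] over [E] gives square matrices. The first times the
    transpose of the second, and the second times that of the third, are block triangular; the third
    is orthogonal. Squaring removes the undetermined signs. *)
Lemma sqr_det_frame_coord : \det (T *m P^T) ^+ 2 = \det (T *m T^T) * \det (u *m E^T) ^+ 2.
Proof.
have PE0 : P *m E^T = 0 := mulmx_tr0 EP.
have uT : u *m T^T = 0 := mulmx_tr0 Tu.
have h1 : \det (col_mx T u) * \det (col_mx P u) = \det (T *m P^T).
  rewrite -(det_tr (col_mx P u)) -det_mulmx tr_col_mx mul_col_row Tu uu.
  by rewrite det_lblock det1 mulr1.
have h2 : \det (col_mx P u) * \det (col_mx P E) = \det (u *m E^T).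
  rewrite -(det_tr (col_mx P E)) -det_mulmx tr_col_mx mul_col_row PE0 PP.
  by rewrite det_lblock det1 mul1r.
have h3 : \det (col_mx P E) ^+ 2 = 1.
  rewrite expr2 -{2}(det_tr (col_mx P E)) -det_mulmx tr_col_mx mul_col_row PE0 PP EE EP.
  by rewrite -scalar_mx_block det1.
have h4 : \det (col_mx T u) ^+ 2 = \det (T *m T^T).
  rewrite expr2 -{2}(det_tr (col_mx T u)) -det_mulmx tr_col_mx mul_col_row Tu uT uu.
  by rewrite det_lblock det1 mulr1.
by rewrite -h1 -h2 -h4 !exprMn h3 mulr1.
Qed.

Hypotheses (uTT : T *m T^T \in unitmx) (w0 : \det (u *m E^T) != 0).

Lemma unitmx_frame_coord : T *m P^T \in unitmx.
Proof.
rewrite unitmxE unitfE -sqrf_eq0 sqr_det_frame_coord mulf_neq0// ?sqrf_eq0//.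
by rewrite -unitfE -unitmxE.
Qed.

Lemma det_slope_gram (Z : 'M[R]_(n, m)) : T *m P^T *m Z = T *m E^T ->
  \det (1%:M + Z *m Z^T) = \det (u *m E^T) ^- 2.
Proof.
move=> CZ; have c0 : \det (T *m P^T) ^+ 2 != 0.
  by rewrite sqrf_eq0 -unitfE -unitmxE unitmx_frame_coord.
have := sqr_det_frame_coord; rewrite (gram_graphE PP EE EP PE1 CZ) !det_mulmx det_tr => h.
have w20 : \det (u *m E^T) ^+ 2 != 0 by rewrite sqrf_eq0.
apply: (mulIf w20); rewrite mulVf//; apply: (mulfI c0); rewrite mulr1 [RHS]h; ring.
Qed.

End graph_determinant.

Section normal_part.
Variables (R : realType) (k d m : nat) (f : 'rV[R]_d) (J : 'M[R]_(k, d)).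
Variables (amb : 'rV[R]_d).

(** The expression in [second_fundamental_form], with the ambient derivative and the Jacobian as
    parameters. *)
Definition normal_part : 'rV[R]_d :=
  let s := amb - dotp amb f *: f in s - s *m orth_proj J.

Lemma normal_part_mul (B : 'M[R]_(d, m)) : f *m B = 0 -> J *m B = 0 ->
  normal_part *m B = amb *m B.
Proof.
move=> fB JB; rewrite /normal_part /orth_proj mulmxBl -!mulmxA JB !mulmx0 subr0.
by rewrite mulmxBl -scalemxAl fB scaler0 subr0.
Qed.

Lemma normal_part_tangential : f *m f^T = 1%:M -> f *m J^T = 0 ->
  J *m J^T \in unitmx -> (exists (c : 'rV[R]_1) (b : 'rV[R]_k), amb = c *m f + b *m J) ->
  normal_part = 0.
Proof.
move=> ff fJ uJ [c [b ambE]].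
have JF : J *m f^T = 0 := mulmx_tr0 fJ.
have -> : normal_part = b *m J - b *m J *m orth_proj J.
  suff E : amb - dotp amb f *: f = b *m J by rewrite /normal_part E.
  rewrite /dotp ambE mulmxDl -!mulmxA ff JF mulmx0 addr0 mulmx1 -mul_scalar_mx.
  by rewrite -mx11_scalar addrC addKr.
by rewrite /orth_proj !mulmxA -(mulmxA b J) mulmxK// subrr.
Qed.

End normal_part.

Section chart_second_fundamental_form.
Variables (R : realType) (k m d : nat).
Variables (U : set 'rV[R]_k) (f : 'rV[R]_k -> 'rV[R]_d).
Variables (P : 'M[R]_(1 + k, d)) (E : 'M[R]_(m, d)).
Hypothesis oU : open U.
Hypothesis sf : smoothmx U f.
Hypothesis ff : forall x, U x -> dotp (f x) (f x) = 1.
Local Notation J := (tangent_frame f).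
Local Notation B := (normal_frame f P E).
Local Notation e := (@basis_vec R k).
Hypothesis uJ : forall x, U x -> J x *m (J x)^T \in unitmx.
Hypothesis uC : forall x, U x -> cone_frame f x *m P^T \in unitmx.

Lemma mul_f_normal_frame x : U x -> f x *m B x = 0.
Proof.
move=> Ux; have := frame_slope_normal (slope_eq E uC Ux).
by rewrite mul_col_mx => /(congr1 usubmx); rewrite col_mxKu linear0.
Qed.

Lemma mul_tangent_normal_frame x : U x -> J x *m B x = 0.
Proof.
move=> Ux; have := frame_slope_normal (slope_eq E uC Ux).
by rewrite mul_col_mx => /(congr1 dsubmx); rewrite col_mxKd linear0.
Qed.

(** Multiplication by [B x] kills the radial and tangential corrections, which turns minimality into
    an equation on plain second derivatives of [f]. *)
Lemma trace_normal_part0 x : U x ->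
  \sum_a \sum_b inv_metric f x a b *:
    normal_part (f x) (J x) ('D_(e a) ('D_(e b) f) x) = 0 ->
  frame_laplacian f x *m B x = 0.
Proof.
move=> Ux H; have := congr1 (mulmxr (B x)) H; rewrite /= mul0mx => <-.
rewrite /frame_laplacian !mulmx_suml; apply: eq_bigr => a _.
rewrite mulmx_suml [row a _ *m _]mulmx_sum_row mulmx_suml; apply: eq_bigr => b _.
have np := normal_part_mul ('D_(e a) ('D_(e b) f) x) (mul_f_normal_frame Ux)
  (mul_tangent_normal_frame Ux).
have fr := frame_rowE oU sf a b Ux.
rewrite -!scalemxAl mxE; congr (_ *: _).
exact: (etrans (congr1 (mulmxr (B x)) fr) (esym np)).
Qed.

Hypotheses (PP : P *m P^T = 1%:M) (EE : E *m E^T = 1%:M) (EP : E *m P^T = 0).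
Hypothesis PE1 : P^T *m P + E^T *m E = 1%:M.

Lemma derive_frame_normal0 x v w : U x ->
  (forall a, 'D_(e a) J x *m B x = 0) -> 'D_v ('D_w f) x *m B x = 0.
Proof.
move=> Ux H; have sJ := smoothmx_frame oU sf.
have der y u : U y -> 'D_u f y = u *m J y.
  move=> Uy; apply/rowP => j; rewrite (derive_entry _ _ _ sf Uy) mxE.
  rewrite {1}(sum_basis_vec u) (derive_sumv _ _ (smooth_differentiable (sf 0 j) Uy)).
  by apply: eq_bigr => a _; rewrite mxE (derive_entry _ _ _ sf Uy).
have der2 u t : 'D_t ('D_u f) x = u *m 'D_t J x.
  rewrite (derive_eq_on oU t Ux (fun y Uy => der y u Uy)).
  by rewrite (derive_mulmx _ oU (smoothmx_cst u oU) sJ Ux) derive_mx_cst mul0mx add0r.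
have J1B : 'D_v J x *m B x = 0.
  apply/row_matrixP => b; rewrite row_mul linear0.
  rewrite -(derive_row _ _ oU sJ Ux).
  rewrite (derive_eq_on oU v Ux (fun y (Uy : U y) => esym (derive_f f y b))).
  have h := schwarz_mx oU v (e b) sf Ux.
  exact: (etrans (congr1 (mulmxr (B x)) (etrans h (der2 v (e b))))
    (etrans (esym (mulmxA _ _ _)) (etrans (congr1 (mulmx v) (H b)) (mulmx0 _ _)))).
exact: (etrans (congr1 (mulmxr (B x)) (der2 w v))
    (etrans (esym (mulmxA _ _ _)) (etrans (congr1 (mulmx w) J1B) (mulmx0 _ _)))).
Qed.

Lemma normal_part_derive0 x v w : U x ->
  (forall a, 'D_(e a) J x *m B x = 0) ->
  normal_part (f x) (J x) ('D_v ('D_w f) x) = 0.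
Proof.
move=> Ux H; have fJ := f_perp_frame oU sf ff Ux; have f1 := f_unit ff Ux.
apply: normal_part_tangential (uJ Ux) _ => //.
have tE := tangentialE PP EE EP PE1 f1 fJ (inv_metricE uJ Ux) (uC Ux)
  (unit_slope_gram f P E x) (unit_slope_gram_tr f P E x) (slope_eq E uC Ux)
  (derive_frame_normal0 v w Ux H).
by eexists; eexists; exact: tE.
Qed.

End chart_second_fundamental_form.

Lemma jacobian_tangent_frame (R : realType) (k d : nat) (U : set 'rV[R]_k)
    (f : 'rV[R]_k -> 'rV[R]_d) x :
  smooth_on U f -> U x -> 'J f x = tangent_frame f x.
Proof.
move=> sf Ux; have df := (sf 1%N).1 x Ux.
by apply/row_matrixP => a; rewrite rowE -(deriveEjacobian _ df) -derive_f.
Qed.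

(** * The compactness argument *)

(** The points of the segment where [g] equals [g 1] form a closed set by continuity and an open one
    by the second hypothesis, and 1 is among them. *)
Lemma segment_locally_constant (R : realType) (g : R -> R) :
  (forall t, 0 <= t <= 1 -> {for t, continuous g}) ->
  (forall t, 0 <= t <= 1 -> g t = g 1 -> \forall s \near t, g s = g t) -> g 0 = g 1.
Proof.
move=> cg lg; pose I01 := [set` `[0 : R, 1]].
have IE t : I01 t <-> 0 <= t <= 1 by rewrite /I01 /= in_itv.
pose B := [set t | I01 t /\ g t = g 1].
suff BE : B = I01.
  have : B 0 by rewrite BE; apply/IE; rewrite lexx ler01.
  by case.
apply: (@segment_connected R 0 1).
- by exists 1; split=> //; apply/IE; rewrite lexx ler01.
- exists (interior [set t | g t = g 1]); first exact: open_interior.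
  apply/seteqP; split=> t.
    move=> [It gt]; split=> //; rewrite /interior /=.
    by have := lg t (proj1 (IE t) It) gt; apply: filterS => s /= ->.
  by move=> [It gt]; split=> //; exact: (nbhs_singleton gt).
- exists (closure B); first exact: closed_closure.
  apply/seteqP; split=> t; first by move=> Bt; split; [exact: Bt.1|exact: subset_closure].
  move=> [It cB]; split=> //; apply: contrapT => /eqP gt.
  have ct := cg t (proj1 (IE t) It).
  have nb : nbhs (g t) [set y | y != g 1] by apply: open_nbhs_nbhs; split; [exact: open_neq|].
  have : \forall s \near t, g s != g 1 by exact: ct nb.
  by move/cB => [s [[_ gs]]] /=; rewrite gs eqxx.
Qed.

Section compact_maximum.
Variables (R : realType) (k : nat) (M : topologicalType) (A : oriented_atlas R k M).

(** [param i] is open at [x], because the patch is open and [coord i] is continuous on it. *)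
Lemma near_patch (p : M) : exists (i : chart A) x, [/\ dom i x, param i x = p &
  forall S : set 'rV[R]_k, nbhs x S -> \forall q \near p, exists y, [/\ S y,
    dom i y & q = param i y]].
Proof.
have [i [x Ux xp]] := patch_cover A p; exists i, x; split=> // S Sx.
have h1 : \forall q \near p, (param i @` dom i) q.
  by apply: open_nbhs_nbhs; split; [exact: patch_open|exists x].
have h2 : \forall q \near p, S (Defs.coord i q).
  have Sx' : nbhs (Defs.coord i (param i x)) S by rewrite (paramK Ux).
  by rewrite -xp; exact: (Defs.coord_continuous Ux) Sx'.
by apply: filterS2 h1 h2 => q [y Uy <-]; rewrite (paramK Uy) => Sy; exists y.
Qed.

Variable Phi : M -> R.
Hypothesis cM : compact [set: M].
Hypothesis cPhi : continuous Phi.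
Hypothesis max_constant : forall p,
  (\forall q \near p, Phi q <= Phi p) -> \forall q \near p, Phi q = Phi p.

(* M need not be connected: a maximum of Phi on the closed set of points around
   which Phi is not constant is a local maximum on M, because along a segment in
   a chart a value larger than this maximum could not change. *)
Lemma compact_max_constant p : \forall q \near p, Phi q = Phi p.
Proof.
pose W := [set p | \forall q \near p, Phi q = Phi p].
have oW : open W.
  rewrite openE => q Wq; rewrite /interior /=.
  apply: filterS2 Wq (nbhs_interior Wq) => s sq ss.
  by apply: filterS ss => r /= ->.
apply: contrapT => nW.
have cK : compact (~` W) := subclosed_compact (open_closedC oW) cM (@subsetT _ _).
have [p1 Kp1 pmax] : exists2 c, c \in ~` W & forall t, t \in ~` W -> Phi t <= Phi c.
  by apply: compact_EVT_max => //; [exists p|exact: continuous_subspaceT].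
move: Kp1; rewrite inE => Kp1; apply: (Kp1); apply: max_constant.
have [i [x [Ux xp near_p]]] := near_patch p1.
have [r r0 rU] : exists2 r : R, 0 < r & ball x r `<=` dom i.
  have /nbhs_ballP[r r0 rU] : nbhs x (dom i).
    by apply: open_nbhs_nbhs; split=> //; exact: dom_open.
  by exists r.
have xr : nbhs x (ball x r) by exact: nbhsx_ballx.
apply: filterS (near_p _ xr) => q [y [By Uy ->]].
rewrite leNgt; apply/negP => lt_q.
pose c (t : R) := x + t *: (y - x).
have cU t : 0 <= t <= 1 -> dom i (c t).
  move=> /andP[t0 t1]; apply: rU; move: By; rewrite -!ball_normE/= => By.
  rewrite /c opprD addNKr normrN normrZ (ger0_norm t0).
  by apply: le_lt_trans By; rewrite (distrC x) ler_piMl.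
have ccont t : {for t, continuous c}.
  apply: cvgD; first exact: cvg_cst.
  by apply: cvgZl; exact: cvg_id.
pose g t := Phi (param i (c t)).
have pc t : 0 <= t <= 1 -> {for t, continuous (fun t => param i (c t))}.
  by move=> t01; apply: (@continuous_comp _ _ _ c (param i)) => //;
    exact: param_continuous (cU t t01).
have g0 : g 0 = Phi p1 by rewrite /g /c scale0r addr0 xp.
have g1 : g 1 = Phi (param i y) by rewrite /g /c scale1r addrC subrK.
have := lt_q; rewrite -g1 -g0 (@segment_locally_constant R g) ?ltxx//.
  by move=> t t01; apply: (@continuous_comp _ _ _ _ Phi); [exact: pc|exact: cPhi].
(* [g t = g 1] exceeds the maximum of [Phi] over the complement of [W], so the point lies in [W],
   where [Phi] is locally constant. *)
move=> t t01 gt1; suff Wt : W (param i (c t)) by exact: (pc t t01 _ Wt).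
apply: contrapT => nWt; have : param i (c t) \in ~` W by rewrite inE.
by move/pmax; rewrite -/(g t) gt1 g1 leNgt lt_q.
Qed.

End compact_maximum.

Section compact_minimal_submanifold.
Variables (R : realType) (k m : nat) (M : topologicalType) (A : oriented_atlas R k M).
Variables (F : M -> 'rV[R]_(k.+1 + m)) (u : M -> 'M[R]_(m, k.+1 + m)).
Variables (E : 'M[R]_(m, k.+1 + m)) (P : 'M[R]_(1 + k, k.+1 + m)).
Hypotheses (cM : compact [set: M]) (immF : spherical_immersion A F) (minF : minimal A F).
Hypothesis nu : forall p, normal_plane A F p (u p).
Hypothesis u3 : forall p, 3^-1 <= \det (u p *m E^T).
Hypotheses (PP : P *m P^T = 1%:M) (EE : E *m E^T = 1%:M) (EP : E *m P^T = 0).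
Hypothesis PE1 : P^T *m P + E^T *m E = 1%:M.

(** The function [D] on [M] itself, independently of charts; [slope_det_chart] makes the
    identification. *)
Definition volume_ratio p : R := \det (u p *m E^T) ^- 2.

Lemma volume_ratio_bounds p : 0 < volume_ratio p <= 9.
Proof.
have w0 : 0 < \det (u p *m E^T) by apply: lt_le_trans (u3 p); rewrite invr_gt0.
rewrite /volume_ratio invr_gt0 exprn_gt0//= -[9]invrK lef_pV2 ?posrE ?invr_gt0 ?exprn_gt0//.
rewrite [X in X <= _](_ : _ = 3^-1 ^+ 2); first by
  rewrite ler_pXn2r ?nnegrE ?invr_ge0 ?(ltW w0)// ; exact: u3.
by rewrite exprVn; congr (_^-1); ring.
Qed.

Section in_chart.
Variable i : chart A.
Local Notation U := (dom i).
Local Notation f := (local_map F i).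

Lemma smoothmx_local_map : smoothmx U f.
Proof. by apply: smooth_on_smoothmx; [exact: dom_open|case: immF]. Qed.

Lemma local_map_unit x : U x -> dotp (f x) (f x) = 1.
Proof. by move=> _; case: immF => F1 _ _; exact: F1. Qed.

Lemma jacobian_local_map x : U x -> 'J f x = tangent_frame f x.
Proof. by move=> Ux; case: immF => _ sF _; exact: jacobian_tangent_frame (sF i) Ux. Qed.

Lemma unitmx_metric x : U x -> tangent_frame f x *m (tangent_frame f x)^T \in unitmx.
Proof.
by move=> Ux; apply: unitmx_row_gram; rewrite -(jacobian_local_map Ux); case: immF => _ _ ->.
Qed.

Lemma unitmx_cone_gram x : U x -> cone_frame f x *m (cone_frame f x)^T \in unitmx.
Proof.
move=> Ux; have oU := @dom_open _ _ _ A i.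
rewrite (gram_col_mx (f_unit local_map_unit Ux)
  (f_perp_frame oU smoothmx_local_map local_map_unit Ux)).
by have [] := invmx_block_diag1 (inv_metricE unitmx_metric Ux).
Qed.

Lemma cone_frame_normal x : U x -> cone_frame f x *m (u (param i x))^T = 0.
Proof.
move=> Ux; have [_ uF /(_ i x Ux erefl)[uJ _]] := nu (param i x).
rewrite -[LHS]trmxK trmx_mul trmxK tr_col_mx mul_mx_row -(jacobian_local_map Ux) uJ.
by rewrite uF row_mx0 trmx0.
Qed.

Lemma det_normal_neq0 p : \det (u p *m E^T) != 0.
Proof. by rewrite gt_eqF// (lt_le_trans _ (u3 p))// invr_gt0. Qed.

Lemma normal_orthonormal p : u p *m (u p)^T = 1%:M.
Proof. by have [] := nu p. Qed.

Lemma unitmx_chart_frame x : U x -> cone_frame f x *m P^T \in unitmx.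
Proof.
move=> Ux; exact: (@unitmx_frame_coord R (1 + k) m P _ E (u (param i x)) PP EE EP
  (normal_orthonormal _) (cone_frame_normal Ux) (unitmx_cone_gram Ux) (det_normal_neq0 _)).
Qed.

Lemma slope_det_chart x : U x -> slope_det f P E x = volume_ratio (param i x).
Proof.
move=> Ux; exact: (@det_slope_gram R (1 + k) m P _ E (u (param i x)) PP EE EP PE1
  (normal_orthonormal _) (cone_frame_normal Ux) (unitmx_cone_gram Ux) (det_normal_neq0 _)
  _ (slope_eq E unitmx_chart_frame Ux)).
Qed.

Lemma slope_det_bounds x : U x -> 0 < slope_det f P E x <= 9.
Proof. by move=> Ux; rewrite slope_det_chart// volume_ratio_bounds. Qed.

Lemma minimal_chart x : U x -> frame_laplacian f x *m normal_frame f P E x = 0.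
Proof.
move=> Ux; refine (trace_normal_part0 E (@dom_open _ _ _ A i)
  smoothmx_local_map unitmx_chart_frame Ux _).
have := minF Ux; rewrite /mean_curvature /metric /second_fundamental_form.
by rewrite (jacobian_local_map Ux).
Qed.

End in_chart.

Lemma volume_ratio_chart (i : chart A) x : dom i x ->
  \forall q \near param i x, volume_ratio q = slope_det (local_map F i) P E (Defs.coord i q).
Proof.
move=> Ux; have h : \forall q \near param i x, (param i @` dom i) q.
  by apply: open_nbhs_nbhs; split; [exact: patch_open|exists x].
apply: filterS h => q [y Uy <-]; by rewrite (paramK Uy) (slope_det_chart Uy).
Qed.

(** [u] picks a basis of each normal plane with no continuity in [p], so continuity is read off from
    [slope_det] in a chart. *)
Lemma volume_ratio_continuous : continuous volume_ratio.
Proof.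
move=> p; have [i [x [Ux <- _]]] := near_patch A p.
have sD := smooth_slope_det E (@dom_open _ _ _ A i) (@smoothmx_local_map i) (@unitmx_chart_frame i).
have cD := smooth_continuous sD Ux.
have c2 : {for param i x, continuous (slope_det (local_map F i) P E \o Defs.coord i)}.
  apply: continuous_comp; first exact: Defs.coord_continuous.
  by rewrite (paramK Ux); exact: cD.
have vE := volume_ratio_chart Ux; rewrite /continuous_at (nbhs_singleton vE).
apply: cvg_trans c2; apply: near_eq_cvg.
by apply: filterS vE => q ->.
Qed.

Lemma volume_ratio_max_constant p : (\forall q \near p, volume_ratio q <= volume_ratio p) ->
  \forall q \near p, volume_ratio q = volume_ratio p.
Proof.
have [i [x [Ux <- near_p]]] := near_patch A p => pmax; have oU := @dom_open _ _ _ A i.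
have pc := param_continuous Ux.
have Dmax : \forall y \near x, slope_det (local_map F i) P E y <= slope_det (local_map F i) P E x.
  have pm : \forall y \near x, volume_ratio (param i y) <= volume_ratio (param i x) := pc _ pmax.
  apply: filterS2 pm (open_near oU Ux (fun _ h => h)) => y h Uy.
  by rewrite (slope_det_chart Uy) (slope_det_chart Ux).
have := slope_det_local_max oU (@smoothmx_local_map i) (@local_map_unit i) (@unitmx_metric i)
  (@unitmx_chart_frame i) (@minimal_chart i) PP EE EP PE1 (@slope_det_bounds i) Ux Dmax.
move=> /near_p; apply: filterS => q [y [h Uy ->]].
by rewrite -(slope_det_chart Uy) -(slope_det_chart Ux).
Qed.

Lemma compact_minimal_totally_geodesic : totally_geodesic A F.
Proof.
move=> i x Ux v w; have oU := @dom_open _ _ _ A i.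
have Dconst y : dom i y -> \forall z \near y, slope_det (local_map F i) P E z =
    slope_det (local_map F i) P E y.
  move=> Uy; have pc := param_continuous Uy.
  have h := compact_max_constant A cM volume_ratio_continuous volume_ratio_max_constant (param i y).
  have ph : \forall z \near y, volume_ratio (param i z) = volume_ratio (param i y) := pc _ h.
  apply: filterS2 ph (open_near oU Uy (fun _ h => h)) => z vz Uz.
  by rewrite (slope_det_chart Uz) (slope_det_chart Uy).
have J1B := normal_second_derivative0 oU (@smoothmx_local_map i) (@local_map_unit i)
  (@unitmx_metric i) (@unitmx_chart_frame i) (@minimal_chart i) PP EE EP PE1
  (@slope_det_bounds i) Dconst.
rewrite /second_fundamental_form (jacobian_local_map Ux).
exact: (normal_part_derive0 oU (@smoothmx_local_map i) (@local_map_unit i)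
  (@unitmx_metric i) (@unitmx_chart_frame i) PP EE EP PE1 v w Ux (fun a => J1B x a Ux)).
Qed.

End compact_minimal_submanifold.

Lemma xget_orthonormal (R : realType) (m d : nat) (Q : set 'M[R]_(m, d)) :
  oriented_plane Q -> Defs.orthonormal (xget 0 Q).
Proof.
move=> [u0 u0o ->]; have : [set B *m u0 | B in special_orthogonal] u0.
  by exists 1%:M; rewrite ?mul1mx//; split; rewrite ?trmx1 ?mulmx1 ?det1.
move=> /(@xgetI _ 0)[B [BB _] <-].
by rewrite /Defs.orthonormal trmx_mul mulmxA -(mulmxA B) u0o mulmx1.
Qed.

(** An empty [N] would make [xget] return its default 0, whose determinant is 0 for positive [m]. In
    this way the lower bound assumed in the theorem itself provides a basis of each normal plane. *)
Lemma xget_plane_ip (R : realType) (m d : nat) (N Q : set 'M[R]_(m, d)) :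
  (0 < m)%N -> plane_ip N Q != 0 -> N (xget 0 N).
Proof.
move=> m0 ip0; apply: contrapT => nN; move/eqP: ip0; apply.
have -> : plane_ip N Q = \det (0 : 'M[R]_m).
  rewrite /plane_ip (_ : xget 0 N = 0) ?mul0mx//; apply: xgetPN => v Nv.
  by apply: nN; exact: xgetI Nv.
by case: m m0 {N Q nN} => // m' _; exact: det0.
Qed.
(* The dimension of M is k, so n = k.+1 ranges over the positive integers. *)
Theorem theorem1p2 (R : realType) (k m : nat) (m_gt0 : (0 < m)%N)
    (M : topologicalType) (A : oriented_atlas R k M)
    (F : M -> 'rV[R]_(k.+1 + m)) (Q0 : set 'M[R]_(m, k.+1 + m)) :
  hausdorff_space M -> compact [set: M] ->
  spherical_immersion A F -> minimal A F ->
  oriented_plane Q0 ->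
  (forall p : M, 3^-1 <= plane_ip (normal_plane A F p) Q0) ->
  totally_geodesic A F.
Proof.
move=> _ cM immF minF oQ h.
have EE := xget_orthonormal oQ; have [P [PP EP PE1]] := orthonormal_complement EE.
have nu p : normal_plane A F p (xget 0 (normal_plane A F p)).
  by apply: (@xget_plane_ip _ _ _ _ Q0) => //; rewrite gt_eqF// (lt_le_trans _ (h p))// invr_gt0.
exact: (@compact_minimal_totally_geodesic R k m M A F _ _ P cM immF minF nu h PP EE EP PE1).
Qed.
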